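(* Let $f$ be a function on $(0,\infty)$, let $z>0$, and let $\nu\in\mathbb{C}$ with $-1<\Re(\nu)<1/2$. If the integrals involved converge absolutely, then $$\mathscr{L}_{2}\bigg\{y^{2\nu-1}\,\mathscr{L}_{2}\Big\{f(x);\frac{1}{2y}\Big\};z\bigg\}=2^{-\nu-\frac{1}{2}}\,z^{-\nu-1}\,\mathscr{K}_{\nu+\frac{1}{2}}\big\{x^{\nu+1}f(x);z\big\},$$ $$\mathscr{L}_{2}\bigg\{y^{2\nu-1}\,\mathscr{L}_{2}\Big\{f(x);\frac{1}{2y}\Big\};z\bigg\}=\frac{\sqrt{\pi}}{2^{\nu+1}}\,z^{-\nu-\frac{1}{2}}\,\mathscr{H}_{\nu}\Big\{u^{\nu+\frac{1}{2}}\,\mathscr{G}\{x\,f(x);u\};z\Big\},$$ and $$\mathscr{K}_{\nu+\frac{1}{2}}\big\{x^{\nu+1}f(x);z\big\}=\Big(\frac{\pi z}{2}\Big)^{1/2}\,\mathscr{H}_{\nu}\Big\{u^{\nu+\frac{1}{2}}\,\mathscr{G}\{x\,f(x);u\};z\Big\}.$$ (In the left-hand sides of the first two identities the outer $\mathscr{L}_2$-transform is taken in the variable $y$ and evaluated at $z$; the Hankel transforms are taken in the variable $u$.)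
   Context: For a function $f$ on $(0,\infty)$ and $y>0$, the following transforms are used: the $\mathscr{L}_2$-transform $$\mathscr{L}_{2}\{f(x);y\}=\int_0^\infty x\,\exp(-x^{2}y^{2})\,f(x)\,dx;$$ the Glasser transform $$\mathscr{G}\{f(x);y\}=\int_{0}^{\infty}\frac{f(x)}{\sqrt{x^{2}+y^{2}}}\,dx;$$ the Hankel transform $$\mathscr{H}_{\nu}\{f(x);y\}=\int_{0}^{\infty}\sqrt{xy}\,\mathrm{J}_{\nu}(xy)\,f(x)\,dx,$$ where $\mathrm{J}_\nu$ is the Bessel function of the first kind of order $\nu$; and the $\mathscr{K}$-transform $$\mathscr{K}_{\nu}\{f(x);y\}=\int_{0}^{\infty}\sqrt{xy}\,\mathrm{K}_{\nu}(xy)\,f(x)\,dx,$$ where $\mathrm{K}_\nu$ is the modified Bessel function of the second kind (Macdonald function) of order $\nu$, normalized so that $\mathrm{K}_{1/2}(x)=\sqrt{\pi/(2x)}\,e^{-x}$. *)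

(* Defs.v *)
From HB Require Import structures.
From mathcomp Require Import all_boot all_order all_algebra.
From mathcomp Require Import ring lra complex.
From mathcomp Require Import all_classical all_reals all_analysis.
From mathcomp Require Import measurable_realfun.
Set Implicit Arguments.
Unset Strict Implicit.
Unset Printing Implicit Defensive.
Import Order.TTheory GRing.Theory Num.Theory.
Import numFieldNormedType.Exports.
Local Open Scope classical_set_scope.
Local Open Scope ring_scope.
Local Open Scope complex_scope.

Section complex_functions.
Context {R : realType}.
Implicit Types (x y t : R) (w s : R[i]) (g : R -> R[i]).

Definition cexp w : R[i] :=
  (expR (complex.Re w))%:C * (cos (complex.Im w) +i* sin (complex.Im w)).

Definition ccosh w : R[i] := (cexp w + cexp (- w)) / 2.

(* Principal value of x^s; meaningful for x > 0 only. *)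
Definition cpow x s : R[i] := cexp (s * (ln x)%:C).

(* Lebesgue integral over (0, oo) of a complex-valued function. *)
Definition cint g : R[i] :=
  (\int[lebesgue_measure]_(x in `]0%R, +oo[) complex.Re (g x))
  +i* (\int[lebesgue_measure]_(x in `]0%R, +oo[) complex.Im (g x)).

(* Absolute convergence of that integral: both components are measurable with
   integrable absolute value. *)
Definition cintegrable g : Prop :=
  lebesgue_measure.-integrable `]0%R, +oo[ (fun x => (complex.Re (g x))%:E) /\
  lebesgue_measure.-integrable `]0%R, +oo[ (fun x => (complex.Im (g x))%:E).

(* Euler's integral: this is Gamma(s) for Re s > 0 only. *)
Definition cGamma s : R[i] :=
  cint (fun t => cpow t (s - 1) * (expR (- t))%:C).

(* Sum of a series of complex numbers, componentwise. *)
Definition cseries (u : nat -> R[i]) : R[i] :=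
  limn (series (fun k => complex.Re (u k)))
  +i* limn (series (fun k => complex.Im (u k))).

(* Power series of J_nu for x > 0; the arguments nu + k + 1 of Gamma all have
   positive real part when -1 < Re nu. *)
Definition bessel_J (nu : R[i]) x : R[i] :=
  cpow (x / 2) nu *
  cseries (fun k : nat =>
    ((-1) ^+ k * (x / 2) ^+ (2 * k))%:C / (k`!%:R * cGamma (nu + k%:R + 1))).

(* Macdonald's integral K_mu(x) = int_0^oo exp(-x cosh t) cosh(mu t) dt, valid
   for x > 0 and every complex order mu; bessel_K_half below checks the
   normalization. *)
Definition bessel_K (mu : R[i]) x : R[i] :=
  cint (fun t => (expR (- x * ((expR t + expR (- t)) / 2)))%:C
                 * ccosh (mu * t%:C)).

End complex_functions.

Section bessel_K_normalization.
Context {R : realType}.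
Implicit Types (x y t w : R).
Local Notation G x t := (expR (- x * ((expR t + expR (- t)) / 2)) *
  ((expR (t / 2) + expR (- (t / 2))) / 2)).

Lemma bessel_K_half_integrand x t :
 (expR (- x * ((expR t + expR (- t)) / 2)))%:C * ccosh (1 / 2 * t%:C) = (G x t)%:C.
Proof.
have e u : cexp u%:C = (expR u)%:C :> R[i].
  by rewrite /cexp /= cos0 sin0 mulr1.
have h : 1 / 2 * t%:C = (t / 2)%:C :> R[i].
  by rewrite mul1r mulrC rmorphM fmorphV rmorph_nat.
by rewrite /ccosh h -rmorphN !e -rmorphD [in RHS]rmorphM [in RHS](rmorphM _ (_ + _)) fmorphV rmorph_nat.
Qed.

(* Substitution t = F w = 2 arsinh (a w). *)
Section arsinh_substitution.
Context (a : R).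
Context (a0 : 0 < a).
Let q w := Num.sqrt ((a * w) ^+ 2 + 1).
Let p w := a * w + q w.
Let F w := 2 * ln (p w).
Let q2 w : q w ^+ 2 = (a * w) ^+ 2 + 1.
Proof. by rewrite sqr_sqrtr// addr_ge0 ?sqr_ge0. Qed.

Let q1 w : 0 < q w.
Proof. by rewrite sqrtr_gt0 ltr_wpDl// sqr_ge0. Qed.

Let p0 w : 0 < p w.
Proof.
rewrite /p; have := q2 w; have := q1 w; move: (q w) (a * w) => u v; nra.
Qed.

Let dF w : is_derive w 1 F (2 * a / q w).
Proof.
have dp : is_derive w 1 p (a + (2 * q w)^-1 * (2 * a ^+ 2 * w)).
  apply: is_deriveD; first by apply: is_derive_eq; rewrite /GRing.scale/=; ring.
  apply: (@is_derive1_comp _ Num.sqrt (fun w => (a * w) ^+ 2 + 1)).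
    by apply: is_derive1_sqrt; rewrite ltr_wpDl// sqr_ge0.
  apply: is_derive_eq; rewrite /GRing.scale/=; ring.
have dl : is_derive w 1 (@ln R \o p) ((p w)^-1 * (a + (2 * q w)^-1 * (2 * a ^+ 2 * w))).
  by apply: is_derive1_comp; exact: is_derive1_ln.
apply: is_derive_eq; rewrite /GRing.scale/=.
have := p0 w; rewrite /p; have := q1 w; move: (q w) => u u0 uw0; field.
by rewrite !gt_eqF//= .
Qed.

Let expF w : expR (F w / 2) = p w.
Proof. by rewrite /F mulrC mulKf// lnK// posrE. Qed.

Let expFN w : expR (- (F w / 2)) = q w - a * w.
Proof.
rewrite expRN expF; apply: (mulfI (lt0r_neq0 (p0 w))); rewrite mulfV ?lt0r_neq0//.
rewrite /p; have := q2 w; move: (q w) => u; nra.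
Qed.

Let F' w : F^`()%classic w = 2 * a / q w.
Proof. by rewrite derive1E; apply: derive_val. Qed.

Let cF : continuous F.
Proof. move=> w; apply: differentiable_continuous; apply/derivable1_diffP; by have [] := dF w. Qed.

Let cq : continuous q.
Proof.
move=> w; apply: (@continuous_comp _ _ _ (fun w => (a * w) ^+ 2 + 1) Num.sqrt); last exact: sqrt_continuous.
by apply: differentiable_continuous; apply/derivable1_diffP.
Qed.

Let cF' : continuous F^`()%classic.
Proof.
rewrite (_ : F^`()%classic = fun w => 2 * a / q w); last by apply/funext => w; exact: F'.
move=> w; apply: cvgM; first exact: cvg_cst.
by apply: cvgV; [rewrite gt_eqF | exact: cq].
Qed.

Let qy : q w @[w --> +oo] --> +oo.
Proof.
apply: (@ger_cvgy _ _ _ _ (fun w => a * w)); last exact: gt0_cvgMry.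
near=> w.
have w0 : 0 <= a * w by rewrite mulr_ge0// ltW.
have := q2 w; have := q1 w; move: (q w) => u; nra.
Unshelve. all: by end_near. Qed.

Let F0 : F 0 = 0.
Proof. by rewrite /F /p /q mulr0 expr0n/= !add0r sqrtr1 ln1 mulr0. Qed.

Lemma integral_arsinh_subst (H : R -> R) : continuous H -> (forall t, 0 <= H t) ->
 (\int[lebesgue_measure]_(t in `[0%R, +oo[) (H t)%:E =
  \int[lebesgue_measure]_(w in `[0%R, +oo[) (H (F w) * (2 * a / q w))%:E)%E.
Proof.
move=> cH H0.
rewrite -{1}F0 (@increasing_ge0_integration_by_substitutiony _ F H 0).
- by apply: eq_integral => w _; rewrite -F'.
- move=> u v; rewrite !in_itv/= !andbT => u0 v0 uv.
  rewrite /F ltr_pM2l// ltr_ln ?posrE// /p.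
  rewrite ltr_leD//; first by rewrite ltr_pM2l.
  rewrite /q ler_sqrt ?addr_ge0 ?sqr_ge0//.
  by rewrite lerD2r lerXn2r ?nnegrE ?mulr_ge0 ?(ltW a0)// ler_pM2l// ltW.
- by move=> w _; exact: cF'.
- by apply/cvg_ex; exists (F^`()%classic 0); apply: cvg_at_right_filter; exact: cF'.
- apply/cvg_ex; exists (2 * a * 0).
  rewrite (_ : F^`()%classic = fun w => 2 * a * (q w)^-1); last by apply/funext => w; exact: F'.
  apply: cvgM; first exact: cvg_cst.
  apply/gtr0_cvgV0; last exact: qy.
  by near=> w.
- split; last by apply: cvg_at_right_filter; exact: cF.
  by move=> w _; by have [] := dF w.
- apply: gt0_cvgMry => //; apply/cvgryPge => A; near=> w.
  rewrite -[A]expRK ler_ln ?posrE ?expR_gt0//.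
  apply: (@le_trans _ _ (a * w)); last by rewrite /p lerDl ltW.
  rewrite -ler_pdivrMl//; near: w; apply: nbhs_pinfty_ge; exact: num_real.
- by apply: continuous_subspaceT.
- by [].
Unshelve. all: by end_near. Qed.

Lemma integrand_half_subst x w : 2 * x * a ^+ 2 = 1 -> G x (F w) * (2 * a / q w) = 2 * a * expR (- x) * gauss_fun w.
Proof.
move=> xa.
have -> : expR (F w) = (p w)^+2 by rewrite -expF expr2 -expRD -splitr.
have -> : expR (- F w) = (q w - a * w)^+2 by rewrite -expFN expr2 -expRD -opprD -splitr.
rewrite expF expFN /p.
have -> : (a * w + q w + (q w - a * w)) / 2 = q w by field.
rewrite /gauss_fun -[RHS]mulrA -expRD.
have -> : - x * (((a * w + q w)^+2 + (q w - a * w)^+2) / 2) = - x - w ^+ 2.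
  have := q2 w; move: (q w) => u hu.
  have -> : w ^+ 2 = (2 * x * a ^+ 2) * w ^+2 by rewrite xa mul1r.
  transitivity (- x * (u ^+ 2 + (a * w) ^+2)); first by field.
  by rewrite hu; ring.
have := q1 w; move: (q w) => u u0; field. by rewrite gt_eqF.
Qed.

End arsinh_substitution.

Lemma bessel_K_half x : 0 < x ->
  bessel_K (1 / 2) x = (Num.sqrt (pi / (2 * x)) * expR (- x))%:C.
Proof.
move=> x0; rewrite /bessel_K /cint.
under [X in X +i* _]eq_Rintegral do rewrite bessel_K_half_integrand /=.
under [X in _ +i* X]eq_Rintegral do rewrite bessel_K_half_integrand /=.
congr (_ +i* _); last by rewrite Rintegral_cst// mul0r.
have cG : continuous (fun t => G x t).
  by move=> t; apply: differentiable_continuous; apply/derivable1_diffP.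
have mG : measurable_fun setT (fun t => G x t) by exact: measurable_realfun.continuous_measurable_fun.
rewrite /Rintegral integral_itv_obnd_cbnd; last first.
  by apply/measurable_EFinP; exact: (measurable_funS measurableT (@subsetT _ _) mG).
pose a := (Num.sqrt (2 * x))^-1.
have a0 : 0 < a by rewrite invr_gt0 sqrtr_gt0 mulr_gt0.
have xa : 2 * x * a ^+ 2 = 1.
  by rewrite exprVn sqr_sqrtr ?mulr_ge0 ?(ltW x0)// mulfV// gt_eqF// mulr_gt0.
rewrite (integral_arsinh_subst a0 cG) => [|t]; last first.
  by rewrite mulr_ge0 ?divr_ge0 ?addr_ge0 ?expR_ge0.
under eq_integral do rewrite integrand_half_subst// EFinM.
rewrite ge0_integralZl//=.
- rewrite integral0y_gauss -EFinM/= sqrtrM ?pi_ge0// sqrtrV ?mulr_ge0 ?(ltW x0)//.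
  by rewrite -/a; field.
- by apply/measurable_EFinP/measurable_funTS; exact: measurable_gauss_fun.
- by move=> w _; rewrite lee_fin gauss_fun_ge0.
- by rewrite lee_fin !mulr_ge0 ?expR_ge0// ltW.
Qed.
End bessel_K_normalization.

Section transforms.
Context {R : realType}.
Implicit Types (x y : R) (nu : R[i]) (f : R -> R[i]).

Definition L2_integrand f y x : R[i] :=
  (x * expR (- (x ^+ 2 * y ^+ 2)))%:C * f x.
Definition Glasser_integrand f y x : R[i] :=
  f x / (Num.sqrt (x ^+ 2 + y ^+ 2))%:C.
Definition Hankel_integrand nu f y x : R[i] :=
  (Num.sqrt (x * y))%:C * bessel_J nu (x * y) * f x.
Definition Ktrans_integrand nu f y x : R[i] :=
  (Num.sqrt (x * y))%:C * bessel_K nu (x * y) * f x.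

Definition L2 f y : R[i] := cint (L2_integrand f y).
Definition Glasser f y : R[i] := cint (Glasser_integrand f y).
Definition Hankel nu f y : R[i] := cint (Hankel_integrand nu f y).
Definition Ktrans nu f y : R[i] := cint (Ktrans_integrand nu f y).

End transforms.

(* Main.v *)
(* Put h x = x f x, a = nu + 1, b = z^2 / 4 and let H be the Laplace transform of h
   in the variable x^2, H q = int h x e^(- x^2 q) dx. The substitution
   q = 1 / (4 y^2) turns the iterated L2-transform into a multiple of int v H, with
   v q = q^(-a - 1/2) e^(- b / q). Macdonald's integral says that the Laplace transform
   W of v, taken at x^2, is a multiple of x^(nu + 1/2) K_(nu + 1/2)(x z), so the
   K-transform is a multiple of int h x W(x^2) dx. Integrating the power series of J_nu
   gives int u^(nu+1) J_nu(u z) e^(- p u^2) du = c p^(-a) e^(- b / p); together with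
   1 / sqrt(x^2 + u^2) = pi^(-1/2) int q^(-1/2) e^(- (x^2 + u^2) q) dq it makes the
   Hankel transform of the Glasser transform a multiple of the same two integrals.

   Each of the three interchanges of integrals holds only conditionally under the
   hypotheses. It is made absolute by a cut-off (e^(- q / n) in q, and
   e^(- u^2 / n) - e^(- n u^2) in u), removed by dominated convergence. The majorant is
   |h| (|W| + e^(- x^2)) up to a constant: the regularized kernels have to be bounded by
   |W| itself, which for complex nu oscillates. For large x this is Laplace's method
   (the phase is almost constant where the mass concentrates, which also shows
   Gamma <> 0); near x = 0 it depends on the sign of Re nu + 1/2, and when
   Re nu = - 1/2 and Im nu <> 0 the kernels stay bounded only because
   q^(- 1 - i Im nu) oscillates. *)
Require Import Defs.
From HB Require Import structures.
From mathcomp Require Import all_boot all_order all_algebra.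
From mathcomp Require Import complex.
From mathcomp Require Import all_classical all_reals all_analysis.
From mathcomp Require Import measurable_realfun gauss_integral ftc.
From mathcomp Require Import ring lra.
Import Order.TTheory GRing.Theory Num.Theory.
Import numFieldNormedType.Exports.
Import Normc.
Local Open Scope classical_set_scope.
Local Open Scope ring_scope.
Local Open Scope complex_scope.

Set Implicit Arguments.
Unset Strict Implicit.
Unset Printing Implicit Defensive.

(** Each identity may use only two of the three groups of convergent integrals, so the three pairs
    need different majorants. For L2 and K, all that is known of [h] at infinity is integrability
    against every [e^(- q x^2)] and against [W(x^2)], which decays only like [e^(- x z)]; large [x]
    therefore needs Laplace's method. Once the Glasser integral converges, [h] is integrable against
    [1 / sqrt(x^2 + 1)] and large [x] is easy. For L2 and Hankel the limit is taken on the [q] side,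
    where no lower bound for [W] enters.

    Both cut-offs stay within one family of kernels: [e^(- q / n)] shifts the argument of [W], and
    [e^(- E u^2)] shifts [p] to [q + E] in [p^(- a) e^(- b / p)]. Hence one bound,
    [vker_near_bound], serves both near [x = 0]. The Gaussian [e^(- u^2 / n)] alone does not tame
    [u = 0]: bounding the Glasser transform costs a factor [1 / u], and [u^(2 Re nu)] is not
    integrable there when [Re nu <= - 1/2]. Subtracting [e^(- n u^2)] gains a factor [u^2], and the
    kernel that it adds tends to 0. *)

Local Notation re := complex.Re.
Local Notation im := complex.Im.

Local Notation pw x r := (expR (r * ln x)).

(** * Complex exponentials, powers and limits *)

Section complex_basics.
Context {R : realType}.
Implicit Types (x y r : R) (w v s : R[i]).

Lemma complex_ext w v : re w = re v -> im w = im v -> w = v.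
Proof. by case: w v => [a b] [c d] /= -> ->. Qed.

Lemma ReD w v : re (w + v) = re w + re v. Proof. by case: w v => [? ?] [? ?]. Qed.
Lemma ImD w v : im (w + v) = im w + im v. Proof. by case: w v => [? ?] [? ?]. Qed.
Lemma ReN w : re (- w) = - re w. Proof. by case: w. Qed.
Lemma ImN w : im (- w) = - im w. Proof. by case: w. Qed.
Lemma ReM w v : re (w * v) = re w * re v - im w * im v.
Proof. by case: w v => [? ?] [? ?]. Qed.
Lemma ImM w v : im (w * v) = re w * im v + im w * re v.
Proof. by case: w v => [? ?] [? ?]. Qed.
Lemma ReC r : re r%:C = r. Proof. by []. Qed.
Lemma ImC r : im r%:C = 0. Proof. by []. Qed.
Lemma ReMC w r : re (w * r%:C) = re w * r. Proof. by rewrite ReM /= mulr0 subr0. Qed.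
Lemma ImMC w r : im (w * r%:C) = im w * r. Proof. by rewrite ImM /= mulr0 add0r. Qed.
Lemma ReCM w r : re (r%:C * w) = r * re w. Proof. by rewrite ReM /= mul0r subr0. Qed.
Lemma ImCM w r : im (r%:C * w) = r * im w. Proof. by rewrite ImM /= mul0r addr0. Qed.
Lemma natC n : n%:R = (n%:R : R)%:C. Proof. by rewrite rmorph_nat. Qed.
Lemma oneC : 1 = (1 : R)%:C. Proof. by []. Qed.
Lemma halfC : 1 / 2 = (1 / 2 : R)%:C.
Proof. by rewrite !mul1r fmorphV rmorph_nat. Qed.

Lemma normc_re w : `|re w| <= normc w.
Proof. case: w => a b /=; rewrite -sqrtr_sqr ler_sqrt ?addr_ge0 ?sqr_ge0//; by rewrite lerDl sqr_ge0. Qed.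
Lemma normc_im w : `|im w| <= normc w.
Proof. case: w => a b /=; rewrite -sqrtr_sqr ler_sqrt ?addr_ge0 ?sqr_ge0//; by rewrite lerDr sqr_ge0. Qed.
Lemma normc_ge0 w : 0 <= normc w. Proof. by case: w => a b /=; rewrite sqrtr_ge0. Qed.
Lemma normc_real r : normc r%:C = `|r|.
Proof. by rewrite /= expr0n/= addr0 sqrtr_sqr. Qed.
Lemma normc_le w : normc w <= `|re w| + `|im w|.
Proof.
case: w => a b /=.
rewrite -[leRHS]ger0_norm ?addr_ge0// -sqrtr_sqr ler_sqrt ?sqr_ge0//.
rewrite sqrrD !real_normK ?num_real// -addrA lerD2l lerDr.
by rewrite mulrn_wge0// mulr_ge0.
Qed.
Lemma normcB w v : normc (w - v) <= normc w + normc v.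
Proof. by rewrite -(normcN v); exact: le_normcD. Qed.
Lemma normc_gt0 w : w != 0 -> 0 < normc w.
Proof. by move=> w0; rewrite lt_def normc_ge0 andbT; apply: contra w0 => /eqP/eq0_normc ->. Qed.
Lemma normcM_real w r : 0 <= r -> normc (w * r%:C) = normc w * r.
Proof. by move=> r0; rewrite normcM normc_real ger0_norm. Qed.
Lemma normc_realM w r : 0 <= r -> normc (r%:C * w) = r * normc w.
Proof. by move=> r0; rewrite mulrC normcM_real// mulrC. Qed.

Lemma cexpD w v : cexp (w + v) = cexp w * cexp v.
Proof.
apply: complex_ext; rewrite /cexp ReD ImD expRD !(ReCM, ImCM, ReM, ImM) /=.
  by rewrite cosD; ring.
by rewrite sinD; ring.
Qed.
Lemma cexp_real r : cexp r%:C = (expR r)%:C.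
Proof. by rewrite /cexp /= cos0 sin0 mulr1. Qed.
Lemma cexp0 : cexp 0 = 1 :> R[i].
Proof. by rewrite (cexp_real 0) expR0. Qed.
Lemma normc_cexp w : normc (cexp w) = expR (re w).
Proof.
by rewrite /cexp normc_realM ?expR_ge0//= cos2Dsin2 sqrtr1 mulr1.
Qed.
Lemma cexp_neq0 w : cexp w != 0.
Proof.
apply/eqP => h; have := expR_gt0 (re w); rewrite -normc_cexp h normc0; by rewrite ltxx.
Qed.
Lemma cexpN w : cexp (- w) = (cexp w)^-1.
Proof. by apply: (mulfI (cexp_neq0 w)); rewrite -cexpD subrr cexp0 divff// cexp_neq0. Qed.
Lemma re_cexp w : re (cexp w) = expR (re w) * cos (im w).
Proof. by rewrite /cexp ReCM. Qed.
Lemma im_cexp w : im (cexp w) = expR (re w) * sin (im w).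
Proof. by rewrite /cexp ImCM. Qed.

Lemma cpowD x s w : cpow x (s + w) = cpow x s * cpow x w.
Proof. by rewrite /cpow mulrDl cexpD. Qed.
Lemma cpowN x s : cpow x (- s) = (cpow x s)^-1.
Proof. by rewrite /cpow mulNr cexpN. Qed.
Lemma cpow0 x : cpow x 0 = 1.
Proof. by rewrite /cpow mul0r cexp0. Qed.
Lemma cpow_real x r : cpow x r%:C = (expR (r * ln x))%:C.
Proof. by rewrite /cpow -rmorphM cexp_real. Qed.
Lemma cpow1 x : 0 < x -> cpow x 1 = x%:C.
Proof. by move=> x0; rewrite (cpow_real x 1) mul1r lnK. Qed.
Lemma cpow_nat x n : 0 < x -> cpow x n%:R = (x ^+ n)%:C.
Proof. by move=> x0; rewrite natC cpow_real expRM_natl lnK. Qed.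
Lemma cpow_exp r s : cpow (expR r) s = cexp (s * r%:C).
Proof. by rewrite /cpow expRK. Qed.
Lemma cpowM x y s : 0 < x -> 0 < y -> cpow (x * y) s = cpow x s * cpow y s.
Proof. by move=> x0 y0; rewrite /cpow lnM// rmorphD mulrDr cexpD. Qed.
Lemma cpowV x s : 0 < x -> cpow x^-1 s = cpow x (- s).
Proof. by move=> x0; rewrite /cpow lnV// rmorphN mulrN mulNr. Qed.
Lemma cpow_neq0 x s : cpow x s != 0. Proof. exact: cexp_neq0. Qed.
Lemma normc_cpow x s : normc (cpow x s) = expR (re s * ln x).
Proof. by rewrite /cpow normc_cexp ReMC. Qed.
Lemma re_cpow x s : re (cpow x s) = expR (re s * ln x) * cos (im s * ln x).
Proof. by rewrite re_cexp ReMC ImMC. Qed.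
Lemma im_cpow x s : im (cpow x s) = expR (re s * ln x) * sin (im s * ln x).
Proof. by rewrite im_cexp ReMC ImMC. Qed.

(** Limits are taken componentwise because [cint] and [cseries] are defined componentwise; real
    limit theorems then apply directly. *)
Definition ccvg (u : nat -> R[i]) (l : R[i]) :=
  (fun n => re (u n)) @ \oo --> re l /\ (fun n => im (u n)) @ \oo --> im l.

Lemma ccvg_unique u l1 l2 : ccvg u l1 -> ccvg u l2 -> l1 = l2.
Proof.
move=> [a b] [c d]; apply: complex_ext.
  exact: (cvg_unique _ a c).
exact: (cvg_unique _ b d).
Qed.
Lemma ccvg_cst l : ccvg (fun=> l) l.
Proof. by split; exact: cvg_cst. Qed.
Lemma ccvgM (u u2 : nat -> R[i]) l m : ccvg u l -> ccvg u2 m -> ccvg (fun n => u n * u2 n) (l * m).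
Proof.
move=> [a b] [c d]; split.
  rewrite ReM; under eq_fun do rewrite ReM.
  by apply: cvgB; apply: cvgM.
rewrite ImM; under eq_fun do rewrite ImM.
by apply: cvgD; apply: cvgM.
Qed.
Lemma ccvgD (u u2 : nat -> R[i]) l m : ccvg u l -> ccvg u2 m -> ccvg (fun n => u n + u2 n) (l + m).
Proof.
move=> [a b] [c d]; split.
  by rewrite ReD; under eq_fun do rewrite ReD; apply: cvgD.
by rewrite ImD; under eq_fun do rewrite ImD; apply: cvgD.
Qed.
Lemma ccvgN u l : ccvg u l -> ccvg (fun n => - u n) (- l).
Proof.
move=> [a b]; split.
  by rewrite ReN; under eq_fun do rewrite ReN; apply: cvgN.
by rewrite ImN; under eq_fun do rewrite ImN; apply: cvgN.
Qed.
Lemma ccvg_real (u : nat -> R) r : u @ \oo --> r -> ccvg (fun n => (u n)%:C) r%:C.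
Proof. by move=> h; split => //=; exact: cvg_cst. Qed.
Lemma ccvg_cexp u l : ccvg u l -> ccvg (fun n => cexp (u n)) (cexp l).
Proof.
move=> [a b]; rewrite /cexp; apply: ccvgM.
  by apply: ccvg_real; apply: (continuous_cvg _ (@continuous_expR R _)).
by split => /=; apply: continuous_cvg => //; [exact: continuous_cos|exact: continuous_sin].
Qed.
Lemma ccvg_cpow (u : nat -> R) r s : 0 < r -> u @ \oo --> r ->
  ccvg (fun n => cpow (u n) s) (cpow r s).
Proof.
move=> r0 h; apply: ccvg_cexp; apply: ccvgM; first exact: ccvg_cst.
by apply: ccvg_real; apply: continuous_cvg => //; exact: continuous_ln.
Qed.

End complex_basics.

(** * Real measurability and integration on the open half-line *)

Section real_layer.
Context {R : realType}.
Implicit Types (g h : R -> R) (x y r : R).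
Local Notation mu := (@lebesgue_measure R).
Local Notation D := (`]0%R, +oo[%classic : set (measurableTypeR R)).

Definition rmeas g := measurable_fun D g.
Definition rintegrable g := mu.-integrable D (fun x => (g x)%:E).
Definition rint g := \int[mu]_(x in D) g x.

Lemma inD x : D x -> 0 < x.
Proof. by rewrite /= in_itv/= andbT. Qed.
Lemma memD x : x \in D -> 0 < x.
Proof. by rewrite inE; exact: inD. Qed.
Let mD : measurable D. Proof. exact: measurable_itv. Qed.

Lemma eq_rmeas g h : (forall x, 0 < x -> g x = h x) -> rmeas g -> rmeas h.
Proof. by move=> gh mg; apply: eq_measurable_fun mg => x /memD; exact: gh. Qed.
Lemma rmeas_comp (phi : R -> R) g : measurable_fun [set: R] phi -> rmeas g ->
  rmeas (fun x => phi (g x)).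
Proof. by move=> mp mg; exact: (measurableT_comp mp mg). Qed.
Lemma rmeas_id : rmeas id. Proof. exact: measurable_id. Qed.
Lemma rmeas_cst r : rmeas (fun=> r). Proof. exact: measurable_cst. Qed.
Lemma rmeasD g h : rmeas g -> rmeas h -> rmeas (fun x => g x + h x).
Proof. exact: measurable_funD. Qed.
Lemma rmeasB g h : rmeas g -> rmeas h -> rmeas (fun x => g x - h x).
Proof. exact: measurable_funB. Qed.
Lemma rmeasM g h : rmeas g -> rmeas h -> rmeas (fun x => g x * h x).
Proof. exact: measurable_funM. Qed.
Lemma rmeasN g : rmeas g -> rmeas (fun x => - g x).
Proof. exact: measurable_funN. Qed.
Lemma rmeasX g n : rmeas g -> rmeas (fun x => g x ^+ n).
Proof. exact: measurable_funX. Qed.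
Lemma rmeas_norm g : rmeas g -> rmeas (fun x => `|g x|).
Proof. exact: rmeas_comp. Qed.
Lemma rmeas_exp g : rmeas g -> rmeas (fun x => expR (g x)).
Proof. exact: rmeas_comp. Qed.
Lemma rmeas_ln g : rmeas g -> rmeas (fun x => ln (g x)).
Proof. exact: rmeas_comp. Qed.
Lemma rmeas_cos g : rmeas g -> rmeas (fun x => cos (g x)).
Proof. apply: rmeas_comp; apply: measurable_realfun.continuous_measurable_fun; exact: continuous_cos. Qed.
Lemma rmeas_sin g : rmeas g -> rmeas (fun x => sin (g x)).
Proof. apply: rmeas_comp; apply: measurable_realfun.continuous_measurable_fun; exact: continuous_sin. Qed.
Lemma rmeas_sqrt g : rmeas g -> rmeas (fun x => Num.sqrt (g x)).
Proof. apply: rmeas_comp; apply: measurable_realfun.continuous_measurable_fun; exact: sqrt_continuous. Qed.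
(** For positive [g] the inverse is [expR (- ln g)], a composition of functions measurable on the
    whole line. *)
Lemma rmeasV g : rmeas g -> (forall x, 0 < x -> 0 < g x) -> rmeas (fun x => (g x)^-1).
Proof.
move=> mg g0; apply: (@eq_rmeas (fun x => expR (- ln (g x)))) => [x /g0 gx|].
  by rewrite -lnV// lnK// posrE invr_gt0.
by apply: rmeas_exp; apply: rmeasN; exact: rmeas_ln.
Qed.
Lemma rmeas_if (b : R -> bool) g h : measurable_fun D b -> rmeas g -> rmeas h ->
  rmeas (fun x => if b x then g x else h x).
Proof.
move=> mb mg mh; apply: (measurable_fun_if mD mb).
- by apply: (measurable_funS mD _ mg) => x [].
- by apply: (measurable_funS mD _ mh) => x [].
Qed.
Lemma rmeas_ltif g1 g2 g h : rmeas g1 -> rmeas g2 -> rmeas g -> rmeas h ->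
  rmeas (fun x => if g1 x <= g2 x then g x else h x).
Proof. by move=> m1 m2; apply: rmeas_if; exact: measurable_fun_ler. Qed.

Lemma rintegrable_meas g : rintegrable g -> rmeas g.
Proof. by move=> /measurable_int /measurable_EFinP. Qed.

Lemma rintegrable_le g h : rmeas g -> rintegrable h ->
  (forall x, 0 < x -> `|g x| <= h x) -> rintegrable g.
Proof.
move=> mg ih gh; apply: (le_integrable mD _ _ ih); first exact/measurable_EFinP.
move=> x /inD x0; rewrite !abse_EFin lee_fin.
by apply: le_trans (gh _ x0) _; exact: ler_norm.
Qed.

Lemma eq_rintegrable g h : (forall x, 0 < x -> g x = h x) -> rintegrable g -> rintegrable h.
Proof. by move=> gh; apply: eq_integrable => // x /memD x0; rewrite gh. Qed.
Lemma eq_rint g h : (forall x, 0 < x -> g x = h x) -> rint g = rint h.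
Proof. by move=> gh; apply: eq_Rintegral => x /memD x0; rewrite gh. Qed.

Lemma rintegrableD g h : rintegrable g -> rintegrable h -> rintegrable (fun x => g x + h x).
Proof. by move=> ig ih; have := integrableD mD ig ih. Qed.
Lemma rintegrableB g h : rintegrable g -> rintegrable h -> rintegrable (fun x => g x - h x).
Proof. by move=> ig ih; have := integrableB mD ig ih. Qed.
Lemma rintegrableZ r g : rintegrable g -> rintegrable (fun x => r * g x).
Proof. by move=> ig; have := integrableZl mD r ig. Qed.
Lemma rintegrable0 : rintegrable (fun=> 0).
Proof. exact: integrable0. Qed.
Lemma rintegrable_norm g : rintegrable g -> rintegrable (fun x => `|g x|).
Proof. by move=> ig; have := integrable_norm ig. Qed.

Lemma rintD g h : rintegrable g -> rintegrable h ->
  rint (fun x => g x + h x) = rint g + rint h.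
Proof. exact: RintegralD. Qed.
Lemma rintB g h : rintegrable g -> rintegrable h ->
  rint (fun x => g x - h x) = rint g - rint h.
Proof. exact: RintegralB. Qed.
Lemma rintZ r g : rintegrable g -> rint (fun x => r * g x) = r * rint g.
Proof. exact: RintegralZl. Qed.
Lemma rint_ge0 g : (forall x, 0 < x -> 0 <= g x) -> 0 <= rint g.
Proof. by move=> g0; apply: Rintegral_ge0 => x /inD; exact: g0. Qed.
Lemma le_rint g h : rintegrable g -> rintegrable h ->
  (forall x, 0 < x -> g x <= h x) -> rint g <= rint h.
Proof. by move=> ig ih gh; apply: le_Rintegral => // x /inD; exact: gh. Qed.
Lemma abs_rint_le g h : rintegrable g -> rintegrable h ->
  (forall x, 0 < x -> `|g x| <= h x) -> `|rint g| <= rint h.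
Proof.
move=> ig ih gh; apply: (le_trans (le_normr_Rintegral mD ig)).
by apply: le_rint => //; exact: rintegrable_norm.
Qed.
Lemma rint0 : rint (fun=> 0) = 0.
Proof. by rewrite /rint Rintegral_cst// mul0r. Qed.

Lemma EFin_rint g : rintegrable g -> (\int[mu]_(x in D) (g x)%:E = (rint g)%:E)%E.
Proof. by move=> ig; rewrite /rint /Rintegral fineK//; exact: integrable_fin_num. Qed.

Lemma rint_cvg (gn : nat -> R -> R) g h :
  (forall n, rmeas (gn n)) -> rintegrable h ->
  (forall n x, 0 < x -> `|gn n x| <= h x) ->
  (forall x, 0 < x -> (fun n => gn n x) @ \oo --> g x) ->
  rintegrable g /\ (fun n => rint (gn n)) @ \oo --> rint g.
Proof.
move=> mgn ih gnh gng.
have mg : rmeas g.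
  by apply: (measurable_fun_cvg mgn) => x /inD; exact: gng.
have [] := @dominated_convergence _ _ _ mu D mD (fun n x => (gn n x)%:E)
   (fun x => (g x)%:E) (fun x => (h x)%:E).
- by move=> n; apply/measurable_EFinP; exact: mgn.
- by apply/measurable_EFinP; exact: mg.
- by apply: aeW => x /inD x0; apply: cvg_EFin; [exact: nearW|exact: gng].
- exact: ih.
- by apply: aeW => x n /inD x0; rewrite abse_EFin lee_fin gnh.
move=> ig _ /= hc; split=> //.
have : (fun n => fine (\int[mu]_(x in D) (gn n x)%:E)%E) @ \oo --> fine (\int[mu]_(x in D) (g x)%:E)%E.
  apply: fine_cvg; rewrite fineK//; exact: integrable_fin_num.
by [].
Qed.

(* The junk value of [rint] is 0, so only finiteness of the integral is tested. *)
Lemma ge0_rintegrable g : rmeas g -> (forall x, 0 < x -> 0 <= g x) ->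
  (\int[mu]_(x in D) (g x)%:E < +oo)%E -> rintegrable g.
Proof.
move=> mg g0 h; apply/integrableP; split; first exact/measurable_EFinP.
apply: le_lt_trans h; rewrite le_eqVlt; apply/orP; left; apply/eqP.
by apply: eq_integral => x /memD x0; rewrite abse_EFin ger0_norm// g0.
Qed.

End real_layer.

(** * Fubini's theorem on the quadrant *)

Section fubini.
Context {R : realType}.
Implicit Types (g : R -> R -> R) (G : R -> R).
Local Notation mu := (@lebesgue_measure R).
Local Notation D := (`]0%R, +oo[%classic : set (measurableTypeR R)).

Definition rmeas2 g := measurable_fun (D `*` D) (fun p : measurableTypeR R * measurableTypeR R => g p.1 p.2).

Let mD : measurable D. Proof. exact: measurable_itv. Qed.
Let mDD : measurable (D `*` D). Proof. exact: measurableX. Qed.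
(** Extension by zero, so that Tonelli and Fubini for the product measure on the whole plane
    apply. *)
Let ext g : measurableTypeR R * measurableTypeR R -> R :=
  ((fun p => g p.1 p.2) \_ (D `*` D)).
Let extE g x y : ext g (x, y) = if (x \in D) && (y \in D) then g x y else 0.
Proof.
by rewrite /ext patchE/= in_setX.
Qed.

Lemma eq_rmeas2 g g' : (forall x y, 0 < x -> 0 < y -> g x y = g' x y) -> rmeas2 g -> rmeas2 g'.
Proof.
move=> e; apply: eq_measurable_fun => -[x y]; rewrite inE => -[/inD x0 /inD y0] /=.
exact: e.
Qed.
Lemma rmeas2_fst G : rmeas G -> rmeas2 (fun x _ => G x).
Proof.
move=> mG; apply: (@measurable_comp _ _ _ _ _ _ D G) => //.
  by move=> _ [[a b] [? ?] <-].
exact: measurable_funTS measurable_fst.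
Qed.
Lemma rmeas2_snd G : rmeas G -> rmeas2 (fun _ y => G y).
Proof.
move=> mG; apply: (@measurable_comp _ _ _ _ _ _ D G) => //.
  by move=> _ [[a b] [? ?] <-].
exact: measurable_funTS measurable_snd.
Qed.
Lemma rmeas2_comp (phi : R -> R) g : measurable_fun [set: R] phi -> rmeas2 g ->
  rmeas2 (fun x y => phi (g x y)).
Proof. by move=> mp mg; exact: (measurableT_comp mp mg). Qed.
Lemma rmeas2D g g' : rmeas2 g -> rmeas2 g' -> rmeas2 (fun x y => g x y + g' x y).
Proof. exact: measurable_funD. Qed.
Lemma rmeas2B g g' : rmeas2 g -> rmeas2 g' -> rmeas2 (fun x y => g x y - g' x y).
Proof. exact: measurable_funB. Qed.
Lemma rmeas2M g g' : rmeas2 g -> rmeas2 g' -> rmeas2 (fun x y => g x y * g' x y).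
Proof. exact: measurable_funM. Qed.
Lemma rmeas2N g : rmeas2 g -> rmeas2 (fun x y => - g x y).
Proof. exact: measurable_funN. Qed.
Lemma rmeas2_exp g : rmeas2 g -> rmeas2 (fun x y => expR (g x y)).
Proof. exact: rmeas2_comp. Qed.
Lemma rmeas2_swap g : rmeas2 g -> rmeas2 (fun x y => g y x).
Proof.
move=> mg; apply: (@measurable_comp _ _ _ _ _ _ (D `*` D) (fun p => g p.1 p.2) _ (fun p => (p.2, p.1))) => //.
  by move=> _ [[a b] [? ?] <-].
by apply/measurable_funTS/measurable_fun_pair; [exact: measurable_snd|exact: measurable_fst].
Qed.

Let mext g : rmeas2 g -> measurable_fun [set: measurableTypeR R * measurableTypeR R] (ext g).
Proof. by move=> mg; exact/(measurable_restrictT _ mDD). Qed.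

Let extF g x (phi : R -> \bar R) : phi 0 = 0%E ->
  (\int[mu]_y phi (ext g (x, y)) = if x \in D then \int[mu]_(y in D) phi (g x y) else 0)%E.
Proof.
move=> p0; case: ifPn => xD; last first.
  by rewrite integral0_eq// => y _; rewrite extE (negbTE xD).
rewrite [RHS]integral_mkcond; apply: eq_integral => y _.
by rewrite extE xD patchE/=; case: ifP.
Qed.
Let extG g y (phi : R -> \bar R) : phi 0 = 0%E ->
  (\int[mu]_x phi (ext g (x, y)) = if y \in D then \int[mu]_(x in D) phi (g x y) else 0)%E.
Proof.
move=> p0; case: ifPn => xD; last first.
  by rewrite integral0_eq// => x _; rewrite extE (negbTE xD) andbF.
rewrite [RHS]integral_mkcond; apply: eq_integral => x _.
by rewrite extE xD andbT patchE/=; case: ifP.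
Qed.

Lemma rmeas_rint_ge0 g : rmeas2 g -> (forall x y, 0 < x -> 0 < y -> 0 <= g x y) ->
  rmeas (fun x => rint (g x)).
Proof.
move=> mg g0.
have : measurable_fun [set: measurableTypeR R] (fun x => \int[mu]_y (ext g (x, y))%:E)%E.
  apply: (@measurable_fun_fubini_tonelli_F _ _ _ _ _ mu (fun p => (ext g p)%:E)).
    by apply/measurable_EFinP; exact: mext.
  move=> [x y]; rewrite lee_fin extE; case: ifPn => // /andP[/memD ? /memD ?].
  exact: g0.
move=> mF.
have mF' : measurable_fun D (fun x => fine (\int[mu]_y (ext g (x, y))%:E)%E).
  by apply: measurable_funTS; exact: measurableT_comp mF.
apply: eq_measurable_fun mF' => x xD; rewrite (extF _ _ (phi := EFin))// xD.
by [].
Qed.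

(** Tonelli covers nonnegative integrands, and [g] is the difference of the nonnegative functions
    [|g| + g] and [|g|]. *)
Lemma rmeas_rint g : rmeas2 g -> (forall x, 0 < x -> rintegrable (g x)) ->
  rmeas (fun x => rint (g x)).
Proof.
move=> mg ig.
have ma : rmeas2 (fun x y => `|g x y|) by apply: rmeas2_comp mg.
have h x : 0 < x -> rint (g x) = rint (fun y => `|g x y| + g x y) - rint (fun y => `|g x y|).
  move=> x0; have i1 := ig _ x0; have i2 := rintegrable_norm i1.
  by rewrite rintD// addrAC subrr add0r.
apply: (@eq_rmeas _ (fun x => rint (fun y => `|g x y| + g x y) - rint (fun y => `|g x y|))).
  by move=> x /h.
apply: rmeasB; apply: rmeas_rint_ge0 => //; first exact: rmeas2D.
by move=> x y _ _; have := ler_norm (- g x y); rewrite normrN; lra.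
Qed.

(** The majorant [G] of the inner absolute integrals makes [g] integrable on the product. Asking for
    every section to be integrable, and not for almost every one, identifies the inner integrals
    with [rint] at each point, so that no null sets are carried along. *)
Lemma rfubini g G : rmeas2 g -> (forall x, 0 < x -> rintegrable (g x)) ->
  (forall y, 0 < y -> rintegrable (g^~ y)) -> rintegrable G ->
  (forall x, 0 < x -> rint (fun y => `|g x y|) <= G x) ->
  [/\ rintegrable (fun x => rint (g x)), rintegrable (fun y => rint (g^~ y)) &
      rint (fun x => rint (g x)) = rint (fun y => rint (g^~ y))].
Proof.
move=> mg ig1 ig2 iG gG.
have ma : rmeas2 (fun x y => `|g x y|) by apply: rmeas2_comp mg.
have me : measurable_fun setT (fun p => (ext g p)%:E).
  by apply/measurable_EFinP; exact: mext.
have int : (mu \x mu)%E.-integrable setT (fun p => (ext g p)%:E).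
  have P := @integrable12ltyP _ _ _ _ R mu mu (fun p => (ext g p)%:E) me; apply/P.
  apply: (@le_lt_trans _ _ (\int[mu]_(x in D) (G x)%:E)%E); last first.
    by rewrite EFin_rint// ltry.
  rewrite [leRHS]integral_mkcond; apply: ge0_le_integral => //.
  - by move=> x _; apply: integral_ge0.
  - apply: (@measurable_fun_fubini_tonelli_F _ _ _ _ _ mu (fun p => `|(ext g p)%:E|%E)).
      exact: measurableT_comp me.
    by move=> p; exact: abse_ge0.
  - by apply/(measurable_restrictT _ mD); exact: measurable_int iG.
  - move=> x _; rewrite patchE.
    rewrite (_ : (fun y => `|(ext g (x, y))%:E|%E) = (fun y => (fun r => `|r%:E|%E) (ext g (x, y))))//.
    rewrite (extF _ _ (phi := fun r => `|r%:E|%E)) ?abse0//; case: ifPn => // xD.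
    have x0 := memD xD.
    rewrite (_ : (fun y => `|(g x y)%:E|%E) = fun y => (`|g x y|)%:E)//.
    by rewrite EFin_rint ?lee_fin ?gG//; exact/rintegrable_norm/ig1.
have E1 : (fun x => \int[mu]_y (ext g (x, y))%:E)%E = (fun x => (rint (g x))%:E) \_ D.
  apply/funext => x; rewrite (extF _ _ (phi := EFin))// patchE.
  by case: ifPn => // /memD x0; rewrite EFin_rint//; exact: ig1.
have E2 : (fun y => \int[mu]_x (ext g (x, y))%:E)%E = (fun y => (rint (g^~ y))%:E) \_ D.
  apply/funext => x; rewrite (extG _ _ (phi := EFin))// patchE.
  by case: ifPn => // /memD x0; rewrite EFin_rint//; exact: ig2.
split.
- have := integrable_fubini_F int; rewrite /fubini_F E1.
  by move/(integrable_mkcond _ mD).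
- have iy : rintegrable (fun y => rint (fun x => `|g x y|)).
    apply: ge0_rintegrable.
    + by apply: rmeas_rint_ge0 => //; exact: rmeas2_swap ma.
    + by move=> y y0; exact: rint_ge0.
    have := (iffLR (@integrable21ltyP _ _ _ _ R mu mu (fun p => (ext g p)%:E) me)) int.
    apply: le_lt_trans; rewrite [leLHS]integral_mkcond.
    rewrite le_eqVlt; apply/orP; left; apply/eqP; apply: eq_integral => y _; rewrite patchE.
    rewrite [RHS](_ : _ = \int[mu]_x (fun r => `|r%:E|%E) (ext g (x, y)))%E//.
    rewrite (extG _ _ (phi := fun r => `|r%:E|%E)) ?abse0//; case: ifPn => // /memD y0.
    rewrite (_ : (fun x => `|(g x y)%:E|%E) = fun x => (`|g x y|)%:E)//.
    by rewrite EFin_rint//; exact/rintegrable_norm/ig2.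
  apply: rintegrable_le iy _; first by apply: rmeas_rint => //; exact: rmeas2_swap.
  move=> y y0; apply: abs_rint_le => //; first exact: ig2.
  exact/rintegrable_norm/ig2.
- have := Fubini int; rewrite E1 E2 -!integral_mkcond => h.
  by rewrite /rint /Rintegral h.
Qed.

End fubini.

(** * Change of variables for nonnegative functions *)

Section change_of_variables.
Import HBNNSimple.
Context {R : realType}.
Local Notation mu := (@lebesgue_measure R).
Local Notation T := (measurableTypeR R).
Local Open Scope ereal_scope.
Variables (phi w : R -> R) (E : set T).
Hypotheses (mphi : measurable_fun [set: T] (phi : T -> T))
  (mw : measurable_fun [set: T] w) (w0 : forall t, (0 <= w t)%R)
  (mE : measurable E) (phiE : forall t, E (phi t)).

Let mpre (A : set T) : measurable A -> measurable (phi @^-1` A).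
Proof. by move=> mA; rewrite -[X in measurable X]setTI; exact: mphi. Qed.

(* Away from E the measure is Lebesgue measure itself, so that uniqueness of
   Lebesgue measure on R applies. *)
Let nu (A : set T) : \bar R := \int[mu]_(t in phi @^-1` A) (w t)%:E + mu (A `&` ~` E).

Let nu0 : nu set0 = 0.
Proof. by rewrite /nu preimage_set0 integral_set0 set0I measure0 adde0. Qed.
Let nu_ge0 A : 0 <= nu A.
Proof. by rewrite /nu adde_ge0// integral_ge0// => t _; rewrite lee_fin. Qed.
Let nu_sigma_additive : semi_sigma_additive nu.
Proof.
move=> F mF tF mUF.
rewrite /nu; under eq_fun do rewrite big_split/=.
apply: cvgeD.
- by rewrite ge0_adde_def// inE; [apply: integral_ge0 => t _; rewrite lee_fin|].
- rewrite preimage_bigcup ge0_integral_bigcup//.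
  + apply: is_cvg_ereal_nneg_natsum_cond => n _ _.
    by apply: integral_ge0 => t _; rewrite lee_fin.
  + by move=> k; exact: mpre.
  + by apply/measurable_EFinP; exact: measurable_funTS.
  + by move=> t _; rewrite lee_fin.
  + move=> i j _ _ [t [/= Fi Fj]].
    by apply: (tF i j) => //; exists (phi t).
- rewrite setI_bigcupl; apply: measure_semi_sigma_additive.
  + by move=> i; apply: measurableI => //; exact: measurableC.
  + by apply: trivIset_setIr.
  + rewrite -setI_bigcupl; apply: measurableI => //; exact: measurableC.
Qed.
HB.instance Definition _ := isMeasure.Build _ T R nu nu0 nu_ge0 nu_sigma_additive.

Hypothesis phi_itv : forall a b : R, (a < b)%R ->
  mu (`]a, b]%classic `&` E) = \int[mu]_(t in phi @^-1` `]a, b]%classic) (w t)%:E.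

(** [nu] agrees with Lebesgue measure on half-open intervals by [phi_itv], hence on all measurable
    sets; on subsets of [E] its second summand vanishes. *)
Let measure_preimage (A : set T) : measurable A ->
  mu (A `&` E) = \int[mu]_(t in phi @^-1` A) (w t)%:E.
Proof.
move=> mA.
have h : mu (A `&` E) = nu (A `&` E).
  apply: (@lebesgue_measure_unique R nu); last exact: measurableI.
  move=> _ [[a b] _ <-] /=; rewrite /nu.
  have [ab|ba] := ltP a b; last first.
    have e : `]a, b]%classic = set0 :> set R by apply: set_itv_ge; rewrite bnd_simp -leNgt.
    by rewrite e measure0 set0I measure0 preimage_set0 integral_set0 adde0.
  rewrite -phi_itv// -measureU//; [|exact: measurableI|by apply: measurableI => //; exact: measurableC|].
    by rewrite -setIUr setUv setIT.
  by rewrite setIACA setICr setI0.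
rewrite h /nu -setIA setICr setI0 measure0 adde0.
by congr (integral _ _ _); apply/seteqP; split => t //= -[].
Qed.

(** Indicators are handled by [measure_preimage], simple functions by linearity, and the general
    case by monotone convergence along [nnsfun_approx]. No regularity of [phi] enters, only its
    effect on intervals. *)
Lemma ge0_integral_transfer (f : T -> \bar R) : measurable_fun E f ->
  (forall x, E x -> 0 <= f x) ->
  \int[mu]_(x in E) f x = \int[mu]_t (f (phi t) * (w t)%:E).
Proof.
move=> mf f0.
pose a_ := nnsfun_approx mE mf.
pose f_ n : T -> R := a_ n.
have mEw : measurable_fun [set: T] (fun t => (w t)%:E) by apply/measurable_EFinP.
have mfphi : measurable_fun [set: T] (fun t => f (phi t)).
  apply: (@measurable_comp _ _ _ _ _ _ E f) => //.
  by move=> _ [t _ <-]; exact: phiE.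
have mfn n : measurable_fun [set: T] (fun t => f_ n (phi t)).
  by apply: measurableT_comp mphi.
have mi n r : measurable_fun [set: T] (fun t => \1_(a_ n @^-1` [set r]) (phi t) : R).
  have mI : measurable_fun [set: T] (\1_(a_ n @^-1` [set r]) : T -> R) by exact: measurable_indic.
  exact: measurableT_comp mI mphi.
have Ef n : \int[mu]_(x in E) (f_ n x)%:E = \int[mu]_t ((f_ n (phi t))%:E * (w t)%:E).
  under eq_integral do rewrite /f_ fimfunE -fsumEFin//.
  rewrite ge0_integral_fsum//; last 2 first.
  - by move=> y; exact/measurable_EFinP/measurable_funM.
  - by move=> y x _; rewrite nnfun_muleindic_ge0.
  transitivity (\int[mu]_t \sum_(r \in range (a_ n)) ((r * \1_(a_ n @^-1` [set r]) (phi t)) * w t)%:E); last first.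
    apply: eq_integral => t _; rewrite -EFinM /f_ fimfunE fsumEFin//; congr (_%:E).
    by rewrite mulr_fsuml.
  rewrite ge0_integral_fsum//; last 2 first.
  - move=> r; apply/measurable_EFinP; apply: measurable_funM; last exact: mw.
    by apply: measurable_funM; [exact: measurable_cst|exact: (mi n r)].
  - move=> r t _; rewrite EFinM mule_ge0 ?lee_fin//.
    rewrite indicE; case: (boolP (phi t \in a_ n @^-1` [set r])) => [|_]; last by rewrite mulr0.
    by rewrite inE/= => <-; rewrite mulr1.
  apply: eq_fsbigr => r rr.
  have r0 : (0 <= r)%R by move: rr; rewrite inE => -[x _ <-].
  under eq_integral do rewrite EFinM.
  under [RHS]eq_integral do rewrite -mulrA EFinM.
  rewrite !ge0_integralZl_EFin//.
  + congr (_ * _); transitivity (mu (a_ n @^-1` [set r] `&` E)).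
      by rewrite integral_indic.
    rewrite measure_preimage//.
    rewrite [LHS]integral_mkcond; apply: eq_integral => t _.
    rewrite patchE indicE.
    have [h|h] := pselect (a_ n (phi t) = r).
      by rewrite !mem_set// mul1r.
    by rewrite !memNset// mul0r.
  all: try by apply/measurable_EFinP; apply: measurable_funM; [exact: (mi n r)|exact: mw].
  all: try by apply/measurable_EFinP; exact: measurable_funTS.
  all: try by move=> t _; rewrite lee_fin ?mulr_ge0.
transitivity (limn (fun n => \int[mu]_(x in E) (f_ n x)%:E)).
  rewrite -monotone_convergence//.
  - apply: eq_integral => y /[!inE] yD; apply/esym/cvg_lim => //.
    by apply: cvg_nnsfun_approx=> // *; apply: f0.
  - by move=> n; apply/measurable_EFinP; exact: measurable_funTS.
  - by move=> n y _; rewrite lee_fin.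
  - by move=> y _ m n mn; rewrite lee_fin; exact/lefP/nd_nnsfun_approx.
rewrite (_ : (fun n => _) = fun n => \int[mu]_t ((f_ n (phi t))%:E * (w t)%:E)); last by apply/funext => n; exact: Ef.
rewrite -monotone_convergence//.
- apply: eq_integral => t _; apply/cvg_lim => //.
  apply: cvgeZr => //.
  by apply: cvg_nnsfun_approx=> // *; apply: f0.
- by move=> n; apply: emeasurable_funM => //; exact/measurable_EFinP.
- by move=> n t _; rewrite mule_ge0 ?lee_fin.
- by move=> t _ m n mn; apply: lee_wpmul2r; rewrite lee_fin//; have /lefP := nd_nnsfun_approx mE mf mn; apply.
Qed.

End change_of_variables.

(** * Exponential, affine and power substitutions *)

Section exponential_substitution.
Context {R : realType}.
Local Notation mu := (@lebesgue_measure R).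
Local Notation D := (`]0%R, +oo[%classic : set (measurableTypeR R)).
Local Open Scope ereal_scope.

(** Intervals are measured by the fundamental theorem with the primitive [- e^(- t)]. The minus sign
    sends 0 to [+oo], so an interval reaching down to 0 has a ray towards [+oo] as its preimage,
    which the improper form of that theorem covers. *)
Lemma ge0_integral_expN (f : R -> \bar R) : measurable_fun D f ->
  (forall x, D x -> 0 <= f x) ->
  \int[mu]_(x in D) f x = \int[mu]_t (f (expR (- t)) * (expR (- t))%:E).
Proof.
apply: (@ge0_integral_transfer R (fun t => expR (- t)) (fun t => expR (- t)) D).
- by apply: measurableT_comp => //; exact: measurable_funN.
- by apply: measurableT_comp => //; exact: measurable_funN.
- by move=> t; exact: expR_ge0.
- exact: measurable_itv.
- by move=> t; rewrite /= in_itv/= andbT expR_gt0.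
move=> a b ab.
have cE : continuous (fun t : R => expR (- t)).
  by move=> t; apply: differentiable_continuous; apply/derivable1_diffP.
have cF : continuous (fun t : R => - expR (- t))%R.
  by move=> t; apply: differentiable_continuous; apply/derivable1_diffP.
have dF (t : R) : is_derive t 1%R (fun t : R => - expR (- t))%R (expR (- t)).
  by apply: is_derive_eq; rewrite /GRing.scale/= mulrN1 opprK.
have dFE (t : R) : (derive1 (fun t : R => - expR (- t)) t = expR (- t))%R.
  by rewrite derive1E; apply: derive_val.
have [b0|b0] := leP b 0%R.
  rewrite (_ : `]a, b] `&` D = set0) ?measure0.
    rewrite (_ : _ @^-1` _ = set0) ?integral_set0//.
    by apply/seteqP; split => // t; rewrite /= in_itv/= => /andP[_]; rewrite leNgt (le_lt_trans b0 (expR_gt0 _)).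
  apply/seteqP; split => // t [] /=; rewrite !in_itv/= andbT => /andP[_ tb].
  by rewrite ltNge (le_trans tb b0).
have [a0|a0] := ltP 0%R a.
  rewrite (_ : `]a, b] `&` D = `]a, b]%classic); last first.
    apply/seteqP; split => [t []//|t] /=; rewrite !in_itv/= andbT => /andP[h1 h2].
    by split; [rewrite h1|exact: lt_trans h1].
  rewrite (_ : _ @^-1` _ = `[- ln b, - ln a[%classic)%R; last first.
    apply/seteqP; split => t; rewrite /= !in_itv/=.
      move=> /andP[h1 h2]; apply/andP; split.
        by rewrite lerNl -[leLHS]expRK ler_ln ?posrE ?expR_gt0.
      by rewrite ltrNr -[ltRHS]expRK ltr_ln ?posrE ?expR_gt0.
    move=> /andP[h1 h2]; apply/andP; split.
      by rewrite -[ltLHS]lnK ?posrE// ltr_expR ltrNr.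
    by rewrite -[leRHS]lnK ?posrE// ler_expR lerNl.
  rewrite lebesgue_measure_itv/= lte_fin ab.
  rewrite integral_itv_bndo_bndc; last first.
    by apply/measurable_EFinP; apply: measurable_funTS; apply: measurable_realfun.continuous_measurable_fun; exact: cE.
  rewrite (@continuous_FTC2 _ (fun t => expR (- t)) (fun t => - expR (- t)) (- ln b) (- ln a))%R.
  - by rewrite !opprK !lnK// -!EFinN -!EFinD; congr (_%:E); ring.
  - by rewrite ltrN2 ltr_ln.
  - exact: continuous_subspaceT.
  - split => [t _||]; first by have [] := dF t.
    + by apply: cvg_at_right_filter; exact: cF.
    + by apply: cvg_at_left_filter; exact: cF.
  - by move=> t _; exact: dFE.
rewrite (_ : `]a, b] `&` D = `]0, b]%classic)%R; last first.
  apply/seteqP; split => [t []|t] /=; rewrite !in_itv/= andbT.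
    by move=> /andP[_ ->] ->.
  by move=> /andP[t0 ->]; split => //; rewrite andbT (le_lt_trans a0).
rewrite (_ : _ @^-1` _ = `[- ln b, +oo[%classic)%R; last first.
  apply/seteqP; split => t; rewrite /= !in_itv/= andbT.
    by move=> /andP[_ h2]; rewrite lerNl -[leLHS]expRK ler_ln ?posrE ?expR_gt0.
  move=> h; rewrite (le_lt_trans a0 (expR_gt0 _))/=.
  by rewrite -[leRHS]lnK ?posrE// ler_expR lerNl.
rewrite lebesgue_measure_itv/= lte_fin b0.
rewrite (@ge0_continuous_FTC2y _ (fun t => expR (- t)) (fun t => - expR (- t)) (- ln b) 0)%R.
- by rewrite !opprK !lnK// -!EFinN -!EFinD; congr (_%:E); ring.
- by move=> t _; exact: expR_ge0.
- exact: continuous_subspaceT.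
- rewrite -[X in _ --> X]oppr0; apply: cvgN.
  exact: cvgr_expR.
- by move=> t _; have [] := dF t.
- by apply: cvg_at_right_filter; exact: cF.
- by move=> t _; exact: dFE.
Qed.

Lemma ge0_integral_affine (c d : R) (f : R -> \bar R) : (c != 0)%R ->
  measurable_fun setT f -> (forall x, 0 <= f x) ->
  \int[mu]_x f x = \int[mu]_t (f (c * t + d)%R * `|c|%:E).
Proof.
move=> c0 mf f0.
apply: (@ge0_integral_transfer R (fun t => c * t + d)%R (fun=> `|c|)%R setT) => //.
- by apply: measurable_funD => //; exact: measurable_funM.
move=> a b ab; rewrite setIT lebesgue_measure_itv/= lte_fin ab.
rewrite integral_cst//; last first.
  rewrite -[X in measurable X]setTI.
  have : measurable_fun [set: measurableTypeR R] (fun t : measurableTypeR R => c * t + d)%R.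
    by apply: measurable_funD => //; exact: measurable_funM.
  by apply => //; exact: measurable_itv.
have [cp|cn|c00] := ltrgt0P c; last by rewrite c00 eqxx in c0.
  rewrite (_ : _ @^-1` _ = (`](a - d) / c, (b - d) / c]%classic : set R))%R; last first.
    by apply/seteqP; split => t; rewrite /= !in_itv/= ltr_pdivrMr// ler_pdivlMr// ltrBlDr lerBrDr mulrC.
  rewrite [X in _ = _ * X]lebesgue_measure_itv/= lte_fin ltr_pM2r ?invr_gt0// ltrD2r ab.
  by rewrite -?EFinN -?EFinD -?EFinM; congr (_%:E); field.
rewrite (_ : _ @^-1` _ = (`[(b - d) / c, (a - d) / c[%classic : set R))%R; last first.
  by apply/seteqP; split => t; rewrite /= !in_itv/= ler_ndivrMr// ltr_ndivlMr// ltrBlDr lerBrDr mulrC andbC.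
rewrite [X in _ = _ * X]lebesgue_measure_itv/= lte_fin ltr_nM2r ?invr_lt0// ltrD2r ab.
by rewrite -?EFinN -?EFinD -?EFinM; congr (_%:E); field.
Qed.

End exponential_substitution.

Section power_substitution.
Context {R : realType}.
Implicit Types (f g : R -> R) (r c d : R).
Local Notation mu := (@lebesgue_measure R).
Local Notation D := (`]0%R, +oo[%classic : set (measurableTypeR R)).

Section substitution.
Variables (phi w : R -> R).
Hypotheses (w0 : forall x, 0 < x -> 0 <= w x).
Hypothesis mS : forall f, rmeas f -> rmeas (fun x => f (phi x) * w x).
Hypothesis S : forall f, rmeas f -> (forall x, 0 < x -> 0 <= f x) ->
  (\int[mu]_(x in D) (f x)%:E = \int[mu]_(x in D) (f (phi x) * w x)%:E)%E.
Hypothesis phi0 : forall x, 0 < x -> 0 < phi x.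

Let S_ge0 f : rintegrable f -> (forall x, 0 < x -> 0 <= f x) ->
  rintegrable (fun x => f (phi x) * w x) /\ rint f = rint (fun x => f (phi x) * w x).
Proof.
move=> fi f0; have mf := rintegrable_meas fi; split.
  apply: ge0_rintegrable; first exact: mS.
    by move=> x x0; rewrite mulr_ge0 ?w0// f0// phi0.
  by rewrite -S// EFin_rint// ltry.
by rewrite /rint /Rintegral S.
Qed.

(** A rule for nonnegative functions extends to integrable ones through [f = (|f| + f) - |f|]. *)
Lemma rint_subst f : rintegrable f ->
  rintegrable (fun x => f (phi x) * w x) /\ rint f = rint (fun x => f (phi x) * w x).
Proof.
move=> fi; have ai := rintegrable_norm fi; have di := rintegrableD ai fi.
have [i1 e1] := S_ge0 ai (fun x _ => normr_ge0 _).
have [x x0|i2 e2] := S_ge0 di.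
  by have := ler_norm (- f x); rewrite normrN; lra.
split.
  apply: eq_rintegrable (rintegrableB i2 i1) => x _ /=; ring.
have -> : rint f = rint (fun x => `|f x| + f x) - rint (fun x => `|f x|).
  by rewrite rintD// addrAC subrr add0r.
rewrite e1 e2 -rintB//; apply: eq_rint => x _; ring.
Qed.

End substitution.

Let ge0_int_expN f : rmeas f -> (forall x, 0 < x -> 0 <= f x) ->
  (\int[mu]_(x in D) (f x)%:E = \int[mu]_t (f (expR (- t)) * expR (- t))%:E)%E.
Proof.
move=> mf f0; rewrite (@ge0_integral_expN _ (fun x => (f x)%:E)).
- by under eq_integral do rewrite -EFinM.
- by apply/measurable_EFinP; exact: mf.
- by move=> x /inD; rewrite lee_fin; exact: f0.
Qed.

Let meas_expN f c d : rmeas f -> measurable_fun [set: measurableTypeR R] (fun t => f (expR (c * t + d))).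
Proof.
move=> mf; apply: (@measurable_comp _ _ _ _ _ _ D f) => //.
  by move=> _ [t _ <-]; rewrite /= in_itv/= andbT expR_gt0.
apply: measurableT_comp => //; apply: measurable_funD => //; exact: measurable_funM.
Qed.

Let meas_e c d : measurable_fun [set: measurableTypeR R] (fun t : R => expR (c * t + d)).
Proof.
apply: measurableT_comp => //; apply: measurable_funD => //; exact: measurable_funM.
Qed.

Let ge0_int_exp f c d : c != 0 -> rmeas f -> (forall x, 0 < x -> 0 <= f x) ->
  (\int[mu]_(x in D) (f x)%:E =
   \int[mu]_t (f (expR (c * t + d)) * expR (c * t + d) * `|c|)%:E)%E.
Proof.
move=> c0 mf f0; rewrite ge0_int_expN//.
rewrite (@ge0_integral_affine _ (- c) (- d) (fun t => (f (expR (- t)) * expR (- t))%:E)) ?oppr_eq0//.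
- apply: eq_integral => t _; rewrite -EFinM normrN.
  by rewrite (_ : - (- c * t + - d) = c * t + d)//; ring.
- apply/measurable_EFinP.
  apply: eq_measurable_fun (measurable_funM (meas_expN (- 1) 0 mf) (meas_e (-1) 0)).
  by move=> t _ /=; rewrite mulN1r addr0.
- by move=> t; rewrite lee_fin mulr_ge0 ?expR_ge0// f0// expR_gt0.
Qed.

(** In the variable [ln x] the map [x |-> e^d x^r] is affine. The cases used later are scalings
    ([r = 1]), squares, inverse square roots, and the powers that produce integrable monomials from
    an indicator. *)
Lemma rint_power r d g : r != 0 -> rintegrable g ->
  rintegrable (fun x => g (expR (r * ln x + d)) * (`|r| * expR (r * ln x + d) / x)) /\
  rint g = rint (fun x => g (expR (r * ln x + d)) * (`|r| * expR (r * ln x + d) / x)).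
Proof.
move=> r0.
have mphi : rmeas (fun x : R => expR (r * ln x + d)).
  apply: rmeas_exp; apply: rmeasD; last exact: rmeas_cst.
  by apply: rmeasM; [exact: rmeas_cst|apply: rmeas_ln; exact: rmeas_id].
have mw : rmeas (fun x => `|r| * expR (r * ln x + d) / x).
  apply: rmeasM; last by apply: rmeasV => //; exact: rmeas_id.
  by apply: rmeasM => //; exact: rmeas_cst.
have mfp f : rmeas f -> rmeas (fun x => f (expR (r * ln x + d))).
  move=> mf; apply: (@measurable_comp _ _ _ _ _ _ D f) => //.
  by move=> _ [t _ <-]; rewrite /= in_itv/= andbT expR_gt0.
apply: (@rint_subst (fun x => expR (r * ln x + d)) (fun x => `|r| * expR (r * ln x + d) / x)).
- by move=> x x0; rewrite !mulr_ge0 ?expR_ge0 ?invr_ge0// ltW.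
- by move=> f mf; apply: rmeasM => //; exact: mfp.
- move=> f mf f0.
  rewrite (ge0_int_exp d r0 mf f0).
  rewrite [RHS](@ge0_int_exp _ 1 0) ?oner_eq0//.
  + apply: eq_integral => t _; rewrite mul1r addr0 expRK normr1 mulr1; congr (_%:E).
    by rewrite -!mulrA; congr (_ * _); rewrite mulVf ?gt_eqF ?expR_gt0// mulr1 mulrC.
  + by apply: rmeasM => //; exact: mfp.
  + by move=> x x0; rewrite mulr_ge0 ?f0 ?expR_gt0// !mulr_ge0 ?expR_ge0 ?invr_ge0// ltW.
- by move=> x _; exact: expR_gt0.
Qed.

(** With [x = e^(d + t)] the half-line becomes the whole line, whose negative half is then folded
    onto the positive one. The parameter [d] is the centre of the fold; a suitable choice turns the
    two terms into a hyperbolic cosine in [lap_vker_bessel_K]. *)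
Lemma rint_exp_fold d g : rintegrable g ->
  rintegrable (fun t => g (expR (d + t)) * expR (d + t) + g (expR (d - t)) * expR (d - t)) /\
  rint g = rint (fun t => g (expR (d + t)) * expR (d + t) + g (expR (d - t)) * expR (d - t)).
Proof.
have mf1 f : rmeas f -> measurable_fun [set: measurableTypeR R] (fun t => f (expR (d + t)) * expR (d + t)).
  move=> mf; apply: eq_measurable_fun (measurable_funM (meas_expN 1 d mf) (meas_e 1 d)).
  by move=> t _ /=; rewrite mul1r addrC.
have mf2 f : rmeas f -> measurable_fun [set: measurableTypeR R] (fun t => f (expR (d - t)) * expR (d - t)).
  move=> mf; apply: eq_measurable_fun (measurable_funM (meas_expN (-1) d mf) (meas_e (-1) d)).
  by move=> t _ /=; rewrite mulN1r addrC.
have mm f : rmeas f -> rmeas (fun t => f (expR (d + t)) * expR (d + t) + f (expR (d - t)) * expR (d - t)).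
  by move=> mf; apply: rmeasD; apply: measurable_funTS; [exact: mf1|exact: mf2].
have S f : rmeas f -> (forall x, 0 < x -> 0 <= f x) ->
  (\int[mu]_(x in D) (f x)%:E = \int[mu]_(t in D) (f (expR (d + t)) * expR (d + t) + f (expR (d - t)) * expR (d - t))%:E)%E.
  move=> mf f0.
  have p1 t : 0 <= f (expR (d + t)) * expR (d + t) by rewrite mulr_ge0 ?expR_ge0// f0// expR_gt0.
  have p2 t : 0 <= f (expR (d - t)) * expR (d - t) by rewrite mulr_ge0 ?expR_ge0// f0// expR_gt0.
  rewrite (ge0_int_exp d (oner_neq0 _) mf f0).
  transitivity (\int[mu]_t (f (expR (d + t)) * expR (d + t))%:E)%E.
    by apply: eq_integral => t _; rewrite normr1 mulr1 mul1r addrC.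
  under [RHS]eq_integral do rewrite EFinD.
  rewrite ge0_integralD//; last 4 first.
  - by move=> t _; rewrite lee_fin.
  - by apply/measurable_EFinP; apply: measurable_funTS; exact: mf1.
  - by move=> t _; rewrite lee_fin.
  - by apply/measurable_EFinP; apply: measurable_funTS; exact: mf2.
  have -> : (\int[mu]_(t in D) (f (expR (d - t)) * expR (d - t))%:E = \int[mu]_(t in `]-oo, 0%R]) (f (expR (d + t)) * expR (d + t))%:E)%E.
    rewrite integral_itv_obnd_cbnd; last by apply/measurable_EFinP; apply: measurable_funTS; exact: mf2.
    rewrite (@ge0_integration_by_substitution0 _ (fun t => (f (expR (d - t)) * expR (d - t))%:E)).
    - by under eq_integral do rewrite opprK.
    - by apply/measurable_EFinP; exact: mf2.
    - by move=> t; rewrite lee_fin.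
  rewrite -ge0_integral_setU//.
  - congr (integral _ _ _); apply/esym/seteqP; split => // t _ /=; rewrite !in_itv/= andbT.
    by case: (leP t 0) => _; [right|left].
  - by apply/measurable_EFinP; apply: measurable_funTS; exact: mf1.
  - by move=> t _; rewrite lee_fin.
  - apply/disj_setPS => t [] /=; rewrite !in_itv/= andbT => h1 h2.
    by rewrite ltNge h2 in h1.
move=> gi; have mg := rintegrable_meas gi.
have S_ge0 f : rintegrable f -> (forall x, 0 < x -> 0 <= f x) ->
    rintegrable (fun t => f (expR (d + t)) * expR (d + t) + f (expR (d - t)) * expR (d - t)) /\
    rint f = rint (fun t => f (expR (d + t)) * expR (d + t) + f (expR (d - t)) * expR (d - t)).
  move=> fi f0; have mf := rintegrable_meas fi; split.
    apply: ge0_rintegrable; first exact: mm.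
      by move=> x x0; rewrite addr_ge0// mulr_ge0 ?expR_ge0// f0// expR_gt0.
    by rewrite -S// EFin_rint// ltry.
  by rewrite /rint /Rintegral S.
have ai := rintegrable_norm gi; have di := rintegrableD ai gi.
have [i1 e1] := S_ge0 _ ai (fun x _ => normr_ge0 _).
have [x x0|i2 e2] := S_ge0 _ di.
  by have := ler_norm (- g x); rewrite normrN; lra.
split.
  apply: eq_rintegrable (rintegrableB i2 i1) => x _ /=; ring.
have -> : rint g = rint (fun x => `|g x| + g x) - rint (fun x => `|g x|).
  by rewrite rintD// addrAC subrr add0r.
rewrite e1 e2 -rintB//; apply: eq_rint => x _; ring.
Qed.

End power_substitution.

(** Measurability is read off the shape of the term; inverses leave the positivity of their argument
    as a goal. *)
Ltac rmeas_tac := repeat match goal with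
  | H : rmeas ?f |- rmeas ?f => exact H
  | |- rmeas (fun x => x) => exact: rmeas_id
  | |- rmeas (fun _ => ?c) => exact: rmeas_cst
  | |- rmeas (fun x => @?a x + @?b x) => apply (@rmeasD _ a b)
  | |- rmeas (fun x => - @?a x) => apply (@rmeasN _ a)
  | |- rmeas (fun x => @?a x * @?b x) => apply (@rmeasM _ a b)
  | |- rmeas (fun x => `|@?a x|) => apply (@rmeas_norm _ a)
  | |- rmeas (fun x => expR (@?a x)) => apply (@rmeas_exp _ a)
  | |- rmeas (fun x => ln (@?a x)) => apply (@rmeas_ln _ a)
  | |- rmeas (fun x => cos (@?a x)) => apply (@rmeas_cos _ a)
  | |- rmeas (fun x => sin (@?a x)) => apply (@rmeas_sin _ a)
  | |- rmeas (fun x => Num.sqrt (@?a x)) => apply (@rmeas_sqrt _ a)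
  | |- rmeas (fun x => @?a x ^+ ?n) => apply (@rmeasX _ a n)
  | |- rmeas (fun x => (@?a x)^-1) => apply (@rmeasV _ a)
  | H : rmeas ?f |- rmeas (fun x => ?f x) => exact H
  end.

(** * The same integration theory for complex-valued functions *)

Section complex_layer.
Context {R : realType}.
Implicit Types (g : R -> R[i]) (h : R -> R) (x y r : R) (c s : R[i]).

Definition cmeas g := rmeas (fun x => re (g x)) /\ rmeas (fun x => im (g x)).

Lemma eq_cmeas g g' : (forall x, 0 < x -> g x = g' x) -> cmeas g -> cmeas g'.
Proof.
by move=> e [a b]; split; [apply: eq_rmeas a|apply: eq_rmeas b] => x x0; rewrite e.
Qed.
Lemma cmeas_cst c : cmeas (fun=> c).
Proof. by split; exact: rmeas_cst. Qed.
Lemma cmeas_real h : rmeas h -> cmeas (fun x => (h x)%:C).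
Proof. by move=> mh; split => //=; exact: rmeas_cst. Qed.
Lemma cmeasM g g' : cmeas g -> cmeas g' -> cmeas (fun x => g x * g' x).
Proof.
move=> [a b] [c d]; split.
  by apply: (eq_rmeas (fun x _ => esym (ReM _ _))); apply: rmeasB; apply: rmeasM.
by apply: (eq_rmeas (fun x _ => esym (ImM _ _))); apply: rmeasD; apply: rmeasM.
Qed.
Lemma cmeasD g g' : cmeas g -> cmeas g' -> cmeas (fun x => g x + g' x).
Proof.
move=> [a b] [c d]; split.
  by apply: (eq_rmeas (fun x _ => esym (ReD _ _))); apply: rmeasD.
by apply: (eq_rmeas (fun x _ => esym (ImD _ _))); apply: rmeasD.
Qed.
Lemma cmeasN g : cmeas g -> cmeas (fun x => - g x).
Proof.
move=> [a b]; split.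
  by apply: (eq_rmeas (fun x _ => esym (ReN _))); apply: rmeasN.
by apply: (eq_rmeas (fun x _ => esym (ImN _))); apply: rmeasN.
Qed.
Lemma cmeas_cpow h s : rmeas h -> cmeas (fun x => cpow (h x) s).
Proof.
move=> mh; split.
  apply: (eq_rmeas (fun x _ => esym (re_cpow _ _))); rmeas_tac.
apply: (eq_rmeas (fun x _ => esym (im_cpow _ _))); rmeas_tac.
Qed.
Lemma rmeas_normc g : cmeas g -> rmeas (fun x => normc (g x)).
Proof.
move=> [a b]; apply: (@eq_rmeas _ (fun x => Num.sqrt (re (g x) ^+ 2 + im (g x) ^+ 2))).
  by move=> x _; case: (g x).
rmeas_tac.
Qed.
Lemma cmeas_lim (gn : nat -> R -> R[i]) g : (forall n, cmeas (gn n)) ->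
  (forall x, 0 < x -> ccvg (gn^~ x) (g x)) -> cmeas g.
Proof.
move=> m c; split.
  apply: (@measurable_fun_cvg _ _ _ _ (fun n x => re (gn n x))); first by move=> n; case: (m n).
  by move=> x /inD /c [].
apply: (@measurable_fun_cvg _ _ _ _ (fun n x => im (gn n x))); first by move=> n; case: (m n).
by move=> x /inD /c [].
Qed.

Lemma eq_cint g g' : (forall x, 0 < x -> g x = g' x) -> cint g = cint g'.
Proof. by move=> e; congr (_ +i* _); apply: eq_rint => x x0; rewrite e. Qed.
Lemma eq_cintegrable g g' : (forall x, 0 < x -> g x = g' x) -> cintegrable g -> cintegrable g'.
Proof. by move=> e [a b]; split; [apply: eq_rintegrable a|apply: eq_rintegrable b] => x x0; rewrite e. Qed.
Lemma cintegrable_meas g : cintegrable g -> cmeas g.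
Proof. by move=> [a b]; split; exact: rintegrable_meas. Qed.
Lemma cintegrable_le g h : cmeas g -> rintegrable h ->
  (forall x, 0 < x -> normc (g x) <= h x) -> cintegrable g.
Proof.
move=> [a b] ih gh; split.
  by apply: (rintegrable_le a ih) => x x0; rewrite (le_trans (normc_re _))// gh.
by apply: (rintegrable_le b ih) => x x0; rewrite (le_trans (normc_im _))// gh.
Qed.
Lemma rintegrable_normc g : cintegrable g -> rintegrable (fun x => normc (g x)).
Proof.
move=> ig; have mg := cintegrable_meas ig; case: ig => a b.
apply: (rintegrable_le (rmeas_normc mg) (rintegrableD (rintegrable_norm a) (rintegrable_norm b))).
by move=> x _; rewrite ger0_norm ?normc_ge0// normc_le.
Qed.
Lemma cintegrable_real h : rintegrable h -> cintegrable (fun x => (h x)%:C).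
Proof. by move=> ih; split => //=; exact: rintegrable0. Qed.
Lemma cint_real h : cint (fun x => (h x)%:C) = (rint h)%:C.
Proof. by congr (_ +i* _); exact: rint0. Qed.
Lemma cintegrableD g g' : cintegrable g -> cintegrable g' -> cintegrable (fun x => g x + g' x).
Proof.
move=> [a b] [c d]; split.
  by apply: (eq_rintegrable (fun x _ => esym (ReD _ _))); exact: (rintegrableD a c).
by apply: (eq_rintegrable (fun x _ => esym (ImD _ _))); exact: (rintegrableD b d).
Qed.
Lemma cintD g g' : cintegrable g -> cintegrable g' ->
  cint (fun x => g x + g' x) = cint g + cint g'.
Proof.
move=> [a b] [c d]; apply: complex_ext; rewrite /cint /=.
  by rewrite -[RHS](rintD a c); apply: eq_rint => x _; rewrite ReD.
by rewrite -[RHS](rintD b d); apply: eq_rint => x _; rewrite ImD.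
Qed.
Lemma cintegrableZ c g : cintegrable g -> cintegrable (fun x => c * g x).
Proof.
move=> ig; apply: (@cintegrable_le _ (fun x => normc c * normc (g x))).
- by apply: cmeasM; [exact: cmeas_cst|exact: cintegrable_meas].
- exact/rintegrableZ/rintegrable_normc.
- by move=> x _; rewrite normcM.
Qed.
Lemma cintZ c g : cintegrable g -> cint (fun x => c * g x) = c * cint g.
Proof.
move=> [a b]; apply: complex_ext.
  rewrite ReM /cint /= -(rintZ (re c) a) -(rintZ (im c) b) -rintB; last 2 first.
  - exact: (rintegrableZ _ a).
  - exact: (rintegrableZ _ b).
  by apply: eq_rint => x _; rewrite ReM.
rewrite ImM /cint /= -(rintZ (im c) a) -(rintZ (re c) b) -rintD; last 2 first.
- exact: (rintegrableZ _ b).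
- exact: (rintegrableZ _ a).
by apply: eq_rint => x _; rewrite ImM.
Qed.
Lemma cintegrableN g : cintegrable g -> cintegrable (fun x => - g x).
Proof.
move=> ig; apply: (@eq_cintegrable (fun x => -1 * g x)); last exact: cintegrableZ.
by move=> x _; rewrite mulN1r.
Qed.
Lemma cintN g : cintegrable g -> cint (fun x => - g x) = - cint g.
Proof.
by move=> ig; rewrite -mulN1r -cintZ//; apply: eq_cint => x _; rewrite mulN1r.
Qed.
Lemma cintegrableB g g' : cintegrable g -> cintegrable g' -> cintegrable (fun x => g x - g' x).
Proof. by move=> i j; exact: (cintegrableD i (cintegrableN j)). Qed.
Lemma cintB g g' : cintegrable g -> cintegrable g' ->
  cint (fun x => g x - g' x) = cint g - cint g'.
Proof. by move=> i j; rewrite (cintD i (cintegrableN j)) cintN. Qed.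
(** The factor 2 comes from bounding the two components separately; later estimates absorb it in
    their constants. *)
Lemma normc_cint_le g h : cintegrable g -> rintegrable h ->
  (forall x, 0 < x -> normc (g x) <= h x) -> normc (cint g) <= 2 * rint h.
Proof.
move=> [a b] ih gh; apply: (le_trans (normc_le _)); rewrite mulr_natl mulr2n /cint /=.
apply: lerD; apply: abs_rint_le => // x x0.
  by rewrite (le_trans (normc_re _))// gh.
by rewrite (le_trans (normc_im _))// gh.
Qed.

Lemma cint_cvg (gn : nat -> R -> R[i]) g h :
  (forall n, cmeas (gn n)) -> rintegrable h ->
  (forall n x, 0 < x -> normc (gn n x) <= h x) ->
  (forall x, 0 < x -> ccvg (gn^~ x) (g x)) ->
  cintegrable g /\ ccvg (fun n => cint (gn n)) (cint g).
Proof.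
move=> m ih b c.
have [] := @rint_cvg R (fun n x => re (gn n x)) (fun x => re (g x)) h _ ih.
- by move=> n; case: (m n).
- by move=> n x x0; rewrite (le_trans (normc_re _))// b.
- by move=> x /c [].
move=> i1 c1.
have [] := @rint_cvg R (fun n x => im (gn n x)) (fun x => im (g x)) h _ ih.
- by move=> n; case: (m n).
- by move=> n x x0; rewrite (le_trans (normc_im _))// b.
- by move=> x /c [].
by move=> i2 c2.
Qed.

Lemma cint_power r d g : r != 0 -> cintegrable g ->
  cintegrable (fun x => g (expR (r * ln x + d)) * (`|r| * expR (r * ln x + d) / x)%:C) /\
  cint g = cint (fun x => g (expR (r * ln x + d)) * (`|r| * expR (r * ln x + d) / x)%:C).
Proof.
move=> r0 [a b].
have [a1 a2] := rint_power d r0 a; have [b1 b2] := rint_power d r0 b.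
split; first split.
- by apply: eq_rintegrable a1 => x _; rewrite ReMC.
- by apply: eq_rintegrable b1 => x _; rewrite ImMC.
- apply: complex_ext; rewrite /cint /=.
    by apply: (etrans a2); apply: eq_rint => x _; rewrite ReMC.
  by apply: (etrans b2); apply: eq_rint => x _; rewrite ImMC.
Qed.

Lemma cint_exp_fold d g : cintegrable g ->
  cintegrable (fun t => g (expR (d + t)) * (expR (d + t))%:C + g (expR (d - t)) * (expR (d - t))%:C) /\
  cint g = cint (fun t => g (expR (d + t)) * (expR (d + t))%:C + g (expR (d - t)) * (expR (d - t))%:C).
Proof.
move=> [a b].
have [a1 a2] := rint_exp_fold d a; have [b1 b2] := rint_exp_fold d b.
split; first split.
- by apply: eq_rintegrable a1 => x _; rewrite ReD !ReMC.
- by apply: eq_rintegrable b1 => x _; rewrite ImD !ImMC.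
- apply: complex_ext; rewrite /cint /=.
    by apply: (etrans a2); apply: eq_rint => x _; rewrite ReD !ReMC.
  by apply: (etrans b2); apply: eq_rint => x _; rewrite ImD !ImMC.
Qed.

Lemma rint_scale r h : 0 < r -> rintegrable h ->
  rintegrable (fun x => h (r * x) * r) /\ rint h = rint (fun x => h (r * x) * r).
Proof.
move=> r0 ih; have [i e] := rint_power (ln r) (oner_neq0 R) ih.
have E x : 0 < x -> h (expR (1 * ln x + ln r)) * (`|1| * expR (1 * ln x + ln r) / x) = h (r * x) * r.
  move=> x0; rewrite mul1r expRD !lnK// normr1 mul1r mulrAC divff ?gt_eqF// mul1r.
  by rewrite (mulrC x).
by split; [apply: eq_rintegrable i|rewrite e; apply: eq_rint].
Qed.
Lemma cint_scale r g : 0 < r -> cintegrable g ->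
  cintegrable (fun x => g (r * x) * r%:C) /\ cint g = cint (fun x => g (r * x) * r%:C).
Proof.
move=> r0 ih; have [i e] := cint_power (ln r) (oner_neq0 R) ih.
have E x : 0 < x -> g (expR (1 * ln x + ln r)) * (`|1| * expR (1 * ln x + ln r) / x)%:C = g (r * x) * r%:C.
  move=> x0; rewrite mul1r expRD !lnK// normr1 mul1r mulrAC divff ?gt_eqF// mul1r.
  by rewrite (mulrC x).
by split; [apply: eq_cintegrable i|rewrite e; apply: eq_cint].
Qed.

Definition cmeas2 (g : R -> R -> R[i]) :=
  rmeas2 (fun x y => re (g x y)) /\ rmeas2 (fun x y => im (g x y)).

Lemma cmeas2_fst g : cmeas g -> cmeas2 (fun x _ => g x).
Proof. by move=> [a b]; split; [exact: (rmeas2_fst a)|exact: (rmeas2_fst b)]. Qed.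
Lemma cmeas2_snd g : cmeas g -> cmeas2 (fun _ y => g y).
Proof. by move=> [a b]; split; [exact: (rmeas2_snd a)|exact: (rmeas2_snd b)]. Qed.
Lemma cmeas2_real (k : R -> R -> R) : rmeas2 k -> cmeas2 (fun x y => (k x y)%:C).
Proof. by move=> mk; split => //=; exact: measurable_cst. Qed.
Lemma cmeas2M (g1 g2 : R -> R -> R[i]) : cmeas2 g1 -> cmeas2 g2 -> cmeas2 (fun x y => g1 x y * g2 x y).
Proof.
move=> [a b] [c d]; split.
  by apply: (eq_rmeas2 (fun x y _ _ => esym (ReM _ _))); apply: rmeas2B; apply: rmeas2M.
by apply: (eq_rmeas2 (fun x y _ _ => esym (ImM _ _))); apply: rmeas2D; apply: rmeas2M.
Qed.
Lemma cmeas2_swap (g : R -> R -> R[i]) : cmeas2 g -> cmeas2 (fun x y => g y x).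
Proof. by move=> [a b]; split; [exact: (rmeas2_swap a)|exact: (rmeas2_swap b)]. Qed.
Lemma cmeas_cint (g : R -> R -> R[i]) : cmeas2 g -> (forall x, 0 < x -> cintegrable (g x)) ->
  cmeas (fun x => cint (g x)).
Proof.
move=> [a b] i; split.
  by apply: (rmeas_rint a) => x /i [].
by apply: (rmeas_rint b) => x /i [].
Qed.

Lemma cfubini (g : R -> R -> R[i]) (G : R -> R) : cmeas2 g ->
  (forall x, 0 < x -> cintegrable (g x)) ->
  (forall y, 0 < y -> cintegrable (g^~ y)) -> rintegrable G ->
  (forall x, 0 < x -> rint (fun y => normc (g x y)) <= G x) ->
  [/\ cintegrable (fun x => cint (g x)), cintegrable (fun y => cint (g^~ y)) &
      cint (fun x => cint (g x)) = cint (fun y => cint (g^~ y))].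
Proof.
move=> [a b] i j iG gG.
have [||||a1 a2 a3] := rfubini (G := G) a.
- by move=> x /i [].
- by move=> y /j [].
- exact: iG.
- move=> x x0; apply: le_trans (gG _ x0); apply: le_rint => [||y y0].
  + by case: (i x x0) => ? ?; exact: rintegrable_norm.
  + exact/rintegrable_normc/i.
  + exact: normc_re.
have [||||b1 b2 b3] := rfubini (G := G) b.
- by move=> x /i [].
- by move=> y /j [].
- exact: iG.
- move=> x x0; apply: le_trans (gG _ x0); apply: le_rint => [||y y0].
  + by case: (i x x0) => ? ?; exact: rintegrable_norm.
  + exact/rintegrable_normc/i.
  + exact: normc_im.
split.
- by split.
- by split.
- by rewrite /cint; congr (_ +i* _); [exact: a3|exact: b3].
Qed.

End complex_layer.

(** * Integrability of powers against exponentials and Gaussians *)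

Section integrable_powers.
Context {R : realType}.
Implicit Types (x y r c p q : R).
Local Notation mu := (@lebesgue_measure R).
Local Notation D := (`]0%R, +oo[%classic : set (measurableTypeR R)).

Lemma ln_le_sub1 x : 0 < x -> ln x <= x - 1.
Proof.
move=> x0; have := @expR_ge1Dx R (ln x); rewrite lnK//; lra.
Qed.

(** This is the boundedness of [x^r e^(- c x)], from [ln y <= y - 1] at [y = c x / (r + 1)]. Using
    [r + 1] in place of the [r] of the true maximizer [r / c] includes [r = 0]. *)
Lemma mul_ln_le r c x : 0 <= r -> 0 < c -> 0 < x ->
  r * ln x - c * x <= r * ln ((r + 1) / c).
Proof.
move=> r0 c0 x0; have r1 : 0 < r + 1 by lra.
have h := @ln_le_sub1 (x * c / (r + 1)) _.
have : ln (x * (c / (r + 1))) <= x * (c / (r + 1)) - 1.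
  by apply: ln_le_sub1; rewrite mulr_gt0// divr_gt0.
rewrite lnM ?posrE ?divr_gt0//.
have -> : ln (c / (r + 1)) = - ln ((r + 1) / c) by rewrite -lnV ?posrE ?divr_gt0// invf_div.
move=> {h} h.
have h2 : r * (ln x - ln ((r + 1) / c)) <= r * (x * (c / (r + 1)) - 1) by rewrite ler_wpM2l.
have h3 : r * (x * (c / (r + 1))) <= c * x.
  rewrite (_ : r * _ = (c * x) * (r / (r + 1))); last by field; rewrite gt_eqF.
  by rewrite ler_piMr ?mulr_ge0 ?(ltW c0) ?(ltW x0)// ler_pdivrMr//; lra.
lra.
Qed.

Lemma rintegrable_indic01 : rintegrable (fun x : R => if x <= 1 then 1 else 0 : R).
Proof.
have m : rmeas (fun x : R => if x <= 1 then 1 else 0 : R).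
  by apply: rmeas_ltif; rmeas_tac.
apply: ge0_rintegrable => //; first by move=> x _; case: ifP.
apply: (@le_lt_trans _ _ (\int[mu]_(x in D) (\1_(`]0%R, 1%R]%classic : set R) x)%:E)%E).
  rewrite le_eqVlt; apply/orP; left; apply/eqP; apply: eq_integral => x /memD x0.
  rewrite indicE; case: ifPn => x1.
    by rewrite mem_set//= in_itv/= x0 x1.
  by rewrite memNset//= in_itv/= (negbTE x1) andbF.
rewrite integral_indic//.
apply: (@le_lt_trans _ _ (mu (`]0%R, 1%R]%classic : set R))%E).
  by apply: le_measure; rewrite ?inE; [exact: measurableI|exact: measurable_itv|exact: subIsetl].
by rewrite lebesgue_measure_itv/= lte_fin ltr01 sube0 ltry.
Qed.

(** The substitution by [x^(r + 1)] maps []0, 1]] to itself and turns its indicator into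
    [(r + 1) x^r]. *)
Lemma rintegrable_pw01 r : -1 < r -> rintegrable (fun x => if x <= 1 then pw x r else 0).
Proof.
move=> r1; have s0 : 0 < r + 1 by lra.
have [i _] := rint_power 0 (lt0r_neq0 s0) rintegrable_indic01.
have := rintegrableZ (r + 1)^-1 i; apply: eq_rintegrable => x x0.
rewrite addr0 gtr0_norm// (_ : (expR ((r + 1) * ln x) <= 1) = (x <= 1)); last first.
  by rewrite -[X in _ <= X]expR0 ler_expR pmulr_rle0// -ln1 ler_ln// posrE.
case: ifP => _; last by rewrite mul0r mulr0.
have -> : expR ((r + 1) * ln x) = pw x r * x by rewrite mulrDl mul1r expRD lnK.
by field; rewrite !gt_eqF.
Qed.

(** The same substitution, now with [r + 1 < 0], exchanges the two sides of 1. Domination replaces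
    equality because the point 1 lies in the transformed interval but not in the target one. *)
Lemma rintegrable_pw1y r : r < -1 -> rintegrable (fun x => if x <= 1 then 0 else pw x r).
Proof.
move=> r1; have s0 : r + 1 < 0 by lra.
have [i _] := rint_power 0 (ltr0_neq0 s0) rintegrable_indic01.
have := rintegrableZ (- (r + 1))^-1 i; move=> {}i.
apply: (rintegrable_le _ i) => [|x x0].
  by apply: rmeas_ltif; rmeas_tac.
rewrite addr0 (ltr0_norm s0); case: (leP x 1) => x1.
  rewrite normr0; apply: mulr_ge0; first by rewrite invr_ge0; lra.
  by apply: mulr_ge0; [case: ifP|rewrite !mulr_ge0 ?expR_ge0 ?invr_ge0 ?(ltW x0)//; lra].
have -> : expR ((r + 1) * ln x) <= 1.
  by rewrite -[X in _ <= X]expR0 ler_expR nmulr_rle0// ln_ge0// ltW.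
have -> : expR ((r + 1) * ln x) = pw x r * x by rewrite mulrDl mul1r expRD lnK.
rewrite ger0_norm ?expR_ge0// le_eqVlt; apply/orP; left; apply/eqP.
by field; rewrite gt_eqF//= lt_eqF.
Qed.

Lemma rintegrable_pw p q : -1 < p -> q < -1 ->
  rintegrable (fun x => if x <= 1 then pw x p else pw x q).
Proof.
move=> p1 q1; have := rintegrableD (rintegrable_pw01 p1) (rintegrable_pw1y q1).
by apply: eq_rintegrable => x _; case: ifP; rewrite ?addr0 ?add0r.
Qed.

Lemma rintegrable_gauss r (B p : R) : -1 < r -> 0 <= B -> 0 < p ->
  rintegrable (fun x => pw x r * expR (B * x - p * x ^+ 2)).
Proof.
move=> r1 B0 p0.
(* For [x > 1] this gives [(r + 2) ln x + B x <= K x], and completing the square bounds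
   [K x - p x^2] by [K^2 / p]; the remaining factor is [x^(- 2)]. *)
pose K := `|r + 2| + B.
have h2 : -2 < -1 :> R by lra.
apply: (rintegrable_le _ (rintegrableZ (expR (B + K ^+ 2 / p)) (rintegrable_pw r1 h2))) => [|x x0].
  by rmeas_tac.
  rewrite ger0_norm ?mulr_ge0 ?expR_ge0// mulrC.
  have KB : 0 <= K ^+ 2 / p by rewrite divr_ge0 ?sqr_ge0// ltW.
  case: ifPn => x1.
    rewrite ler_pM2r ?expR_gt0// ler_expR.
    have : B * x <= B by rewrite ler_piMr.
    have : 0 <= p * x ^+ 2 by rewrite mulr_ge0 ?sqr_ge0// ltW.
    lra.
  rewrite -!expRD ler_expR.
  have x1' : 1 < x by rewrite ltNge.
  have l0 : 0 <= ln x by rewrite ln_ge0// ltW.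
  have l1 : (r + 2) * ln x <= `|r + 2| * x.
    apply: (@le_trans _ _ (`|r + 2| * ln x)); first by rewrite ler_wpM2r// ler_norm.
    by rewrite ler_wpM2l//; have := ln_le_sub1 x0; lra.
  have : 0 <= p * (x - K / p) ^+ 2 by rewrite mulr_ge0 ?sqr_ge0// ltW.
  have -> : p * (x - K / p) ^+ 2 = p * x ^+ 2 - 2 * (K * x) + K ^+ 2 / p by field; rewrite gt_eqF.
  have : K * x = `|r + 2| * x + B * x by rewrite /K mulrDl.
  have : 0 <= K * x by rewrite mulr_ge0 ?addr_ge0// ltW.
  lra.
Qed.

Lemma rintegrable_gamma r c : -1 < r -> 0 < c ->
  rintegrable (fun x => pw x r * expR (- (c * x))).
Proof.
move=> r1 c0.
pose K := `|r + 2| * ln ((`|r + 2| + 1) / c).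
have h2 : -2 < -1 :> R by lra.
apply: (rintegrable_le _ (rintegrableZ (1 + expR K) (rintegrable_pw r1 h2))) => [|x x0].
  by rmeas_tac.
  rewrite ger0_norm ?mulr_ge0 ?expR_ge0//.
  case: ifPn => x1.
    rewrite mulrC ler_pM2r ?expR_gt0//.
    have : expR (- (c * x)) <= 1 by rewrite -expR0 ler_expR oppr_le0 mulr_ge0// ltW.
    by have := expR_gt0 K; lra.
  have x1' : 1 < x by rewrite ltNge.
  have l0 : 0 <= ln x by rewrite ln_ge0// ltW.
  apply: (@le_trans _ _ (expR K * expR (-2 * ln x))); last first.
    by rewrite ler_pM2r ?expR_gt0//; lra.
  rewrite -!expRD ler_expR.
  have h := mul_ln_le (normr_ge0 (r + 2)) c0 x0.
  have : (r + 2) * ln x <= `|r + 2| * ln x by rewrite ler_wpM2r// ler_norm.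
  rewrite -/K in h; lra.
Qed.

Lemma cintegrable_gamma (s : R[i]) c : -1 < re s -> 0 < c ->
  cintegrable (fun x => cpow x s * (expR (- (c * x)))%:C).
Proof.
move=> s1 c0; apply: (cintegrable_le _ (rintegrable_gamma s1 c0)).
  apply: cmeasM; first by apply: cmeas_cpow; rmeas_tac.
  by apply: cmeas_real; rmeas_tac.
by move=> x _; rewrite normcM_real ?expR_ge0// normc_cpow.
Qed.

End integrable_powers.

(** * The improper fundamental theorem of calculus *)

Section ftc.
Context {R : realType}.
Implicit Types (x y r c a : R).
Local Notation mu := (@lebesgue_measure R).
Local Notation D := (`]0%R, +oo[%classic : set (measurableTypeR R)).

(** Integrability of [f] is assumed, so dominated convergence passes from compact intervals to the
    ray, and limits of [F] along one sequence at each end suffice. *)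
Lemma rint_FTC (F f : R -> R) a l0 l1 : 0 <= a ->
  (forall x, a < x -> is_derive x 1 F (f x)) ->
  (forall x, a < x -> {for x, continuous f}) ->
  rintegrable (fun x => if x <= a then 0 else f x) ->
  (fun n : nat => F (a + n.+2%:R^-1)) @ \oo --> l0 ->
  (fun n : nat => F (a + n.+2%:R)) @ \oo --> l1 ->
  rint (fun x => if x <= a then 0 else f x) = l1 - l0.
Proof.
move=> a0 dF cf fi c0 c1.
(* The offset 2 gives [1 / (n + 2) < 1 < n + 2], so the interval is nondegenerate already at
   [n = 0]. *)
pose l n := a + n.+2%:R^-1; pose u n := a + n.+2%:R.
have al n : a < l n by rewrite ltrDl invr_gt0.
have lu n : l n < u n.
  rewrite ltrD2l (@lt_trans _ _ 1)//; last by rewrite ltr1n.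
  by rewrite invf_lt1// ltr1n.
pose g n x := if x <= l n then 0 else if x <= u n then f x else 0.
have cfl n : {within `[l n, u n], continuous f}.
  apply: continuous_in_subspaceT => x; rewrite inE/= in_itv/= => /andP[h _].
  by apply: cf; exact: lt_le_trans (al n) h.
have gE n : rint (g n) = F (u n) - F (l n).
  have h := @continuous_FTC2 R f F (l n) (u n) (lu n) (cfl n) _ _.
  have : (\int[mu]_(x in D) (g n x)%:E = \int[mu]_(x in `[l n, u n]) (f x)%:E)%E.
    have -> : (\int[mu]_(x in `[l n, u n]) (f x)%:E = \int[mu]_(x in `]l n, u n]) (f x)%:E)%E.
      rewrite integral_itv_obnd_cbnd//.
      apply/measurable_EFinP; apply: subspace_continuous_measurable_fun => //.
      by apply: continuous_subspaceW (cfl n) => x /=; rewrite !in_itv/= => /andP[/ltW -> ->].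
    rewrite integral_mkcond [RHS]integral_mkcond; apply: eq_integral => x _.
    rewrite !patchE; case: (boolP (x \in D)) => xD; last first.
      rewrite memNset//= in_itv/= => /andP[h1 _]; move/negP: xD; apply; apply: mem_set.
      by rewrite /= in_itv/= andbT (le_lt_trans a0)// (lt_trans (al n)).
    have x0 := memD xD; rewrite /g.
    have [xl|lx] := leP x (l n).
      by rewrite memNset//= in_itv/= ltNge xl.
    have [xu|ux] := leP x (u n).
      by rewrite mem_set//= in_itv/= lx xu.
    by rewrite memNset//= in_itv/= (leNgt x) ux andbF.
  rewrite /rint /Rintegral => ->; rewrite h//.
  - split.
    + by move=> x; rewrite in_itv/= => /andP[h1 _]; have [] := dF x (lt_trans (al n) h1).
    + apply: cvg_at_right_filter; apply: differentiable_continuous; apply/derivable1_diffP.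
      by have [] := dF _ (al n).
    + apply: cvg_at_left_filter; apply: differentiable_continuous; apply/derivable1_diffP.
      by have [] := dF _ (lt_trans (al n) (lu n)).
  - move=> x; rewrite in_itv/= => /andP[h1 _]; rewrite derive1E.
    by have dx := dF x (lt_trans (al n) h1); apply: derive_val.
have mf := rintegrable_meas fi.
have mg n : rmeas (g n).
  apply: (@eq_rmeas _ (fun x => if x <= l n then 0 else if x <= u n then (if x <= a then 0 else f x) else 0)).
    move=> x x0; rewrite /g; case: ifPn => //; rewrite -ltNge => h.
    by rewrite (leNgt x a) (lt_trans (al n) h).
  by do 2 (apply: rmeas_ltif; rmeas_tac).
have [] := @rint_cvg R g (fun x => if x <= a then 0 else f x) _ mg (rintegrable_norm fi).
- move=> n x x0; rewrite /g; case: ifPn => [_|]; first by rewrite normr0.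
  rewrite -ltNge => h; rewrite (leNgt x a) (lt_trans (al n) h)/=.
  by case: ifP => // _; rewrite normr0.
- move=> x x0; apply: cvg_near_cst.
  case: ifPn => [xa|]; first by near=> n; rewrite /g (le_trans xa)// ltW.
  rewrite -ltNge => ax; near=> n.
  have h1 : l n < x.
    rewrite /l -ltrBrDl invf_plt ?posrE ?subr_gt0//.
    rewrite (@lt_le_trans _ _ n%:R)//; last by rewrite ler_nat; exact: leq_trans (leqnSn _) (leqnSn _).
    by near: n; exact: nbhs_infty_gtr.
  have h2 : x <= u n.
    rewrite /u -lerBlDl (@le_trans _ _ n%:R)//; last by rewrite ler_nat; exact: leq_trans (leqnSn _) (leqnSn _).
    by near: n; exact: nbhs_infty_ger.
  by rewrite /g leNgt h1/= h2.
move=> _ h.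
apply: (cvg_unique _ h) => //.
rewrite (_ : (fun n => rint (g n)) = fun n => F (u n) - F (l n)); last by apply/funext.
exact: cvgB.
Unshelve. all: by end_near. Qed.

End ftc.

(** * Primitives with logarithmic oscillation *)

Section oscillating_exponential.
Context {R : realType}.
Implicit Types (x y r X : R).

Lemma cvg_expN0 (u : nat -> R) : u @ \oo --> +oo -> (fun n => expR (- u n)) @ \oo --> 0.
Proof. by move=> uy; exact: (cvg_comp _ _ uy (@cvgr_expR R)). Qed.

Lemma cvg_natS2 : (fun n : nat => n.+2%:R : R) @ \oo --> +oo.
Proof.
apply/cvgryPge => A; near=> n.
rewrite (@le_trans _ _ n%:R)//; last by rewrite ler_nat; exact: leq_trans (leqnSn _) (leqnSn _).
by near: n; exact: nbhs_infty_ger.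
Unshelve. all: by end_near. Qed.

Lemma cvg_mul_lnS2 r : 0 < r -> (fun n : nat => r * ln (n.+2%:R : R)) @ \oo --> +oo.
Proof.
move=> r0; apply/cvgryPge => A; near=> n.
rewrite -ler_pdivrMl// -[leLHS]expRK ler_ln ?posrE ?expR_gt0//.
near: n; move/cvgryPge: cvg_natS2; exact.
Unshelve. all: by end_near. Qed.

Lemma cvg_mulS2 r : 0 < r -> (fun n : nat => r * n.+2%:R) @ \oo --> +oo.
Proof.
move=> r0; apply/cvgryPge => A; near=> n.
rewrite -ler_pdivrMl//; near: n; move/cvgryPge: cvg_natS2; exact.
Unshelve. all: by end_near. Qed.

Lemma ler_trig (A B w : R) : `|A * cos w + B * sin w| <= `|A| + `|B|.
Proof.
apply: (le_trans (ler_normD _ _)); rewrite !normrM.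
by apply: lerD; rewrite ler_piMr// ler_norml; [rewrite cos_geN1 cos_le1|rewrite sin_geN1 sin_le1].
Qed.

Variables (s c w A B : R).
(** For [(A, B)] equal to [(1, 0)] and [(0, 1)] these are the real and imaginary parts of
    [x^(s + i w) e^(- c x)]; general pairs serve the primitive in [oscillation_bound]. *)
Definition osc x := expR (s * ln x - c * x) * (A * cos (w * ln x) + B * sin (w * ln x)).
Definition dosc x := expR (s * ln x - c * x) *
  ((s / x - c) * (A * cos (w * ln x) + B * sin (w * ln x)) +
   w / x * (B * cos (w * ln x) - A * sin (w * ln x))).

Lemma is_derive_osc x : 0 < x -> is_derive x 1 osc (dosc x).
Proof.
move=> x0.
have dl : is_derive x 1 (@ln R) x^-1 by exact: is_derive1_ln.
have d1 : is_derive x 1 (fun x => s * ln x - c * x) (s / x - c).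
  by apply: is_derive_eq; rewrite /GRing.scale/=; ring.
have d2 : is_derive x 1 (fun x => w * ln x) (w / x).
  by apply: is_derive_eq; rewrite /GRing.scale/=; ring.
have de : is_derive x 1 (expR \o (fun x => s * ln x - c * x)) (expR (s * ln x - c * x) * (s / x - c)).
  by apply: is_derive1_comp.
have dc : is_derive x 1 (cos \o (fun x => w * ln x)) (- sin (w * ln x) * (w / x)).
  by apply: is_derive1_comp.
have ds : is_derive x 1 (sin \o (fun x => w * ln x)) (cos (w * ln x) * (w / x)).
  by apply: is_derive1_comp.
have E : osc = (expR \o (fun x => s * ln x - c * x)) * (A *: (cos \o (fun x => w * ln x)) + B *: (sin \o (fun x => w * ln x))).
  by apply/funext => y.
rewrite E; apply: (is_derive_eq (is_deriveM de (is_deriveD (is_deriveZ A dc) (is_deriveZ B ds)))).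
rewrite /dosc.
transitivity (expR (s * ln x - c * x) *
 (A * (- sin (w * ln x) * (w / x)) + B * (cos (w * ln x) * (w / x))) +
 (A * cos (w * ln x) + B * sin (w * ln x)) *
 (expR (s * ln x - c * x) * (s / x - c))); first by [].
ring.
Qed.

Lemma continuous_dosc x : 0 < x -> {for x, continuous dosc}.
Proof.
move=> x0.
have cl : ln y @[y --> x] --> ln x by exact: continuous_ln.
have cV : y^-1 @[y --> x] --> x^-1 by apply: cvgV; [rewrite gt_eqF|exact: cvg_id].
have cw : w * ln y @[y --> x] --> w * ln x by apply: cvgM => //; exact: cvg_cst.
have cc : cos (w * ln y) @[y --> x] --> cos (w * ln x) by apply: (continuous_cvg _ (@continuous_cos R _)).
have cs : sin (w * ln y) @[y --> x] --> sin (w * ln x) by apply: (continuous_cvg _ (@continuous_sin R _)).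
apply: cvgM.
  apply: (continuous_cvg _ (@continuous_expR R _)).
  by apply: cvgB; apply: cvgM => //; exact: cvg_cst.
apply: cvgD; apply: cvgM.
- by apply: cvgB; [apply: cvgM => //; exact: cvg_cst|exact: cvg_cst].
- by apply: cvgD; apply: cvgM => //; exact: cvg_cst.
- by apply: cvgM => //; exact: cvg_cst.
- by apply: cvgB; apply: cvgM => //; exact: cvg_cst.
Qed.

Lemma normr_osc_le x : `|osc x| <= expR (s * ln x - c * x) * (`|A| + `|B|).
Proof. by rewrite /osc normrM ger0_norm ?expR_ge0// ler_wpM2l ?expR_ge0// ler_trig. Qed.

Lemma cvg_osc_y a : 0 <= a -> 0 < c -> (fun n : nat => osc (a + n.+2%:R)) @ \oo --> 0.
Proof.
move=> a0 c0; have c20 : 0 < c / 2 by lra.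
(* Half of the decay [e^(- c x)] absorbs the power [x^s]; the other half tends to 0. *)
pose K := expR (`|s| * ln ((`|s| + 1) / (c / 2))) * (`|A| + `|B|).
apply/norm_cvg0P; apply: (@squeeze_cvgr _ _ _ _ (fun=> 0) (fun n : nat => K * expR (- (c / 2 * n.+2%:R)))).
- near=> n; rewrite normr_ge0/=; apply: (le_trans (normr_osc_le _)).
  rewrite /K mulrAC ler_wpM2r ?addr_ge0// -expRD ler_expR.
  set x := a + _.
  have n1 : 1 <= n.+2%:R :> R by rewrite ler1n.
  have x1 : 1 <= x by rewrite /x; lra.
  have x0 : 0 < x by lra.
  have l0 : 0 <= ln x by rewrite ln_ge0.
  have := mul_ln_le (normr_ge0 s) c20 x0.
  have : s * ln x <= `|s| * ln x by rewrite ler_wpM2r// ler_norm.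
  have : c / 2 * n.+2%:R <= c / 2 * x by rewrite ler_wpM2l ?(ltW c20)// /x; lra.
  lra.
- exact: cvg_cst.
- rewrite -[X in _ --> X](mulr0 K); apply: cvgM; first exact: cvg_cst.
  by apply: cvg_expN0; exact: cvg_mulS2.
Unshelve. all: by end_near. Qed.

Lemma cvg_osc_0 : 0 < s -> 0 <= c -> (fun n : nat => osc (0 + n.+2%:R^-1)) @ \oo --> 0.
Proof.
move=> s0 c0; pose K := `|A| + `|B|.
apply/norm_cvg0P; apply: (@squeeze_cvgr _ _ _ _ (fun=> 0) (fun n : nat => K * expR (- (s * ln n.+2%:R)))).
- near=> n; rewrite normr_ge0/= add0r; apply: (le_trans (normr_osc_le _)).
  rewrite -/K mulrC ler_wpM2l ?addr_ge0// ler_expR lnV ?posrE// mulrN lerBlDr lerDl.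
  by rewrite mulr_ge0// invr_ge0.
- exact: cvg_cst.
- rewrite -[X in _ --> X](mulr0 K); apply: cvgM; first exact: cvg_cst.
  by apply: cvg_expN0; exact: cvg_mul_lnS2.
Unshelve. all: by end_near. Qed.

End oscillating_exponential.

(** * The functional equation of Gamma, and a uniform oscillatory integral *)

Section gamma_recursion.
Context {R : realType}.
Implicit Types (s : R[i]).

Lemma cGamma_integrable s : 0 < re s ->
  cintegrable (fun t => cpow t (s - 1) * (expR (- t))%:C).
Proof.
move=> s0; have : -1 < re (s - 1) by rewrite ReD ReN /=; lra.
move/cintegrable_gamma => /(_ 1 ltr01); apply: eq_cintegrable => t _.
by rewrite mul1r.
Qed.

(** The derivative of [t^s e^(- t)] is [s t^(s - 1) e^(- t) - t^s e^(- t)]. Its integral vanishes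
    because [t^s e^(- t)] tends to 0 at both ends. *)
Lemma cGammaS s : 0 < re s -> cGamma (s + 1) = s * cGamma s.
Proof.
move=> s0.
have i0 := cGamma_integrable s0.
have s1 : 0 < re (s + 1) by rewrite ReD /=; lra.
have i1 := cGamma_integrable s1.
pose g t := s * (cpow t (s - 1) * (expR (- t))%:C) - cpow t (s + 1 - 1) * (expR (- t))%:C.
have ig : cintegrable g by apply: cintegrableB => //; exact: cintegrableZ.
have gE : cint g = s * cGamma s - cGamma (s + 1).
  by rewrite /g cintB//; [rewrite cintZ|exact: cintegrableZ].
have cE t : 0 < t -> g t = (expR (re s * ln t - 1 * t))%:C *
    ((s / t%:C - 1) * (cos (im s * ln t) +i* sin (im s * ln t))).
  move=> t0; rewrite /g addrK cpowD cpowN cpow1//.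
  rewrite /cpow /cexp ReMC ImMC mul1r expRD rmorphM.
  by ring.
have t0C t : 0 < t -> t%:C^-1 = (t^-1)%:C :> R[i] by move=> _; rewrite fmorphV.
have reE t : 0 < t -> re (g t) = dosc (re s) 1 (im s) 1 0 t.
  move=> t0; rewrite cE// t0C// /dosc !(ReCM, ReM, ReD, ReN, ImM, ImD, ImN) /=; ring.
have imE t : 0 < t -> im (g t) = dosc (re s) 1 (im s) 0 1 t.
  move=> t0; rewrite cE// t0C// /dosc !(ImCM, ReM, ReD, ReN, ImM, ImD, ImN) /=; ring.
have key A B h : rintegrable h -> (forall t, 0 < t -> h t = dosc (re s) 1 (im s) A B t) -> rint h = 0.
  move=> ih hE.
  have E t : 0 < t -> h t = if t <= 0 then 0 else dosc (re s) 1 (im s) A B t.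
    by move=> t0; rewrite leNgt t0 hE.
  rewrite (eq_rint E) -[RHS](subrr 0).
  apply: (@rint_FTC R (osc (re s) 1 (im s) A B) (dosc (re s) 1 (im s) A B) 0 0 0) => //.
  - by move=> x; exact: is_derive_osc.
  - by move=> x; exact: continuous_dosc.
  - exact: eq_rintegrable E ih.
  - exact: cvg_osc_0.
  - exact: cvg_osc_y.
have : cint g = 0.
  case: ig => a b; apply: complex_ext; rewrite /cint /=.
    exact: key a reE.
  exact: key b imE.
by rewrite gE => /eqP; rewrite subr_eq0 => /eqP.
Qed.

(* Integration by parts against the primitive of cos(w ln r)/r: this is where
   the oscillation w <> 0 replaces absolute convergence. *)
Lemma oscillation_bound (w A B : R) : w != 0 -> exists C : R, forall X : R, 0 < X ->
  let g r := if r <= 1 then 0 else expR (- (X * r)) / r * (A * cos (w * ln r) + B * sin (w * ln r)) in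
  rintegrable g /\ `|rint g| <= C.
Proof.
(* With these coefficients [A' cos(w ln r) + B' sin(w ln r)] has derivative
   [(A cos(w ln r) + B sin(w ln r)) / r]. *)
move=> w0; pose A' := - B / w; pose B' := A / w.
have e1 : -1 < 0 :> R by lra.
have iE X : 0 < X -> rintegrable (fun r : R => expR (- (X * r))).
  move=> X0; apply: eq_rintegrable (rintegrable_gamma e1 X0) => r _.
  by rewrite mul0r expR0 mul1r.
exists ((`|A'| + `|B'|) * (1 + rint (fun r => expR (- (1 * r))))) => X X0 g.
have ig : rintegrable g.
  apply: (rintegrable_le _ (rintegrableZ (`|A| + `|B|) (iE X X0))).
    by apply: rmeas_ltif; rmeas_tac.
  move=> r r0; rewrite /g; case: (leP r 1) => r1.
    by rewrite normr0 mulr_ge0 ?addr_ge0 ?expR_ge0.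
  rewrite normrM mulrC ler_pM//; first exact: ler_trig.
  rewrite ger0_norm ?divr_ge0 ?expR_ge0 ?(ltW r0)//.
  by rewrite ler_piMr ?expR_ge0// invf_le1// ltW.
split => //.
pose h r := if r <= 1 then 0 else X * expR (- (X * r)) * (A' * cos (w * ln r) + B' * sin (w * ln r)).
have ih0 : rintegrable (fun r => (`|A'| + `|B'|) * (X * expR (- (X * r)))).
  by do 2 apply: rintegrableZ; exact: iE.
have hb r : 0 < r -> `|h r| <= (`|A'| + `|B'|) * (X * expR (- (X * r))).
  move=> r0; rewrite /h; case: ifP => _.
    by rewrite normr0 !mulr_ge0 ?addr_ge0 ?expR_ge0// ltW.
  rewrite normrM [leRHS]mulrC ger0_norm ?mulr_ge0 ?expR_ge0 ?(ltW X0)//.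
  by rewrite ler_wpM2l ?mulr_ge0 ?expR_ge0 ?(ltW X0)// ler_trig.
have ih : rintegrable h.
  by apply: (rintegrable_le _ ih0) => //; apply: rmeas_ltif; rmeas_tac.
pose q r := if r <= 1 then 0 else dosc 0 X w A' B' r.
have qE r : 0 < r -> g r - h r = q r.
  move=> r0; rewrite /g /h /q; case: ifP => _; first by rewrite subrr.
  rewrite /dosc mul0r sub0r /A' /B'; field; by rewrite ?w0 ?(gt_eqF r0).
have iq : rintegrable q by apply: eq_rintegrable qE _; exact: rintegrableB.
have rq : rint q = - osc 0 X w A' B' 1.
  rewrite -[RHS]sub0r.
  apply: (@rint_FTC R (osc 0 X w A' B') (dosc 0 X w A' B') 1 (osc 0 X w A' B' 1) 0) => //.
  - by move=> x x1; apply: is_derive_osc; lra.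
  - by move=> x x1; apply: continuous_dosc; lra.
  - have c1 : {for 1, continuous (osc 0 X w A' B')}.
      have [d _] := @is_derive_osc R 0 X w A' B' 1 ltr01.
      by apply: differentiable_continuous; apply/derivable1_diffP.
    have cv : (fun n : nat => 1 + n.+2%:R^-1 : R) @ \oo --> (1 : R).
      have h1 : (fun n : nat => n.+2%:R^-1 : R) @ \oo --> (0 : R).
        by apply/gtr0_cvgV0; [near=> n|exact: cvg_natS2].
      have : (fun n : nat => 1 + n.+2%:R^-1 : R) @ \oo --> (1 + 0 : R).
        by apply: cvgD => //; exact: cvg_cst.
      by rewrite addr0.
    exact: (cvg_comp _ _ cv c1).
  - exact: cvg_osc_y.
have o1 : `|osc 0 X w A' B' 1| <= `|A'| + `|B'|.
  apply: (le_trans (normr_osc_le _ _ _ _ _ _)).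
  by rewrite ler_piMl ?addr_ge0// ln1 mulr0 mulr1 sub0r -expR0 ler_expR lerNl oppr0 ltW.
have -> : rint g = rint q + rint h.
  rewrite -rintD//; apply: eq_rint => r r0; rewrite -qE//; ring.
have := ler_normD (rint q) (rint h).
have := abs_rint_le ih ih0 hb.
rewrite rintZ; last by apply: rintegrableZ; exact: iE.
(* The scaling [r -> X r] removes [X], which makes the constant uniform as [X] tends to 0. *)
have -> : rint (fun r => X * expR (- (X * r))) = rint (fun r => expR (- (1 * r))).
  rewrite (rint_scale X0 (iE 1 ltr01)).2; apply: eq_rint => r _.
  by rewrite mul1r mulrC.
have : `|rint q| <= `|A'| + `|B'| by rewrite rq normrN.
lra.
Unshelve. all: by end_near. Qed.

End gamma_recursion.

(** * Laplace's method with an oscillating factor *)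

Section laplace_method.
Context {R : realType}.
Implicit Types (x y r : R).

Lemma rintegrable_itv (a b : R) : 0 <= a -> a < b ->
  rintegrable (fun r : R => if r <= a then 0 else if r <= b then 1 else 0 : R) /\
  rint (fun r : R => if r <= a then 0 else if r <= b then 1 else 0 : R) = b - a.
Proof.
move=> a0 ab.
have m : rmeas (fun r : R => if r <= a then 0 else if r <= b then 1 else 0 : R).
  by do 2 (apply: rmeas_ltif; rmeas_tac).
have E : (\int[lebesgue_measure]_(x in (`]0%R, +oo[%classic : set (measurableTypeR R)))
    (if (x <= a)%R then 0 else if (x <= b)%R then 1 else 0)%:E = (b - a)%:E)%E.
  transitivity (\int[lebesgue_measure]_(x in (`]0%R, +oo[%classic : set (measurableTypeR R))) (\1_(`]a, b]%classic : set R) x)%:E)%E.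
    apply: eq_integral => x /memD x0.
    rewrite indicE; case: (leP x a) => xa.
      by rewrite memNset//= in_itv/= ltNge xa.
    case: (leP x b) => xb.
      by rewrite mem_set//= in_itv/= xa xb.
    by rewrite memNset//= in_itv/= xa leNgt xb.
  rewrite integral_indic//.
  rewrite (_ : _ `&` _ = (`]a, b]%classic : set R)).
    transitivity (lebesgue_measure (`]a, b]%classic : set R)); first by [].
    by rewrite lebesgue_measure_itv/= lte_fin ab -EFinB.
  apply/seteqP; split => [x []//|x] /= h; split => //.
  by move: h; rewrite !in_itv/= andbT => /andP[h _]; exact: le_lt_trans h.
split; last by rewrite /rint /Rintegral E.
apply: ge0_rintegrable => //; last by rewrite E ltry.
by move=> x _; case: ifP => // _; case: ifP.
Qed.

(* Laplace's method around r = 1: the weight exp(- rho * y r) concentrates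
   there, where the oscillating factor cos(t * ln r) is close to 1. *)
Lemma laplace_cos (v y : R -> R) (t c0 : R) : rmeas v -> rmeas y ->
  (forall r, 0 < r -> 0 <= v r) -> 0 < c0 -> (forall r, 1 <= r <= 2 -> c0 <= v r) ->
  (forall r, 0 < r -> 0 <= y r) ->
  (forall r, 0 < r -> (r - 1) ^+ 2 <= 2 * (r + 1) * y r) ->
  (forall r, 1 <= r <= 2 -> y r <= (r - 1) ^+ 2) ->
  rintegrable (fun r => v r * expR (- y r)) ->
  exists N : R, 1 <= N /\ forall rho, N <= rho ->
    let A := rint (fun r => v r * expR (- (rho * y r))) in
    [/\ rintegrable (fun r => v r * expR (- (rho * y r))), 0 < A &
     A <= 4 * rint (fun r => cos (t * ln r) * (v r * expR (- (rho * y r))))].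
Proof.
move=> mv my v0 c00 vc y0 ylow yup ivy.
have cc : {for 1, continuous (fun r : R => cos (t * ln r))}.
  apply: (continuous_cvg _ (@continuous_cos R _)).
  by apply: cvgM; [exact: cvg_cst|exact: continuous_ln].
have [d d0 hd] : exists2 d : R, 0 < d & forall r, `|r - 1| < d -> 1 / 2 <= cos (t * ln r).
  move: cc; rewrite /prop_for /continuous_at ln1 mulr0 cos0 => /cvgrPdist_lt /(_ (1 / 2)).
  have h2 : 0 < 1 / 2 :> R by lra.
  move=> /(_ h2) [d /= d0 hd]; exists d => // r rd.
  have := hd r; rewrite /= distrC => /(_ rd); rewrite ltr_norml => /andP[_]; lra.
(* If [e = |r - 1|] were at least [d], then [ylow] and [y r <= eta] would give
   [e^2 <= 2 (2 + e) eta]. But [e^2 / (2 + e)] increases in [e] and is [4 eta] at [e = d]. *)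
pose eta := d ^+ 2 / (4 * (2 + d)).
have eta0 : 0 < eta by rewrite divr_gt0 ?exprn_gt0//; lra.
have near1 r : 0 < r -> y r <= eta -> 1 / 2 <= cos (t * ln r).
  move=> r0 yr; apply: hd; rewrite ltNge; apply/negP => dr.
  have h1 := ylow r r0.
  set e := `|r - 1| in dr *.
  have e2 : (r - 1) ^+ 2 = e ^+ 2 by rewrite /e real_normK ?num_real.
  have re : r <= 1 + e by rewrite /e; have := ler_norm (r - 1); lra.
  have h2 : 2 * (r + 1) * y r <= 2 * (2 + e) * eta.
    apply: ler_pM => //; [lra|exact: y0|lra].
  have h3 : e ^+ 2 <= 2 * (2 + e) * eta by rewrite -e2 (le_trans h1).
  have h4 : eta * (4 * (2 + d)) = d ^+ 2 by rewrite /eta divfK// gt_eqF//; lra.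
  have : e ^+ 2 * (2 * (2 + d)) <= (2 + e) * d ^+ 2.
    rewrite -h4 (_ : (2 + e) * _ = 2 * (2 + e) * eta * (2 * (2 + d))); last by ring.
    by rewrite ler_wpM2r//; lra.
  have a1 : d ^+ 2 <= e ^+ 2 by rewrite ler_sqr ?nnegrE; lra.
  have a2 : 0 <= e * d * (e - d) by rewrite !mulr_ge0//; lra.
  have a3 : 0 < e ^+ 2 by rewrite exprn_gt0//; lra.
  have a4 : 0 <= d * e ^+ 2 by rewrite mulr_ge0 ?sqr_ge0//; lra.
  lra.
pose A0 := rint (fun r => v r * expR (- y r)).
have A00 : 0 <= A0.
  by apply: rint_ge0 => r r0; rewrite mulr_ge0 ?expR_ge0 ?v0.
(* On [[1, 1 + b]] one has [y <= b^2 <= eta / 2], so this interval carries mass at least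
   [c0 b e^(- rho eta / 2)]. The region [y > eta] carries at most [e^(eta - rho eta) A0], which is
   smaller for large [rho]. *)
pose b := Num.min 1 (eta / 2).
have b0 : 0 < b by rewrite lt_min ltr01/= divr_gt0.
have b1 : b <= 1 by rewrite ge_min lexx.
have be : b <= eta / 2 by rewrite ge_min lexx orbT.
pose P := c0 * b.
have P0 : 0 < P by rewrite mulr_gt0.
(* Exactly what makes six times the far mass at most [A]; with [lower] this leaves [A / 2 - A / 4],
   whence the factor 4. *)
pose N := Num.max 1 ((2 / eta) * (1 + eta + ln (6 * (A0 + 1) / P))).
exists N; split; first by rewrite le_max lexx.
move=> rho Nr A.
have r1 : 1 <= rho by apply: le_trans Nr; rewrite le_max lexx.
have r2 : 1 + eta + ln (6 * (A0 + 1) / P) <= rho * eta / 2.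
  have : 2 / eta * (1 + eta + ln (6 * (A0 + 1) / P)) <= rho by apply: le_trans Nr; rewrite le_max lexx orbT.
  by rewrite mulrAC ler_pdivrMr//; lra.
have iA : rintegrable (fun r => v r * expR (- (rho * y r))).
  apply: (rintegrable_le _ ivy); first by rmeas_tac.
  move=> r r0; rewrite ger0_norm ?mulr_ge0 ?expR_ge0 ?v0//.
  rewrite ler_wpM2l ?v0// ler_expR lerN2; have := y0 r r0; nra.
have ic : rintegrable (fun r => cos (t * ln r) * (v r * expR (- (rho * y r)))).
  apply: (rintegrable_le _ iA); first by rmeas_tac.
  move=> r r0; rewrite normrM (ger0_norm (x := v r * _)) ?mulr_ge0 ?expR_ge0 ?v0//.
  by rewrite ler_piMl ?mulr_ge0 ?expR_ge0 ?v0// ler_norml cos_geN1 cos_le1.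
pose q := expR (- (rho * eta / 2)).
have q0 : 0 < q by exact: expR_gt0.
have AP : q * P <= A.
  have ab : (1 : R) < 1 + b by lra.
  have [i1 e1] := rintegrable_itv ler01 ab.
  have -> : q * P = rint (fun r : R => q * c0 * (if r <= 1 then 0 else if r <= 1 + b then 1 else 0)).
    by rewrite rintZ// e1 /P; ring.
  apply: le_rint => // [|r r0]; first exact: rintegrableZ.
  have p0 : 0 <= v r * expR (- (rho * y r)) by rewrite mulr_ge0 ?expR_ge0 ?v0.
  case: (leP r 1) => h1; first by rewrite mulr0.
  case: (leP r (1 + b)) => h2; last by rewrite mulr0.
  rewrite mulr1 mulrC ler_pM// ?(ltW c00) ?(ltW q0)//.
    by apply: vc; lra.
  rewrite ler_expR lerN2.
  have h3 : y r <= eta / 2.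
    have h4 : y r <= (r - 1) ^+ 2 by apply: yup; lra.
    nra.
  nra.
have A_gt0 : 0 < A by apply: lt_le_trans AP; rewrite mulr_gt0.
split => //.
pose eps := expR (eta - rho * eta).
(* Where [y <= eta] the cosine is at least 1/2. Elsewhere it is at least [-1], and the loss of 3/2
   is paid by the far weight, which is at most [eps] times the one at [rho = 1]. *)
have lower : A / 2 - 3 / 2 * (eps * A0) <= rint (fun r => cos (t * ln r) * (v r * expR (- (rho * y r)))).
  have -> : A / 2 - 3 / 2 * (eps * A0) = rint (fun r => 1 / 2 * (v r * expR (- (rho * y r))) - 3 / 2 * eps * (v r * expR (- y r))).
    rewrite rintB; [|exact: rintegrableZ|exact: rintegrableZ].
    by rewrite !rintZ// -/A -/A0; ring.
  apply: le_rint => // [|r r0].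
    by apply: rintegrableB; exact: rintegrableZ.
  have p0 : 0 <= v r * expR (- (rho * y r)) by rewrite mulr_ge0 ?expR_ge0 ?v0.
  have p1 : 0 <= v r * expR (- y r) by rewrite mulr_ge0 ?expR_ge0 ?v0.
  have ep : 0 <= eps by exact: expR_ge0.
  case: (leP (y r) eta) => hy.
    have := near1 r r0 hy; nra.
  have h1 : v r * expR (- (rho * y r)) <= eps * (v r * expR (- y r)).
    rewrite mulrCA ler_wpM2l ?v0// -expRD ler_expR; nra.
  have : -1 <= cos (t * ln r) by exact: cos_geN1.
  nra.
have small : 6 * (eps * A0) <= A.
  have e1 : 6 * (A0 + 1) / P = expR (ln (6 * (A0 + 1) / P)).
    by rewrite lnK// posrE divr_gt0//; lra.
  have h1 : eps * (6 * (A0 + 1) / P) <= q.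
    rewrite e1 -expRD ler_expR; lra.
  have h2 : eps * (6 * (A0 + 1)) <= q * P.
    by move: h1; rewrite mulrA ler_pdivrMr.
  have ep : 0 <= eps by exact: expR_ge0.
  nra.
lra.
Qed.

End laplace_method.

(** * Nonvanishing and growth of Gamma in the right half-plane *)

Section gamma_nonvanishing.
Context {R : realType}.
Implicit Types (s nu : R[i]).

Lemma real_complex_neq0 (r : R) : r != 0 -> r%:C != 0 :> R[i].
Proof. by move=> h; rewrite eq_complex /= negb_and h. Qed.

(** Every real power is allowed: [e^(- b / q)] beats it at 0 and [e^(- c q)] at infinity, by
    [mul_ln_le] applied to [1 / q] and to [q]. *)
Lemma rintegrable_macdonald (s b c : R) : 0 < b -> 0 < c ->
  rintegrable (fun q => pw q s * expR (- (b / q) - c * q)).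
Proof.
move=> b0 c0; have z1 : -1 < 0 :> R by lra. have h2 : -2 < -1 :> R by lra.
pose K1 := `|s| * ln ((`|s| + 1) / b).
pose K2 := `|s + 2| * ln ((`|s + 2| + 1) / c).
apply: (rintegrable_le _ (rintegrableZ (expR K1 + expR K2) (rintegrable_pw z1 h2))) => [|q q0].
  by rmeas_tac.
rewrite ger0_norm ?mulr_ge0 ?expR_ge0// -expRD.
have iq0 : 0 < q^-1 by rewrite invr_gt0.
have bq : 0 <= b / q by rewrite mulr_ge0 ?ltW.
have cq : 0 <= c * q by rewrite mulr_ge0 ?ltW.
have e1 : 0 < expR K1 by exact: expR_gt0.
have e2 : 0 < expR K2 by exact: expR_gt0.
case: (leP q 1) => q1.
  rewrite mul0r expR0 mulr1.
  apply: (@le_trans _ _ (expR K1)); last lra.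
  rewrite ler_expR.
  have h := mul_ln_le (normr_ge0 s) b0 iq0.
  have l0 : 0 <= ln q^-1 by rewrite ln_ge0// invf_ge1.
  have : s * ln q <= `|s| * ln q^-1.
    rewrite lnV ?posrE// mulrN -mulNr -normrN.
    have : ln q <= 0 by rewrite ln_le0.
    have := ler_norm (- s); move: (ln q) `| - s| => l m; nra.
  rewrite -/K1 in h; lra.
rewrite mulrC; apply: (@le_trans _ _ (expR (-2 * ln q) * expR K2)); last first.
  by rewrite mulrC ler_wpM2r ?expR_ge0//; lra.
rewrite -expRD ler_expR.
have l0 : 0 <= ln q by rewrite ln_ge0// ltW.
have h := mul_ln_le (normr_ge0 (s + 2)) c0 q0.
have : (s + 2) * ln q <= `|s + 2| * ln q by rewrite ler_wpM2r// ler_norm.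
rewrite -/K2 in h; lra.
Qed.

(** With [q = sqrt r], [ln r <= 2 (q - 1)] gives [(q - 1)^2 <= r - 1 - ln r]; multiply by
    [(q + 1)^2 <= 2 (r + 1)]. *)
Lemma sqr_sub1_le (r : R) : 0 < r -> (r - 1) ^+ 2 <= 2 * (r + 1) * (r - 1 - ln r).
Proof.
move=> r0; pose q := Num.sqrt r.
have q0 : 0 < q by rewrite sqrtr_gt0.
have rq : r = q ^+ 2 by rewrite sqr_sqrtr// ltW.
have hl : ln r <= 2 * (q - 1).
  by rewrite rq lnXn// mulr2n; have := ln_le_sub1 q0; lra.
have h1 : (q - 1) ^+ 2 <= r - 1 - ln r by rewrite sqrrB1 rq in hl *; lra.
have e : (r - 1) ^+ 2 = (q + 1) ^+ 2 * (q - 1) ^+ 2 by rewrite rq; ring.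
have h2 : (q + 1) ^+ 2 <= 2 * (r + 1).
  by rewrite rq; have := sqr_ge0 (q - 1); rewrite !expr2; lra.
by rewrite e ler_pM ?sqr_ge0.
Qed.

(** From [- ln r <= 1 / r - 1] the left side is at most [(r - 1)^2 / r]. *)
Lemma sub1_ln_le (r : R) : 1 <= r -> r - 1 - ln r <= (r - 1) ^+ 2.
Proof.
move=> r1; have r0 : 0 < r by lra.
have iv : 0 < r^-1 by rewrite invr_gt0.
have := ln_le_sub1 iv; rewrite lnV ?posrE// => h.
have i1 : r^-1 <= 1 by rewrite invf_le1.
have e : r * r^-1 = 1 by rewrite mulfV// gt_eqF.
have : (r - 1) * (r - 1) * (1 - r^-1) >= 0 by rewrite !mulr_ge0//; lra.
have -> : (r - 1) * (r - 1) * (1 - r^-1) = (r - 1) ^+ 2 - r + 2 - r^-1.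
  by rewrite mulrBr mulr1 (_ : _ * r^-1 = r * (r * r^-1) - 2 * (r * r^-1) + r^-1); [rewrite e|]; ring.
lra.
Qed.

(** Scaling by [rho = Re s + n - 1] in Euler's integral produces the weight
    [e^(- rho (r - 1 - ln r))] and the phase [Im s ln r]. For large [n] Laplace's method makes the
    real part of the scaled integral positive. *)
Lemma cGamma_shift_neq0 s : 0 < re s -> exists n : nat, cGamma (s + n%:R) != 0.
Proof.
move=> s0.
have [|||||||||N [N1 hN]] := @laplace_cos R (fun=> 1) (fun r => r - 1 - ln r) (im s) 1.
- by rmeas_tac.
- by rmeas_tac.
- by [].
- exact: ltr01.
- by [].
- by move=> r r0; have := ln_le_sub1 r0; lra.
- exact: sqr_sub1_le.
- by move=> r /andP[r1 _]; exact: sub1_ln_le.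
- have e1 : -1 < 1 :> R by lra.
  have := rintegrableZ (expR 1) (rintegrable_gamma e1 ltr01).
  apply: eq_rintegrable => r r0; rewrite /= !mul1r -!expRD; congr expR; lra.
have [n hn] : exists n : nat, N <= re s + n%:R - 1.
  have p : 0 <= N + 1 by lra.
  by exists (Num.bound (N + 1)); have := archi_boundP p; lra.
exists n; set rho := re s + n%:R - 1 in hn.
have rho0 : 0 < rho by lra.
have [iA A0 A4] := hN rho hn.
set s' := s + n%:R.
have rs : re s' = rho + 1 by rewrite /s' ReD natC /= /rho; ring.
have is' : im s' = im s by rewrite /s' ImD natC /= addr0.
have rs' : re (s' - 1) = rho by rewrite ReD ReN rs /=; ring.
have is1 : im (s' - 1) = im s by rewrite ImD ImN is' /=; ring.
have s'0 : 0 < re s' by rewrite rs; lra.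
have iG := cGamma_integrable s'0.
apply/eqP => h.
have [i1 e1] := cint_scale rho0 iG.
have E r : 0 < r -> cpow (rho * r) (s' - 1) * (expR (- (rho * r)))%:C * rho%:C =
   (cpow rho (s' - 1) * rho%:C) * (cpow r (s' - 1) * (expR (- (rho * r)))%:C).
  by move=> r0; rewrite cpowM//; ring.
have i2 : cintegrable (fun r => cpow r (s' - 1) * (expR (- (rho * r)))%:C).
  by apply: cintegrable_gamma => //; rewrite rs'; lra.
have : cGamma s' = cpow rho (s' - 1) * rho%:C * cint (fun r => cpow r (s' - 1) * (expR (- (rho * r)))%:C).
  by rewrite /cGamma e1 -cintZ//; apply: eq_cint => r r0; rewrite E.
rewrite h => /esym/eqP; rewrite mulf_eq0 (negbTE (mulf_neq0 (cpow_neq0 _ _) _)) /=; last first.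
  by apply: real_complex_neq0; rewrite gt_eqF.
move=> /eqP z0.
have h0 : rint (fun r => re (cpow r (s' - 1) * (expR (- (rho * r)))%:C)) = 0.
  by rewrite -[RHS]/(re 0) -z0.
have : rint (fun r => expR (- rho) * (cos (im s * ln r) * (1 * expR (- (rho * (r - 1 - ln r)))))) = 0.
  rewrite -[RHS]h0; apply: eq_rint => r r0.
  have h1 : expR (- rho) * expR (- (rho * (r - 1 - ln r))) = expR (rho * ln r) * expR (- (rho * r)).
    by rewrite -!expRD; congr expR; ring.
  by rewrite ReMC re_cpow rs' is1 mul1r mulrCA h1; ring.
rewrite rintZ; last first.
  apply: (rintegrable_le _ iA); first by rmeas_tac.
  move=> r r0; rewrite normrM (ger0_norm (x := 1 * _)) ?mulr_ge0 ?expR_ge0//.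
  by rewrite ler_piMl ?mulr_ge0 ?expR_ge0// ler_norml cos_geN1 cos_le1.
move/eqP; rewrite mulf_eq0 gt_eqF ?expR_gt0//= => /eqP e0.
by move: A4; rewrite e0 mulr0 leNgt A0.
Qed.

(** By [cGammaS] a zero at [s + n] would propagate to [s + n + 1], so nonvanishing descends from the
    shift found above. *)
Lemma cGamma_neq0 s : 0 < re s -> cGamma s != 0.
Proof.
move=> s0; have [n] := cGamma_shift_neq0 s0.
elim: n => [|n ih]; first by rewrite addr0.
move=> h; apply: ih; apply: contra h => /eqP h.
rewrite -addn1 natrD addrA cGammaS ?h ?mulr0//.
by rewrite ReD natC /=; have : 0 <= n%:R :> R by []; lra.
Qed.

(** Each step of the recursion gains a factor of modulus at least [Re nu + n + 1 >= k (n + 1)] with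
    [k = min(1, Re nu + 1)]. This controls the denominators of the Bessel series. *)
Lemma cGamma_lower nu : -1 < re nu -> exists c k : R, [/\ 0 < c, 0 < k, k <= 1 &
  forall n : nat, c * k ^+ n * n`!%:R <= normc (cGamma (nu + n%:R + 1))].
Proof.
move=> hnu.
have n1 : 0 < re (nu + 1) by rewrite ReD /=; lra.
pose k := Num.min 1 (re nu + 1).
have k0 : 0 < k by rewrite lt_min ltr01/=; lra.
have k1 : k <= 1 by rewrite ge_min lexx.
have k2 : k <= re nu + 1 by rewrite ge_min lexx orbT.
exists (normc (cGamma (nu + 1))), k; split => //.
  by apply: normc_gt0; exact: cGamma_neq0.
elim => [|n ih]; first by rewrite expr0 fact0 !mulr1 addr0.
have nn : 0 <= n%:R :> R by [].
have e : nu + n.+1%:R + 1 = (nu + n%:R + 1) + 1 by rewrite -addn1 natrD; ring.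
have r0 : k * n.+1%:R <= re (nu + n%:R + 1).
  by rewrite !ReD natC /= -addn1 natrD; nra.
have gS : cGamma (nu + n%:R + 1 + 1) = (nu + n%:R + 1) * cGamma (nu + n%:R + 1).
  by apply: cGammaS; apply: (lt_le_trans _ r0); rewrite mulr_gt0.
rewrite e gS.
rewrite normcM factS natrM exprS.
rewrite (_ : _ * _ = (k * n.+1%:R) * (normc (cGamma (nu + 1)) * k ^+ n * n`!%:R)); last by ring.
apply: ler_pM => //.
- by rewrite mulr_ge0// ltW.
- by rewrite !mulr_ge0 ?normc_ge0// exprn_ge0// ltW.
- by apply: (le_trans r0); apply: (le_trans (ler_norm _)); exact: normc_re.
Qed.

End gamma_nonvanishing.

(** * Termwise Laplace transform of the Bessel series *)

Section bessel_laplace.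
Context {R : realType}.
Implicit Types (x y u p : R) (nu s w : R[i]).

Lemma re_sum (F : nat -> R[i]) n : re (\sum_(0 <= k < n) F k) = \sum_(0 <= k < n) re (F k).
Proof. exact: (big_morph (fun w : R[i] => re w) ReD (erefl _)). Qed.
Lemma im_sum (F : nat -> R[i]) n : im (\sum_(0 <= k < n) F k) = \sum_(0 <= k < n) im (F k).
Proof. exact: (big_morph (fun w : R[i] => im w) ImD (erefl _)). Qed.
Lemma normc_sum_le (F : nat -> R[i]) n :
  normc (\sum_(0 <= k < n) F k) <= \sum_(0 <= k < n) normc (F k).
Proof.
elim: n => [|n ih]; first by rewrite !big_nil normc0.
by rewrite !big_nat_recr//= (le_trans (le_normcD _ _))// lerD2r.
Qed.

Lemma eq_ccvg (F G : nat -> R[i]) w : (forall n, F n = G n) -> ccvg F w -> ccvg G w.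
Proof. by move=> /funext ->. Qed.

Lemma sum_sqr_le (a : nat -> R) n : (forall k, 0 <= a k) ->
  \sum_(0 <= k < n) a k ^+ 2 <= (\sum_(0 <= k < n) a k) ^+ 2.
Proof.
move=> a0; elim: n => [|n ih]; first by rewrite !big_nil expr0n.
rewrite !big_nat_recr//= sqrrD.
have : 0 <= \sum_(0 <= k < n) a k by apply: sumr_ge0 => k _.
have := a0 n; nra.
Qed.

Lemma sum_exp_coeff_le x n : 0 <= x -> \sum_(0 <= k < n) (x ^+ k / k`!%:R) <= expR x.
Proof.
move=> x0.
have h : {homo series (exp_coeff x) : m n / (m <= n)%N >-> m <= n}.
  by apply: nondecreasing_series => k _ _; rewrite /exp_coeff/= divr_ge0// exprn_ge0.
exact: (nondecreasing_cvgn_le h (is_cvg_series_exp_coeff x) n).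
Qed.

Lemma cvg_sum_exp x : (fun n => \sum_(0 <= k < n) (x ^+ k / k`!%:R)) @ \oo --> expR x.
Proof. exact: (is_cvg_series_exp_coeff x). Qed.

Lemma ccvg_cseries (F : nat -> R[i]) (M : R) :
  (forall n, \sum_(0 <= k < n) normc (F k) <= M) ->
  ccvg (fun n => \sum_(0 <= k < n) F k) (cseries F).
Proof.
move=> hM.
have key (f : nat -> R) : (forall k, `|f k| <= normc (F k)) -> cvgn (series f).
  move=> hf; apply: normed_cvg.
  apply: nondecreasing_is_cvgn.
    by apply: nondecreasing_series => k _ _ /=.
  exists M => _ [n _ <-]; apply: le_trans (hM n); rewrite /= /series /=.
  by apply: ler_sum => k _; exact: hf.
split.
  rewrite (_ : (fun n => _) = series (fun k => re (F k))); last by apply/funext => n; rewrite re_sum.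
  by apply: key => k; exact: normc_re.
rewrite (_ : (fun n => _) = series (fun k => im (F k))); last by apply/funext => n; rewrite im_sum.
by apply: key => k; exact: normc_im.
Qed.

Variables (nu : R[i]) (z : R).
Hypotheses (hz : 0 < z) (hnu : -1 < re nu).

Let T x (k : nat) : R[i] :=
  ((-1) ^+ k * (x / 2) ^+ (2 * k))%:C / (k`!%:R * cGamma (nu + k%:R + 1)).

Let hnuk (k : nat) : 0 < re (nu + k%:R + 1).
Proof. by rewrite !ReD natC /=; have : 0 <= k%:R :> R by []; move: hnu; lra. Qed.

(** By [cGamma_lower] the terms are at most a constant times the square of [(x / (2 k))^j / j!]. A
    sum of squares is at most the square of the sum, hence at most [e^(x / k)]. Exponential growth
    is good enough against the Gaussian weights to come. *)
Lemma bessel_terms_bound : exists c l : R, [/\ 0 < c, 0 < l &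
  forall x n, 0 < x -> \sum_(0 <= k < n) normc (T x k) <= c * expR (l * x)].
Proof.
have [c [k [c0 k0 k1 hc]]] := cGamma_lower hnu.
exists c^-1, k^-1; split; rewrite ?invr_gt0// => x n x0.
pose y := x / 2 / k.
have y0 : 0 <= y by rewrite !divr_ge0// ltW.
have hT j : normc (T x j) <= c^-1 * (y ^+ j / j`!%:R) ^+ 2.
  have f0 : 0 < j`!%:R :> R by rewrite ltr0n fact_gt0.
  have kj : 0 < k ^+ j by rewrite exprn_gt0.
  have kj1 : k ^+ j <= 1 by rewrite exprn_ile1// ltW.
  rewrite /T normcM normc_real normrM normrX normrN normr1 expr1n mul1r normcV normcM.
  rewrite natC normc_real ger0_norm ?exprn_ge0 ?divr_ge0 ?(ltW x0)// (ger0_norm (ltW f0)).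
  set G := normc _; have hG : c * k ^+ j * j`!%:R <= G by exact: hc.
  have G0 : 0 < c * k ^+ j * j`!%:R by rewrite !mulr_gt0.
  (* A further factor [k^j <= 1] is given away so that the bound on the term becomes a perfect
     square. *)
  have hG2 : c * (k ^+ j) ^+ 2 * j`!%:R <= G.
    apply: le_trans hG; rewrite ler_pM2r// ler_pM2l// expr2 ler_piMr// ltW//.
  have G1 : 0 < c * (k ^+ j) ^+ 2 * j`!%:R by rewrite !mulr_gt0 ?exprn_gt0.
  rewrite exprM -exprM mulnC exprM.
  rewrite (_ : c^-1 * _ = ((x / 2) ^+ j) ^+ 2 * (j`!%:R * (c * (k ^+ j) ^+ 2 * j`!%:R))^-1); last first.
    rewrite /y !expr_div_n; field; rewrite !gt_eqF//=.
  rewrite ler_wpM2l ?sqr_ge0// lef_pV2 ?posrE ?mulr_gt0//; last by rewrite (lt_le_trans G1).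
  by rewrite ler_pM2l.
apply: (@le_trans _ _ (c^-1 * \sum_(0 <= j < n) (y ^+ j / j`!%:R) ^+ 2)).
  by rewrite mulr_sumr; apply: ler_sum => j _.
rewrite ler_pM2l ?invr_gt0//.
apply: (le_trans (sum_sqr_le _ _)) => [j|]; first by rewrite divr_ge0 ?exprn_ge0.
have h := sum_exp_coeff_le n y0.
have h0 : 0 <= \sum_(0 <= j < n) (y ^+ j / j`!%:R).
  by apply: sumr_ge0 => j _; rewrite divr_ge0 ?exprn_ge0.
have -> : expR (k^-1 * x) = expR y ^+ 2.
  by rewrite expr2 -expRD; congr expR; rewrite /y; field; rewrite gt_eqF.
by rewrite ler_sqr ?nnegrE ?expR_ge0.
Qed.

Let pre u := cpow u (nu + 1) * cpow (u * z / 2) nu.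
Let S n u := pre u * \sum_(0 <= k < n) T (u * z) k.
(** This is the Hankel kernel [sqrt(u z) J_nu(u z)] times the weight [u^(nu + 1/2)], with the
    constant [sqrt z] removed. *)
Definition hankel_kernel u := cpow u (nu + 1) * bessel_J nu (u * z).
Local Notation j := hankel_kernel.

Let uz0 u : 0 < u -> 0 < u * z. Proof. by move=> u0; rewrite mulr_gt0. Qed.

Let ccvgS u : 0 < u -> ccvg (fun n => S n u) (j u).
Proof.
move=> u0; have [c [l [c0 l0 h]]] := bessel_terms_bound.
rewrite /S /j /bessel_J mulrA; apply: ccvgM; first exact: ccvg_cst.
by apply: (ccvg_cseries (M := c * expR (l * (u * z)))) => n; exact: (h _ _ (uz0 u0)).
Qed.

Let normc_pre u : 0 < u -> normc (pre u) = expR (re nu * ln (z / 2)) * pw u (2 * re nu + 1).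
Proof.
move=> u0; rewrite /pre normcM !normc_cpow ReD /= -!expRD; congr expR.
rewrite -mulrA lnM ?posrE ?divr_gt0//; ring.
Qed.

Let S_bound : exists C l : R, [/\ 0 < C, 0 < l & forall n u, 0 < u ->
  normc (S n u) <= C * (pw u (2 * re nu + 1) * expR (l * u))].
Proof.
have [c [l [c0 l0 h]]] := bessel_terms_bound.
exists (expR (re nu * ln (z / 2)) * c), (l * z).
split; rewrite ?mulr_gt0 ?expR_gt0// => n u u0.
rewrite /S normcM normc_pre//.
rewrite (_ : _ * c * _ = expR (re nu * ln (z / 2)) * pw u (2 * re nu + 1) * (c * expR (l * (u * z)))); last first.
  by rewrite (_ : l * z * u = l * (u * z)); ring.
rewrite ler_wpM2l ?mulr_ge0 ?expR_ge0//.
by apply: (le_trans (normc_sum_le _ _)); exact: h (uz0 u0).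
Qed.

Lemma hankel_kernel_bound : exists C l : R, [/\ 0 < C, 0 < l & forall u, 0 < u ->
  normc (j u) <= C * (pw u (2 * re nu + 1) * expR (l * u))].
Proof.
have [C [l [C0 l0 h]]] := S_bound; exists (2 * C), l; split => //; first by rewrite mulr_gt0.
move=> u u0; have [a b] := ccvgS u0.
have ha : `|re (j u)| <= C * (pw u (2 * re nu + 1) * expR (l * u)).
  apply: (ler_cvg_to (cvg_norm a) (cvg_cst _)); near=> n.
  by apply: le_trans (h n u u0); exact: normc_re.
have hb : `|im (j u)| <= C * (pw u (2 * re nu + 1) * expR (l * u)).
  apply: (ler_cvg_to (cvg_norm b) (cvg_cst _)); near=> n.
  by apply: le_trans (h n u u0); exact: normc_im.
apply: (le_trans (normc_le _)); lra.
Unshelve. all: by end_near. Qed.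

Let cmeasS n : cmeas (S n).
Proof.
apply: cmeasM.
  by apply: cmeasM; apply: cmeas_cpow; rmeas_tac.
elim: n => [|n ih].
  by apply: (@eq_cmeas _ (fun=> 0)) (cmeas_cst 0) => u _; rewrite big_nil.
apply: (@eq_cmeas _ (fun u => \sum_(0 <= k < n) T (u * z) k + T (u * z) n)) => [u _|].
  by rewrite big_nat_recr.
apply: cmeasD => //; apply: cmeasM; last exact: cmeas_cst.
by apply: cmeas_real; rmeas_tac.
Qed.

Lemma cmeas_hankel_kernel : cmeas j.
Proof. by apply: cmeas_lim cmeasS _ => u; exact: ccvgS. Qed.

(** Euler's integral after the substitution [t = p u^2]. *)
Lemma cint_gauss_power s p : 0 < re s -> 0 < p ->
  cintegrable (fun u => cpow u (2 * s - 1) * (expR (- (p * u ^+ 2)))%:C) /\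
  cint (fun u => cpow u (2 * s - 1) * (expR (- (p * u ^+ 2)))%:C) =
    cGamma s / 2 * cpow p (- s).
Proof.
move=> s0 p0; have two0 : (2 : R) != 0 by [].
have [i e] := cint_power (ln p) two0 (cGamma_integrable s0).
have E u : 0 < u -> cpow (expR (2 * ln u + ln p)) (s - 1) * (expR (- expR (2 * ln u + ln p)))%:C *
    (`|2| * expR (2 * ln u + ln p) / u)%:C =
    (2 * cpow p s) * (cpow u (2 * s - 1) * (expR (- (p * u ^+ 2)))%:C).
  move=> u0; have -> : expR (2 * ln u + ln p) = p * u ^+ 2.
    by rewrite expRD expRM_natl !lnK// mulrC.
  have pu : 0 < p * u ^+ 2 by rewrite mulr_gt0 ?exprn_gt0.
  have h1 : cpow (p * u ^+ 2) (s - 1) * (p * u ^+ 2)%:C = cpow p s * cpow u (2 * s).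
    rewrite -(cpow1 pu) -cpowD subrK cpowM ?exprn_gt0//; congr (_ * _).
    by rewrite /cpow lnXn// mulr2n rmorphD; congr cexp; ring.
  have h2 : cpow u (2 * s - 1) = cpow u (2 * s) / u%:C by rewrite cpowD cpowN cpow1.
  rewrite (ger0_norm (x := 2))// h2.
  rewrite (_ : (2 * (p * u ^+ 2) / u)%:C = 2 * (p * u ^+ 2)%:C * (u%:C)^-1); last first.
    by rewrite !rmorphM fmorphV rmorph_nat.
  transitivity (2 * (cpow (p * u ^+ 2) (s - 1) * (p * u ^+ 2)%:C) * (u%:C)^-1 * (expR (- (p * u ^+ 2)))%:C).
    by ring.
  by rewrite h1; ring.
have i2 : cintegrable (fun u => (2 * cpow p s) * (cpow u (2 * s - 1) * (expR (- (p * u ^+ 2)))%:C)).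
  exact: eq_cintegrable E i.
have nz : 2 * cpow p s != 0 by rewrite mulf_neq0 ?cpow_neq0// pnatr_eq0.
have i3 : cintegrable (fun u => cpow u (2 * s - 1) * (expR (- (p * u ^+ 2)))%:C).
  by apply: eq_cintegrable (cintegrableZ (2 * cpow p s)^-1 i2) => u _; rewrite mulKf.
split => //.
rewrite /cGamma e (eq_cint E) cintZ// cpowN.
by field; rewrite cpow_neq0 ?pnatr_eq0.
Qed.

(** The term of index [k] integrates to a multiple of [Gamma(nu + k + 1) p^(- nu - k - 1)]. Its
    Gamma factor cancels the one in the series of [J_nu], leaving the exponential series at
    [X = - z^2 / (4 p)]. [S_bound] times the Gaussian dominates all partial sums. *)
Lemma laplace_hankel_kernel p : 0 < p ->
  cintegrable (fun u => j u * (expR (- (p * u ^+ 2)))%:C) /\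
  cint (fun u => j u * (expR (- (p * u ^+ 2)))%:C) =
    cpow (z / 2) nu / 2 * cpow p (- (nu + 1)) * (expR (- (z ^+ 2 / 4 / p)))%:C.
Proof.
move=> p0.
have [C [l [C0 l0 h]]] := S_bound.
have r1 : -1 < 2 * re nu + 1 by move: hnu; lra.
have ig := rintegrableZ C (rintegrable_gauss r1 (ltW l0) p0).
have [|||i c] := @cint_cvg R (fun n u => S n u * (expR (- (p * u ^+ 2)))%:C)
    (fun u => j u * (expR (- (p * u ^+ 2)))%:C) _ _ ig.
- by move=> n; apply: cmeasM (cmeasS n) _; apply: cmeas_real; rmeas_tac.
- move=> n u u0; rewrite normcM_real ?expR_ge0// expRD !mulrA.
  by rewrite ler_wpM2r ?expR_ge0// -!mulrA h.
- move=> u u0; apply: ccvgM; [exact: ccvgS|exact: ccvg_cst].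
split => //; apply: ccvg_unique c _.
pose X := - (z ^+ 2 / 4 / p).
have z20 : 0 < z / 2 by rewrite divr_gt0.
have term k : cintegrable (fun u => pre u * T (u * z) k * (expR (- (p * u ^+ 2)))%:C) /\
  cint (fun u => pre u * T (u * z) k * (expR (- (p * u ^+ 2)))%:C) =
  cpow (z / 2) nu / 2 * cpow p (- (nu + 1)) * (X ^+ k / k`!%:R)%:C.
  have [i1 e1] := cint_gauss_power (hnuk k) p0.
  have gk : cGamma (nu + k%:R + 1) != 0 by exact: cGamma_neq0.
  have fk : k`!%:R != 0 :> R[i] by rewrite pnatr_eq0 -lt0n fact_gt0.
  pose c0 := cpow (z / 2) nu * ((-1) ^+ k * (z / 2) ^+ (2 * k))%:C / (k`!%:R * cGamma (nu + k%:R + 1)).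
  have E u : 0 < u -> pre u * T (u * z) k * (expR (- (p * u ^+ 2)))%:C =
     c0 * (cpow u (2 * (nu + k%:R + 1) - 1) * (expR (- (p * u ^+ 2)))%:C).
    move=> u0; rewrite /pre /T /c0 -!(mulrA u z) cpowM//.
    have -> : 2 * (nu + k%:R + 1) - 1 = (nu + 1) + nu + (2 * k)%:R by rewrite natrM; ring.
    rewrite !cpowD cpow_nat//.
    have -> : (u * (z / 2)) ^+ (2 * k) = u ^+ (2 * k) * (z / 2) ^+ (2 * k) by rewrite exprMn.
    rewrite !rmorphM.
    by field; rewrite fk gk.
  have i2 := cintegrableZ c0 i1.
  split; first by apply: eq_cintegrable i2 => u u0; rewrite E.
  rewrite (eq_cint E) cintZ// e1 /c0.
  have -> : - (nu + k%:R + 1) = - (nu + 1) + - k%:R by ring.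
  have h3 : cpow p (- (nu + 1) + - k%:R) = cpow p (- (nu + 1)) * (p ^+ k)%:C^-1.
    by rewrite cpowD (cpowN _ k%:R) cpow_nat.
  rewrite h3.
  have pk : (p ^+ k)%:C != 0 :> R[i] by apply: real_complex_neq0; rewrite expf_neq0// gt_eqF.
  have -> : (X ^+ k / k`!%:R)%:C = ((-1) ^+ k * (z / 2) ^+ (2 * k))%:C * (p ^+ k)%:C^-1 / k`!%:R :> R[i].
    rewrite rmorphM fmorphV rmorph_nat; congr (_ / _).
    rewrite -fmorphV -rmorphM; congr (_%:C).
    rewrite /X exprM -mulrA -exprMn -exprVn -exprMn; congr (_ ^+ k).
    by field; rewrite gt_eqF.
  by field; rewrite ?fk ?gk ?pk ?pnatr_eq0.
have sumE n : cint (fun u => S n u * (expR (- (p * u ^+ 2)))%:C) =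
   cpow (z / 2) nu / 2 * cpow p (- (nu + 1)) * (\sum_(0 <= k < n) (X ^+ k / k`!%:R))%:C /\
   cintegrable (fun u => S n u * (expR (- (p * u ^+ 2)))%:C).
  elim: n => [|n [ih1 ih2]].
    have E0 u : 0 < u -> S 0 u * (expR (- (p * u ^+ 2)))%:C = (0 : R)%:C.
      by move=> _; rewrite /S big_nil mulr0 mul0r.
    rewrite (eq_cint E0) cint_real rint0 big_nil mulr0; split => //.
    apply: eq_cintegrable (cintegrable_real rintegrable0) => u u0; by rewrite E0.
  have [t1 t2] := term n.
  have E u : 0 < u -> S n.+1 u * (expR (- (p * u ^+ 2)))%:C =
     S n u * (expR (- (p * u ^+ 2)))%:C + pre u * T (u * z) n * (expR (- (p * u ^+ 2)))%:C.
    by move=> _; rewrite /S big_nat_recr//=; ring.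
  split.
    by rewrite (eq_cint E) cintD// ih1 t2 big_nat_recr//= rmorphD mulrDr.
  by apply: eq_cintegrable (cintegrableD ih2 t1) => u u0; rewrite E.
apply: (eq_ccvg (fun n => esym (sumE n).1)).
apply: ccvgM; first exact: ccvg_cst.
by apply: ccvg_real; exact: cvg_sum_exp.
Qed.

End bessel_laplace.

(** * Shifted kernels, their common majorant and their limits *)

Section laplace_kernels.
Context {R : realType}.
Variables (a : R[i]) (b : R).
Hypotheses (b0 : 0 < b) (a0 : 0 < re a).
Implicit Types (q r x E X : R).
Local Notation al := (re a).

(** The shift [E] is the trace of a cut-off [e^(- E u^2)], which replaces [p = q] by [p = q + E] in
    the transform of the Hankel kernel. The factor [q^(- 1/2)] comes from the integral for
    [1 / sqrt(x^2 + u^2)] and is not shifted. *)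
Definition vker E q : R[i] := cpow (q + E) (- a) * (expR (- (b / (q + E))) * pw q (- (1 / 2)))%:C.
(** The minimum of [q^(- 1/2)] and [q^(- 1/2 - al)]: up to a constant it dominates [vker E] for all
    [E >= 0] at once. *)
Definition mker q : R := if q <= 1 then pw q (- (1 / 2)) else pw q (- (1 / 2) - al).
Definition lap (g : R -> R[i]) X : R[i] := cint (fun q => g q * (expR (- (X * q)))%:C).

Lemma normc_vker E q : normc (vker E q) =
  pw (q + E) (- al) * (expR (- (b / (q + E))) * pw q (- (1 / 2))).
Proof. by rewrite /vker normcM_real ?mulr_ge0 ?expR_ge0// normc_cpow ReN. Qed.

Lemma cmeas_vker E : 0 <= E -> cmeas (vker E).
Proof.
move=> E0; apply: cmeasM; first by apply: cmeas_cpow; rmeas_tac.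
apply: cmeas_real; rmeas_tac => x x0; lra.
Qed.

Lemma pw_expV_le r : 0 < r -> pw r (- al) * expR (- (b / r)) <= expR (al * ln ((al + 1) / b)).
Proof.
move=> r0; rewrite -expRD ler_expR.
have iv : 0 < r^-1 by rewrite invr_gt0.
by have := mul_ln_le (ltW a0) b0 iv; rewrite lnV ?posrE//; lra.
Qed.

(** The first summand bounds [r^(- al) e^(- b / r)] over all [r > 0] and serves [q <= 1]; the added
    1 lets the same constant serve [q > 1]. *)
Definition Kv : R := expR (al * ln ((al + 1) / b)) + 1.
Lemma Kv_ge1 : 1 <= Kv. Proof. by rewrite /Kv lerDr expR_ge0. Qed.

Lemma normc_vker_le E q : 0 <= E -> 0 < q -> normc (vker E q) <= Kv * mker q.
Proof.
move=> E0 q0; have r0 : 0 < q + E by lra.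
rewrite normc_vker mulrA /mker; case: (leP q 1) => q1.
  by rewrite ler_wpM2r ?expR_ge0// (le_trans (pw_expV_le r0))// /Kv lerDl.
have -> : pw q (- (1 / 2) - al) = pw q (- al) * pw q (- (1 / 2)) by rewrite -expRD; congr expR; ring.
rewrite mulrA ler_wpM2r ?expR_ge0//.
apply: (@le_trans _ _ (pw q (- al))); last by rewrite ler_peMl ?expR_ge0 ?Kv_ge1.
apply: (@le_trans _ _ (pw (q + E) (- al))).
  by rewrite ler_piMr ?expR_ge0// -expR0 ler_expR oppr_le0 divr_ge0 ?ltW.
by rewrite ler_expR ler_wnM2l ?oppr_le0 ?(ltW a0)// ler_ln ?posrE; lra.
Qed.

Lemma rmeas_mker : rmeas mker.
Proof. by apply: rmeas_ltif; rmeas_tac. Qed.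
Lemma mker_ge0 q : 0 <= mker q.
Proof. by rewrite /mker; case: ifP => _; rewrite expR_ge0. Qed.
Lemma mker_le q : 0 < q -> mker q <= pw q (- (1 / 2)).
Proof.
move=> q0; rewrite /mker; case: (leP q 1) => q1 //; rewrite ler_expR.
have l0 : 0 <= ln q by rewrite ln_ge0// ltW.
have := mulr_ge0 (ltW a0) l0; lra.
Qed.
Lemma mker_le2 q : 0 < q -> mker q <= pw q (- (1 / 2) - al).
Proof.
move=> q0; rewrite /mker; case: (leP q 1) => q1 //; rewrite ler_expR.
have l0 : ln q <= 0 by rewrite ln_le0.
have := mulr_ge0_le0 (ltW a0) l0; lra.
Qed.

Lemma half_gtN1 : -1 < - (1 / 2) :> R. Proof. lra. Qed.

Lemma rintegrable_mker X : 0 < X -> rintegrable (fun q => mker q * expR (- (X * q))).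
Proof.
move=> X0; apply: (rintegrable_le _ (rintegrable_gamma half_gtN1 X0)).
  by apply: rmeasM; [exact: rmeas_mker|rmeas_tac].
move=> q q0; rewrite ger0_norm ?mulr_ge0 ?mker_ge0 ?expR_ge0//.
by rewrite ler_wpM2r ?expR_ge0// mker_le.
Qed.

Definition Mker X := rint (fun q => mker q * expR (- (X * q))).
Lemma Mker_ge0 X : 0 <= Mker X.
Proof. by apply: rint_ge0 => q _; rewrite mulr_ge0 ?mker_ge0 ?expR_ge0. Qed.
Lemma Mker_mono X Y : 0 < X -> X <= Y -> Mker Y <= Mker X.
Proof.
move=> X0 XY; apply: le_rint; [apply: rintegrable_mker; lra|exact: rintegrable_mker|].
move=> q q0; rewrite ler_wpM2l ?mker_ge0// ler_expR lerN2 ler_wpM2r//; exact: ltW.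
Qed.

Lemma rint_gamma_scale s X : -1 < s -> 0 < X ->
  rint (fun q => pw q s * expR (- (X * q))) = pw X (- s - 1) * rint (fun q => pw q s * expR (- (1 * q))).
Proof.
move=> s1 X0; rewrite (rint_scale X0 (rintegrable_gamma s1 ltr01)).2 -rintZ; last first.
  exact: (rint_scale X0 (rintegrable_gamma s1 ltr01)).1.
apply: eq_rint => q q0; rewrite mul1r.
have e1 : expR (s * ln (X * q)) = pw X s * pw q s by rewrite lnM// mulrDr expRD.
have e2 : pw X (- s - 1) * pw X s * X = 1.
  rewrite -expRD (_ : _ + _ = - ln X); last by ring.
  by rewrite expRN lnK// mulVf// gt_eqF.
rewrite e1; transitivity (pw X (- s - 1) * pw X s * X * (pw q s * expR (- (X * q)))); last by ring.
by rewrite e2 mul1r.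
Qed.

(** This is [Gamma(1/2)]; [G12E] evaluates it. *)
Definition G12 : R := rint (fun q => pw q (- (1 / 2)) * expR (- (1 * q))).

Lemma Mker_le X : 0 < X -> Mker X <= G12 * pw X (- (1 / 2)).
Proof.
move=> X0; rewrite mulrC (_ : - (1 / 2) = - - (1 / 2) - 1 :> R); last by field.
rewrite -(rint_gamma_scale half_gtN1 X0); apply: le_rint.
- exact: rintegrable_mker.
- exact: (rintegrable_gamma half_gtN1 X0).
- by move=> q q0; rewrite ler_wpM2r ?expR_ge0// mker_le.
Qed.

Lemma lap_integrable (g : R -> R[i]) C X : cmeas g -> 0 < X ->
  (forall q, 0 < q -> normc (g q) <= C * mker q) ->
  cintegrable (fun q => g q * (expR (- (X * q)))%:C) /\ normc (lap g X) <= 2 * C * Mker X.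
Proof.
move=> mg X0 gC.
have hb q : 0 < q -> normc (g q * (expR (- (X * q)))%:C) <= C * (mker q * expR (- (X * q))).
  by move=> q0; rewrite normcM_real ?expR_ge0// mulrA ler_wpM2r ?expR_ge0// gC.
have ih := rintegrableZ C (rintegrable_mker X0).
have ig : cintegrable (fun q => g q * (expR (- (X * q)))%:C).
  apply: (cintegrable_le _ ih) => //; apply: cmeasM => //.
  by apply: cmeas_real; rmeas_tac.
split => //; apply: (le_trans (normc_cint_le ig ih hb)).
by rewrite rintZ ?mulrA//; exact: rintegrable_mker.
Qed.

Lemma lap_vker_integrable E X : 0 <= E -> 0 < X ->
  cintegrable (fun q => vker E q * (expR (- (X * q)))%:C).
Proof.
move=> E0 X0; have [] := @lap_integrable (vker E) Kv X (cmeas_vker E0) X0 _ => //.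
by move=> q; exact: normc_vker_le.
Qed.

Lemma ccvg0_le (u : nat -> R[i]) (e : nat -> R) :
  (forall n, normc (u n) <= e n) -> e @ \oo --> 0 -> ccvg u 0.
Proof.
move=> ue e0; split; apply/norm_cvg0P; apply: (squeeze_cvgr _ (cvg_cst 0) e0); near=> n.
  by rewrite normr_ge0/= (le_trans (normc_re _)).
by rewrite normr_ge0/= (le_trans (normc_im _)).
Unshelve. all: by end_near. Qed.

Lemma cvg_natS1V : (fun n : nat => n.+1%:R^-1 : R) @ \oo --> 0.
Proof. exact: cvg_harmonic. Qed.

Lemma cvg_vker0 q : 0 < q -> ccvg (fun n : nat => vker (n.+1%:R^-1) q) (vker 0 q).
Proof.
move=> q0.
have h : (fun n : nat => q + n.+1%:R^-1) @ \oo --> q + 0.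
  by apply: cvgD; [exact: cvg_cst|exact: cvg_natS1V].
apply: ccvgM; first by apply: ccvg_cpow => //; rewrite addr0.
apply: ccvg_real; apply: cvgM; last exact: cvg_cst.
apply: (continuous_cvg _ (@continuous_expR R _)); apply: cvgN.
apply: cvgM; first exact: cvg_cst.
by apply: cvgV => //; rewrite addr0 gt_eqF.
Qed.

(** The modulus is at most [E^(- al) q^(- 1/2)] with [al > 0]. This removes the kernel of the
    subtracted Gaussian [e^(- n u^2)] in the limit. *)
Lemma cvg_vker_y q : 0 < q -> ccvg (fun n : nat => vker n.+1%:R q) 0.
Proof.
move=> q0.
apply: (@ccvg0_le _ (fun n : nat => expR (- (al * ln n.+1%:R)) * pw q (- (1 / 2)))).
  move=> n; rewrite normc_vker; have n0 : 0 < n.+1%:R :> R by [].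
  rewrite mulrA ler_wpM2r ?expR_ge0// -expRD ler_expR.
  have : 0 <= b / (q + n.+1%:R) by rewrite divr_ge0 ?(ltW b0)//; lra.
  have : al * ln n.+1%:R <= al * ln (q + n.+1%:R).
    by rewrite ler_wpM2l ?(ltW a0)// ler_ln ?posrE//; lra.
  lra.
rewrite -[X in _ --> X](mul0r (pw q (- (1 / 2)))); apply: cvgM; last exact: cvg_cst.
apply: cvg_expN0; apply/cvgryPge => A; near=> n.
rewrite -ler_pdivrMl// -[leLHS]expRK ler_ln ?posrE ?expR_gt0//.
rewrite (@le_trans _ _ n%:R)//; last by rewrite ler_nat.
by near: n; exact: nbhs_infty_ger.
Unshelve. all: by end_near. Qed.

End laplace_kernels.

Section rint_half.
Context {R : realType}.

(** The substitution [q = u^2] gives twice the Gaussian integral over the half-line. *)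
Lemma G12E : @G12 R = Num.sqrt pi.
Proof.
have two0 : (2 : R) != 0 by [].
have z1 : -1 < 0 :> R by lra.
have half1 : -1 < - (1 / 2) :> R by lra.
have [i e] := rint_power 0 two0 (rintegrable_gamma half1 ltr01).
rewrite /G12 e.
have E (u : R) : 0 < u -> expR (- (1 / 2) * ln (expR (2 * ln u + 0))) *
   expR (- (1 * expR (2 * ln u + 0))) * (`|2| * expR (2 * ln u + 0) / u) = 2 * gauss_fun u.
  move=> u0; rewrite addr0 expRK (ger0_norm (x := 2))// (mul1r (expR _)).
  rewrite (_ : - (1 / 2) * (2 * ln u) = - ln u); last by field.
  rewrite expRM_natl expRN lnK// /gauss_fun; field; by rewrite gt_eqF.
rewrite (eq_rint E).
have ig : rintegrable (@gauss_fun R).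
  have := rintegrableZ 2^-1 i; apply: eq_rintegrable => u u0.
  by rewrite E// mulKf.
rewrite rintZ// /rint /Rintegral.
rewrite integral_itv_obnd_cbnd; last first.
  by apply/measurable_EFinP; apply: measurable_funTS; exact: measurable_gauss_fun.
by rewrite integral0y_gauss /= mulrCA divff ?mulr1// pnatr_eq0.
Qed.

Lemma rint_sqrtV (A : R) : 0 < A ->
  rint (fun q => pw q (- (1 / 2)) * expR (- (A * q))) = Num.sqrt pi / Num.sqrt A.
Proof.
move=> A0; have half1 : -1 < - (1 / 2) :> R by lra.
rewrite (rint_gamma_scale half1 A0) -/(G12) G12E mulrC; congr (_ * _).
have s0 : 0 < Num.sqrt A by rewrite sqrtr_gt0.
have e : ln A = 2 * ln (Num.sqrt A) by rewrite -{1}(sqr_sqrtr (ltW A0)) lnXn// mulr_natl.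
rewrite e (_ : (- - (1 / 2) - 1) * (2 * ln (Num.sqrt A)) = - ln (Num.sqrt A)); last by field.
by rewrite expRN lnK.
Qed.

End rint_half.

(** * The critical line Re a = 1/2: boundedness through oscillation *)

Section oscillating_kernel.
Context {R : realType}.
Implicit Types (q r x E X : R).

Lemma cos_lipschitz x y : `|cos x - cos y| <= `|x - y|.
Proof.
wlog xy : x y / y <= x.
  move=> h; case: (leP y x) => [/h//|/ltW /h]; by rewrite distrC (distrC y).
have [|c _ ->] := @MVT_segment R cos (fun x => - sin x) y x xy.
  by apply: continuous_subspaceT; exact: continuous_cos.
by rewrite normrM ler_piMl// normrN ler_norml sin_geN1 sin_le1.
Qed.
Lemma sin_lipschitz x y : `|sin x - sin y| <= `|x - y|.
Proof.
wlog xy : x y / y <= x.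
  move=> h; case: (leP y x) => [/h//|/ltW /h]; by rewrite distrC (distrC y).
have [|c _ ->] := @MVT_segment R sin cos y x xy.
  by apply: continuous_subspaceT; exact: continuous_sin.
by rewrite normrM ler_piMl// ler_norml cos_geN1 cos_le1.
Qed.

(** The two components of [r^s] are [cos(Im s ln r) / r] and [sin(Im s ln r) / r], so
    [oscillation_bound] applies to each. The bound is uniform as [X] tends to 0, where the absolute
    integral diverges logarithmically. *)
Lemma oscillation_cpow_bound (s : R[i]) : re s = -1 -> im s != 0 -> exists C : R,
  forall X, 0 < X ->
  let g r := if r <= 1 then 0 else cpow r s * (expR (- (X * r)))%:C in
  cintegrable g /\ normc (cint g) <= C.
Proof.
move=> s1 s2.
have [C1 h1] := @oscillation_bound R (im s) 1 0 s2.
have [C2 h2] := @oscillation_bound R (im s) 0 1 s2.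
exists (C1 + C2) => X X0 g.
have [i1 b1] := h1 X X0; have [i2 b2] := h2 X X0.
have e1 r : 0 < r -> (if r <= 1 then 0 else expR (- (X * r)) / r * (1 * cos (im s * ln r) + 0 * sin (im s * ln r))) = re (g r).
  move=> r0; rewrite /g; case: ifP => // _.
  by rewrite ReMC re_cpow s1 mulN1r (expRN (ln r)) lnK//; ring.
have e2 r : 0 < r -> (if r <= 1 then 0 else expR (- (X * r)) / r * (0 * cos (im s * ln r) + 1 * sin (im s * ln r))) = im (g r).
  move=> r0; rewrite /g; case: ifP => // _.
  by rewrite ImMC im_cpow s1 mulN1r (expRN (ln r)) lnK//; ring.
split.
  by split; [exact: eq_rintegrable e1 i1|exact: eq_rintegrable e2 i2].
apply: (le_trans (normc_le _)); rewrite /cint /=.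
by apply: lerD; [rewrite -[X in `|X|](eq_rint e1)|rewrite -[X in `|X|](eq_rint e2)].
Qed.

Variables (a : R[i]) (b : R).
Hypotheses (b0 : 0 < b) (a12 : re a = 1 / 2) (a2 : im a != 0).

Let a0 : 0 < re a. Proof. by rewrite a12; lra. Qed.
Let s : R[i] := - a - (1 / 2)%:C.
Let res : re s = -1. Proof. by rewrite /s ReD !ReN a12 ReC; lra. Qed.
Let ims : im s = - im a. Proof. by rewrite /s ImD !ImN ImC oppr0 addr0. Qed.

Let m2 r : R := if r <= 1 then pw r (- (1 / 2)) else pw r (-2).

Let rintegrable_m2 : rintegrable m2.
Proof. by apply: rintegrable_pw; lra. Qed.

(* Up to L = max(E, 1) the kernel is dominated; beyond L it is compared with
   the E-free power q^(-1 - it), whose integral is bounded by oscillation. *)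
Let tail_le E L q : 0 <= E -> E <= L -> 1 <= L -> L < q ->
  normc (vker a b E q - cpow q s) <= (2 + 2 * b + 2 * `|im a|) * (L * pw q (-2)).
Proof.
move=> E0 EL L1 Lq.
have q0 : 0 < q by lra.
have r0 : 0 < q + E by lra.
pose lr := ln (q + E); pose lq := ln q.
have lrq : lr - lq <= E / q.
  have p0 : 0 < 1 + E / q by rewrite ltr_wpDr// divr_ge0// ltW.
  have -> : lr - lq = ln (1 + E / q).
    rewrite /lr /lq -ln_div ?posrE//; congr ln; field; by rewrite gt_eqF.
  by have := ln_le_sub1 p0; lra.
have lqr : lq <= lr by rewrite ler_ln ?posrE//; lra.
(* The logarithm of the ratio of the moduli of [vker a b E q] and [q^s]; it is nonpositive and at
   least [- (E + b) / q]. *)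
pose x := (lq - lr) / 2 - b / (q + E).
pose A := expR (- lq + x); pose B := expR (- lq).
have bq : b / (q + E) <= b / q by rewrite ler_pM2l// lef_pV2 ?posrE//; lra.
have br : 0 <= b / (q + E) by rewrite divr_ge0// ltW.
have x0 : x <= 0 by rewrite /x; lra.
have AB : A = B * expR x by rewrite /A expRD.
have ex : 1 - expR x <= E / q + b / q.
  have e0 : 0 <= E / q by rewrite divr_ge0// ltW.
  by have := expR_ge1Dx x; rewrite {1}/x; lra.
have B0 : 0 < B by exact: expR_gt0.
have BV : B = q^-1 by rewrite /B expRN lnK.
have q2 : pw q (-2) = q^-1 * q^-1 by rewrite (_ : -2 * ln q = - ln q + - ln q); [rewrite expRD expRN lnK|ring].
have hA : expR (- (1 / 2) * lr) * (expR (- (b / (q + E))) * pw q (- (1 / 2))) = A.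
  by rewrite -!expRD /A /x -/lq; congr expR; field; rewrite gt_eqF.
have vre : re (vker a b E q) = A * cos (im a * lr).
  by rewrite /vker ReMC re_cpow ReN ImN a12 (mulNr (im a)) cosN -/lr -hA; ring.
have vim : im (vker a b E q) = - (A * sin (im a * lr)).
  by rewrite /vker ImMC im_cpow ReN ImN a12 (mulNr (im a)) sinN -/lr -hA; ring.
have sre : re (cpow q s) = B * cos (im a * lq).
  by rewrite re_cpow res ims (mulNr (im a)) cosN mulN1r.
have sim : im (cpow q s) = - (B * sin (im a * lq)).
  by rewrite im_cpow res ims (mulNr (im a)) sinN mulN1r mulrN.
have dl : `|im a * lr - im a * lq| <= `|im a| * (E / q).
  by rewrite -mulrBr normrM ler_wpM2l// ger0_norm//; lra.
(* [A c1 - B c2 = (A - B) c1 + B (c1 - c2)] separates the error in modulus from the error in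
   phase. *)
have comp (c1 c2 : R) : `|c1| <= 1 -> `|c1 - c2| <= `|im a| * (E / q) ->
    `|A * c1 - B * c2| <= (E / q + b / q) / q + `|im a| * (E / q) / q.
  move=> h1 h2.
  rewrite (_ : A * c1 - B * c2 = (A - B) * c1 + B * (c1 - c2)); last by ring.
  apply: (le_trans (ler_normD _ _)); apply: lerD.
    rewrite normrM -[leRHS]mulr1 ler_pM//.
    rewrite AB -[X in _ - X]mulr1 -mulrBr normrM gtr0_norm// BV mulrC ler_wpM2r ?invr_ge0 ?(ltW q0)//.
    rewrite distrC ger0_norm// subr_ge0 -expR0 ler_expR//.
  rewrite normrM gtr0_norm// BV mulrC ler_wpM2r ?invr_ge0 ?(ltW q0)//.
have h1 : `|re (vker a b E q - cpow q s)| <= (E / q + b / q) / q + `|im a| * (E / q) / q.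
  rewrite ReD ReN vre sre; apply: comp.
    by rewrite ler_norml cos_geN1 cos_le1.
  by apply: le_trans dl; exact: cos_lipschitz.
have h2 : `|im (vker a b E q - cpow q s)| <= (E / q + b / q) / q + `|im a| * (E / q) / q.
  rewrite ImD ImN vim sim.
  rewrite (_ : _ - _ = - (A * sin (im a * lr) - B * sin (im a * lq))); last by ring.
  rewrite normrN; apply: comp.
    by rewrite ler_norml sin_geN1 sin_le1.
  by apply: le_trans dl; exact: sin_lipschitz.
apply: (le_trans (normc_le _)); apply: (le_trans (lerD h1 h2)).
rewrite q2; set v := q^-1; have v0 : 0 < v by rewrite invr_gt0.
rewrite [leLHS](_ : _ = (2 * E + 2 * b + 2 * `|im a| * E) * (v * v)); last by ring.
rewrite [leRHS]mulrA ler_wpM2r ?mulr_ge0 ?(ltW v0)//.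
have t0 : 0 <= `|im a| by [].
have := ler_wpM2l t0 EL; have : b <= b * L by rewrite ler_peMr// ltW.
lra.
Qed.

Lemma cmeas_ltif (g1 g2 : R -> R) (g h : R -> R[i]) : rmeas g1 -> rmeas g2 -> cmeas g -> cmeas h ->
  cmeas (fun x => if g1 x <= g2 x then g x else h x).
Proof.
move=> m1 m2' [p1 p2] [q1 q2]; split.
  apply: (@eq_rmeas _ (fun x => if g1 x <= g2 x then re (g x) else re (h x))).
    by move=> x _; case: ifP.
  exact: rmeas_ltif.
apply: (@eq_rmeas _ (fun x => if g1 x <= g2 x then im (g x) else im (h x))).
  by move=> x _; case: ifP.
exact: rmeas_ltif.
Qed.

(** The integral splits into [g1], the kernel up to [L] and its difference from [q^s] beyond, and
    [g2], the pure power beyond [L]. The first is dominated by a scaled copy of [m2], the second is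
    handled by oscillation, and neither bound depends on [E] or [X]. *)
Lemma vker_osc_bound : exists C : R, forall E X, 0 <= E -> 0 < X ->
  normc (lap (vker a b E) X) <= C.
Proof.
have ims0 : im s != 0 by rewrite ims oppr_eq0.
have [C0 hO] := oscillation_cpow_bound res ims0.
pose K := Kv a b + (2 + 2 * b + 2 * `|im a|).
have Kv1 := Kv_ge1 a b.
have t0 : 0 <= `|im a| by [].
have K2 : 2 + 2 * b + 2 * `|im a| <= K by rewrite /K; lra.
have K1 : Kv a b <= K by rewrite /K; move: b0; lra.
exists (2 * (K * rint m2) + C0) => E X E0 X0.
pose L := Num.max E 1.
have EL : E <= L by rewrite le_max lexx.
have L1 : 1 <= L by rewrite le_max lexx orbT.
have L0 : 0 < L by lra.
have Li : 0 < L^-1 by rewrite invr_gt0.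
have LV : L^-1 = expR (- ln L) by rewrite expRN lnK.
pose g1 q := (if q <= L then vker a b E q else vker a b E q - cpow q s) * (expR (- (X * q)))%:C.
pose g2 q := if q <= L then 0 else cpow q s * (expR (- (X * q)))%:C.
(* The dilated majorant [m2(q / L) / L] has the same integral for every [L]. *)
have [iD eD] := rint_scale Li rintegrable_m2.
have iKD := rintegrableZ K iD.
have lnLq q : 0 < q -> ln (L^-1 * q) = ln q - ln L.
  by move=> q0; rewrite lnM ?posrE// lnV ?posrE// addrC.
have hb q : 0 < q -> normc (g1 q) <= K * (m2 (L^-1 * q) * L^-1).
  move=> q0; rewrite /g1 normcM_real ?expR_ge0// /m2.
  have -> : (L^-1 * q <= 1) = (q <= L) by rewrite mulrC ler_pdivrMr// mul1r.
  have ex1 : expR (- (X * q)) <= 1 by rewrite -expR0 ler_expR oppr_le0 mulr_ge0// ltW.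
  have r0 : 0 < q + E by lra.
  case: (leP q L) => qL; rewrite lnLq// LV -expRD.
    apply: (@le_trans _ _ (normc (vker a b E q))); first by rewrite ler_piMr ?normc_ge0.
    apply: (@le_trans _ _ (Kv a b * expR (- (1 / 2) * (ln q - ln L) - ln L))); last first.
      by rewrite ler_wpM2r ?expR_ge0.
    rewrite (_ : _ - ln L = - (1 / 2) * ln L + - (1 / 2) * ln q); last by field.
    rewrite expRD mulrA normc_vker mulrA ler_wpM2r ?expR_ge0//.
    have [E1|E1] := leP E 1.
      have -> : L = 1 by apply/eqP; rewrite eq_le L1 andbT ge_max E1 lexx.
      rewrite ln1 mulr0 expR0 mulr1; apply: (le_trans (pw_expV_le b0 a0 r0)).
      by rewrite /Kv lerDl.
    have -> : L = E by rewrite /L max_l// ltW.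
    apply: (@le_trans _ _ (expR (- (1 / 2) * ln E))); last by rewrite ler_peMl ?expR_ge0.
    rewrite a12; apply: (@le_trans _ _ (expR (- (1 / 2) * ln (q + E)))).
      by rewrite ler_piMr ?expR_ge0// -expR0 ler_expR oppr_le0 divr_ge0 ?ltW.
    by rewrite ler_expR ler_wnM2l ?oppr_le0// ler_ln ?posrE; lra.
  apply: (@le_trans _ _ (normc (vker a b E q - cpow q s))); first by rewrite ler_piMr ?normc_ge0.
  apply: (le_trans (tail_le E0 EL L1 qL)).
  have -> : L * pw q (-2) = expR (-2 * (ln q - ln L) - ln L).
    by rewrite -{1}(lnK L0) -expRD; congr expR; ring.
  by rewrite ler_wpM2r ?expR_ge0.
have m1 : cmeas g1.
  apply: cmeasM; last by apply: cmeas_real; rmeas_tac.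
  have mv := cmeas_vker a b E0.
  apply: cmeas_ltif => //; try by rmeas_tac.
  by apply: cmeasD => //; apply: cmeasN; apply: cmeas_cpow; rmeas_tac.
have i1 : cintegrable g1 by exact: cintegrable_le iKD hb.
have n1 : normc (cint g1) <= 2 * (K * rint m2).
  by apply: (le_trans (normc_cint_le i1 iKD hb)); rewrite rintZ// -eD.
have XL : 0 < X * L by rewrite mulr_gt0.
(* Rescaled by [L], the tail beyond [L] is the tail beyond 1 with [X L] in place of [X]; the
   oscillation bound is blind to this change. *)
have [iO nO] := hO (X * L) XL.
have [iS eS] := cint_scale Li iO.
set gO := (fun r : R => if r <= 1 then 0 else _) in iO nO iS eS.
(* Because [Re s = -1], the scaling factor of [q^s dq] has modulus 1. *)
pose c := (cpow L^-1 s * (L^-1)%:C)^-1.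
have c0 : cpow L^-1 s * (L^-1)%:C != 0.
  by rewrite mulf_neq0 ?cpow_neq0// real_complex_neq0// gt_eqF.
have nc : normc c = 1.
  rewrite /c normcV normcM_real ?(ltW Li)// normc_cpow res mulN1r lnV ?posrE// opprK lnK//.
  by rewrite divff ?gt_eqF// invr1.
have E2 q : 0 < q -> c * (gO (L^-1 * q) * (L^-1)%:C) = g2 q.
  move=> q0; rewrite /gO /g2.
  have -> : (L^-1 * q <= 1) = (q <= L) by rewrite mulrC ler_pdivrMr// mul1r.
  case: ifP => _; first by rewrite mul0r mulr0.
  rewrite cpowM// (_ : X * L * (L^-1 * q) = X * q); last by field; rewrite gt_eqF.
  rewrite (_ : _ * _ * _ * _ = (cpow L^-1 s * (L^-1)%:C) * (cpow q s * (expR (- (X * q)))%:C)); last by ring.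
  by rewrite /c mulKf.
have i2 : cintegrable g2 by apply: eq_cintegrable E2 _; exact: cintegrableZ.
have n2 : normc (cint g2) <= C0.
  by rewrite -(eq_cint E2) cintZ// -eS normcM nc mul1r.
have -> : lap (vker a b E) X = cint g1 + cint g2.
  rewrite -cintD//; apply: eq_cint => q q0; rewrite /g1 /g2; case: ifP => _; first by rewrite addr0.
  by ring.
by apply: (le_trans (le_normcD _ _)); exact: lerD.
Qed.

End oscillating_kernel.

(** * Lower bounds for the Macdonald-type transform W *)

Section macdonald_lower_bounds.
Context {R : realType}.
Variables (a : R[i]) (b : R).
Hypotheses (b0 : 0 < b) (a0 : 0 < re a).
Implicit Types (q r X : R).
Local Notation al := (re a).
Local Notation W X := (lap (vker a b 0) X).
Local Notation Wabs X := (rint (fun q => normc (vker a b 0 q) * expR (- (X * q)))).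

Lemma rintegrable_Wabs X : 0 < X -> rintegrable (fun q => normc (vker a b 0 q) * expR (- (X * q))).
Proof.
move=> X0; have := rintegrable_normc (lap_vker_integrable b0 a0 (lexx 0) X0).
by apply: eq_rintegrable => q _; rewrite normcM_real ?expR_ge0.
Qed.

(** Here [mker] itself is integrable, so [Mker] stays bounded as [X] tends to 0 and the [+ 1] alone
    is enough. *)
Lemma Mker_le_W_gt : 1 / 2 < al -> exists C : R, 0 <= C /\ forall X, 0 < X -> X <= 1 ->
  Mker a X <= C * (normc (W X) + 1).
Proof.
move=> ha; have h1 : -1 < - (1 / 2) :> R by lra.
have h2 : - (1 / 2) - al < -1 by lra.
have im := rintegrable_pw h1 h2.
have m0 : 0 <= rint (mker a) by apply: rint_ge0 => q _; exact: mker_ge0.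
exists (rint (mker a)); split => // X X0 _.
apply: (@le_trans _ _ (rint (mker a))).
  apply: le_rint => //; first exact: (rintegrable_mker a0 X0).
  by move=> q q0; rewrite ler_piMr ?mker_ge0// -expR0 ler_expR oppr_le0 mulr_ge0// ltW.
by have := mulr_ge0 m0 (normc_ge0 (W X)); lra.
Qed.

(** For real [a] the kernel is positive and [W] equals [Wabs]. Beyond [q = 1] the loss [e^(- b / q)]
    is at least [e^(- b)], and the part up to 1 contributes a bounded amount. *)
Lemma Mker_le_W_real : im a = 0 -> exists C : R, 0 <= C /\ forall X, 0 < X -> X <= 1 ->
  Mker a X <= C * (normc (W X) + 1).
Proof.
move=> ia; have h1 : -1 < - (1 / 2) :> R by lra.
have i01 := rintegrable_pw01 h1.
set I01 := rint (fun x : R => if x <= 1 then pw x (- (1 / 2)) else 0).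
have I0 : 0 <= I01 by apply: rint_ge0 => q _; case: ifP; rewrite ?expR_ge0.
exists (I01 + expR b); split; first by rewrite addr_ge0 ?expR_ge0.
move=> X X0 _.
have aE : a = al%:C by apply: complex_ext.
have WE : W X = (Wabs X)%:C.
  rewrite -cint_real; apply: eq_cint => q q0.
  rewrite rmorphM; congr (_ * _); rewrite normc_vker /vker {1}aE -rmorphN cpow_real.
  by rewrite -rmorphM.
have W0 : 0 <= Wabs X by apply: rint_ge0 => q _; rewrite mulr_ge0 ?normc_ge0 ?expR_ge0.
have -> : normc (W X) = Wabs X by rewrite WE normc_real ger0_norm.
have iW := rintegrable_Wabs X0.
apply: (@le_trans _ _ (I01 + expR b * Wabs X)); last first.
  by have := mulr_ge0 I0 W0; have := expR_ge0 b; lra.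
rewrite -rintZ// -rintD//; last exact: rintegrableZ.
apply: le_rint; [exact: (rintegrable_mker a0 X0)|by apply: rintegrableD => //; exact: rintegrableZ|].
move=> q q0; have p0 : 0 <= normc (vker a b 0 q) * expR (- (X * q)) by rewrite mulr_ge0 ?normc_ge0 ?expR_ge0.
have eb := expR_ge0 b.
rewrite /mker; case: (leP q 1) => q1.
  rewrite (@le_trans _ _ (pw q (- (1 / 2))))//.
    by rewrite ler_piMr ?expR_ge0// -expR0 ler_expR oppr_le0 mulr_ge0// ltW.
  by rewrite lerDl mulr_ge0.
rewrite add0r mulrA ler_wpM2r ?expR_ge0// normc_vker addr0 -!expRD ler_expR.
have : b / q <= b by rewrite ler_piMr ?(ltW b0)// invf_le1// ltW.
lra.
Qed.

(** After [q = p / X], [W X] is a factor of modulus [X^(al - 1/2)] times an integral tending to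
    [Gamma(1/2 - a)], which is nonzero. So [|W|] grows at the very rate that bounds [Mker]. *)
Lemma Mker_le_W_lt : al < 1 / 2 -> exists C : R, 0 <= C /\ forall X, 0 < X -> X <= 1 ->
  Mker a X <= C * (normc (W X) + 1).
Proof.
move=> ha.
have alg (g m w : R) : 0 < m -> 2 * g / m * (w * (m / 2)) = w * g.
  by move=> m0; field; rewrite gt_eqF.
pose s : R[i] := - a + (1 / 2)%:C.
have res : re s = 1 / 2 - al by rewrite /s ReD ReN ReC; lra.
have s0 : 0 < re s by rewrite res; lra.
have G0 := cGamma_neq0 s0.
have nG : 0 < normc (cGamma s) by exact: normc_gt0.
have iG := cGamma_integrable s0.
have res1 : re (s - 1) = - (1 / 2) - al by rewrite ReD ReN res /=; lra.
have h1 : -1 < - (1 / 2) - al by lra.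
pose k X q := pw q (- (1 / 2) - al) * (1 - expR (- (b * X / q))) * expR (- (1 * q)).
have ik0 := rintegrable_gamma h1 ltr01.
have k_b X q : 0 <= X -> 0 < q -> 0 <= 1 - expR (- (b * X / q)) <= 1.
  move=> X0 q0; rewrite subr_ge0 -{1}expR0 ler_expR oppr_le0 lerBlDr lerDl expR_ge0 andbT.
  by rewrite divr_ge0 ?mulr_ge0 ?(ltW b0) ?(ltW q0).
have mk X : rmeas (k X) by rewrite /k; rmeas_tac.
have kle X q : 0 <= X -> 0 < q -> `|k X q| <= pw q (- (1 / 2) - al) * expR (- (1 * q)).
  move=> X0 q0; have /andP[e0 e1] := k_b X q X0 q0.
  rewrite ger0_norm; last by rewrite /k !mulr_ge0 ?expR_ge0.
  by rewrite /k ler_wpM2r ?expR_ge0// ler_piMr ?expR_ge0.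
have ik X : 0 <= X -> rintegrable (k X).
  by move=> X0; apply: (rintegrable_le (mk X) ik0) => q; exact: kle.
have [|||_ cJ] := @rint_cvg R (fun n => k n.+1%:R^-1) (fun=> 0) _ _ ik0.
- by move=> n; exact: mk.
- by move=> n q q0; exact: kle.
- move=> q q0; rewrite /k.
  rewrite -[X in _ --> X](mul0r (expR (- (1 * q)))); apply: cvgM; last exact: cvg_cst.
  rewrite -[X in _ --> X](mulr0 (pw q (- (1 / 2) - al))); apply: cvgM; first exact: cvg_cst.
  rewrite -[X in _ --> X](subrr 1); apply: cvgB; first exact: cvg_cst.
  rewrite -[X in _ --> X]expR0; apply: (continuous_cvg _ (@continuous_expR R _)).
  rewrite -[X in _ --> X]oppr0; apply: cvgN.
  rewrite -[X in _ --> X](mul0r (q^-1)); apply: cvgM; last exact: cvg_cst.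
  rewrite -[X in _ --> X](mulr0 b); apply: cvgM; [exact: cvg_cst|exact: cvg_natS1V].
(* A quarter, because [normc_cint_le] doubles it: the integral then differs from Gamma by at most
   half of the modulus of Gamma. *)
have [n hn] : exists n : nat, rint (k n.+1%:R^-1) <= normc (cGamma s) / 4.
  have g4 : 0 < normc (cGamma s) / 4 by rewrite divr_gt0.
  move/cvgrPdist_lt : cJ => /(_ _ g4) [n _ /(_ n (leqnn n))] /=.
  by rewrite rint0 sub0r normrN => h; exists n; rewrite (le_trans (ler_norm _))// ltW.
pose x0 : R := n.+1%:R^-1.
have x00 : 0 < x0 by rewrite invr_gt0.
pose Ga := rint (fun q => pw q (- (1 / 2) - al) * expR (- (1 * q))).
have Ga0 : 0 <= Ga by apply: rint_ge0 => q _; rewrite mulr_ge0 ?expR_ge0.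
have c20 : 0 <= 2 * Ga / normc (cGamma s) by rewrite !mulr_ge0 ?invr_ge0 ?normc_ge0.
exists (2 * Ga / normc (cGamma s) + Mker a x0); split; first by rewrite addr_ge0 ?Mker_ge0.
move=> X X0 X1; have nW := normc_ge0 (W X).
(* Away from 0 the monotone [Mker] is bounded by its value at [x0], which the [+ 1] absorbs. *)
have [Xx|xX] := leP X x0; last first.
  apply: (le_trans (Mker_mono a0 x00 (ltW xX))); rewrite mulrDl.
  apply: ler_wpDl; first by rewrite mulr_ge0 ?addr_ge0.
  by rewrite mulrDr mulr1 lerDr mulr_ge0 ?Mker_ge0.
have XV : 0 < X^-1 by rewrite invr_gt0.
have [iV eV] := cint_scale XV (lap_vker_integrable b0 a0 (lexx 0) X0).
pose c := cpow X^-1 (- a) * (pw X^-1 (- (1 / 2)) * X^-1)%:C.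
pose V p := cpow p (s - 1) * (expR (- (b * X / p)) * expR (- p))%:C.
have E p : 0 < p -> vker a b 0 (X^-1 * p) * (expR (- (X * (X^-1 * p))))%:C * (X^-1)%:C = c * V p.
  move=> p0; rewrite /vker !addr0 cpowM// lnM ?posrE// mulrDr expRD.
  rewrite mulVKf ?gt_eqF// (_ : b / (X^-1 * p) = b * X / p); last by field; rewrite !gt_eqF.
  rewrite /V /c (_ : s - 1 = - a + (- (1 / 2))%:C); last first.
    by apply: complex_ext; rewrite /s !(ReD, ImD, ReN, ImN, ReC, ImC) /=; field.
  by rewrite cpowD (cpow_real p) !rmorphM; ring.
have cX : normc c = pw X (al - 1 / 2).
  rewrite /c normcM_real ?mulr_ge0 ?expR_ge0 ?(ltW XV)// normc_cpow ReN lnV ?posrE//.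
  have XVe : X^-1 = expR (- ln X) by rewrite expRN lnK.
  by rewrite XVe -!expRD; congr expR; field.
have c0 : c != 0.
  apply: mulf_neq0; first exact: cpow_neq0.
  by apply: real_complex_neq0; apply: lt0r_neq0; rewrite !mulr_gt0 ?expR_gt0.
have iVV : cintegrable V.
  have icV : cintegrable (fun p => c * V p) by exact: eq_cintegrable E iV.
  by apply: eq_cintegrable (cintegrableZ c^-1 icV) => p _; rewrite mulKf.
have WV : W X = c * cint V.
  by rewrite -cintZ// -(eq_cint E) -eV.
have diff : normc (cGamma s - cint V) <= 2 * rint (k X).
  rewrite /cGamma -cintB//; apply: normc_cint_le; [exact: cintegrableB|exact/ik/ltW|].
  move=> p p0; rewrite /V.
  have /andP[e0 e1] := k_b X p (ltW X0) p0.
  rewrite (_ : _ - _ = cpow p (s - 1) * (expR (- p) - expR (- (b * X / p)) * expR (- p))%:C); last first.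
    by rewrite rmorphB mulrBr.
  rewrite normcM normc_real normc_cpow res1 /k (mul1r p).
  rewrite (_ : expR (- p) - _ = (1 - expR (- (b * X / p))) * expR (- p)); last by ring.
  by rewrite ger0_norm ?mulr_ge0 ?expR_ge0// mulrA.
have kX : rint (k X) <= rint (k x0).
  apply: le_rint; [exact/ik/ltW|exact/ik/ltW|] => q q0.
  rewrite /k ler_wpM2r ?expR_ge0// ler_wpM2l ?expR_ge0// lerD2l lerN2 ler_expR lerN2.
  by rewrite ler_wpM2r ?invr_ge0 ?(ltW q0)// ler_wpM2l// ltW.
have VG : normc (cGamma s) / 2 <= normc (cint V).
  have tri := le_normcD (cGamma s - cint V) (cint V); rewrite subrK in tri.
  move: diff kX hn tri; rewrite -/x0.
  move: (rint (k X)) (rint (k x0)) (normc (cGamma s)) (normc (cint V)) (normc (cGamma s - cint V)).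
  by clear=> u1 u2 u3 u4 u5; lra.
have W1 : pw X (al - 1 / 2) * (normc (cGamma s) / 2) <= normc (W X).
  by rewrite WV normcM cX ler_wpM2l ?expR_ge0.
have M1 : Mker a X <= pw X (al - 1 / 2) * Ga.
  rewrite (_ : al - 1 / 2 = - (- (1 / 2) - al) - 1); last by field.
  rewrite -(rint_gamma_scale h1 X0); apply: le_rint.
  - exact: (rintegrable_mker a0 X0).
  - exact: (rintegrable_gamma h1 X0).
  - by move=> q q0; rewrite ler_wpM2r ?expR_ge0// mker_le2.
have M2 : pw X (al - 1 / 2) * Ga <= 2 * Ga / normc (cGamma s) * normc (W X).
  by rewrite -(alg Ga _ (pw X (al - 1 / 2)) nG); exact: ler_wpM2l c20 _ _ W1.
apply: (le_trans (le_trans M1 M2)); rewrite [leRHS]mulrDl; apply: ler_wpDr.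
  by rewrite mulr_ge0 ?Mker_ge0 ?addr_ge0.
by rewrite ler_wpM2l// lerDl.
Qed.

Lemma Mker_le_W : (im a = 0 \/ al != 1 / 2) -> exists C : R, 0 <= C /\ forall X, 0 < X -> X <= 1 ->
  Mker a X <= C * (normc (W X) + 1).
Proof.
case=> [|h]; first exact: Mker_le_W_real.
case/lt_total/orP: h => h; first exact: Mker_le_W_lt.
exact: Mker_le_W_gt.
Qed.

(** The exponent [b / q + X q] is least at [q = sqrt(b / X)]. Scaling this point to [r = 1] gives
    [2 rho + rho (r + 1 / r - 2)] with [rho = sqrt(b X)]. Then [laplace_cos] shows that the phase
    [Im a ln r] costs at most a factor 4. *)
Lemma Wabs_le_W : exists X1 : R, 1 <= X1 /\ forall X, X1 <= X -> Wabs X <= 4 * normc (W X).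
Proof.
pose v r := pw r (- al - 1 / 2).
pose y r : R := r + r^-1 - 2.
have yE r : 0 < r -> y r * r = (r - 1) ^+ 2.
  by move=> r0; rewrite /y; field; rewrite gt_eqF.
have y0 r : 0 < r -> 0 <= y r.
  by move=> r0; rewrite -(pmulr_lge0 _ r0) yE// sqr_ge0.
have [|||||||||N [N1 hN]] := @laplace_cos R v y (im a) (expR ((- al - 1 / 2) * ln 2)).
- by rewrite /v; rmeas_tac.
- by rewrite /y; rmeas_tac.
- by move=> r _; exact: expR_ge0.
- exact: expR_gt0.
- move=> r /andP[r1 r2]; rewrite /v ler_expR ler_wnM2l//; first by move: a0; lra.
  by rewrite ler_ln ?posrE//; lra.
- exact: y0.
- move=> r r0; rewrite -yE// [leRHS]mulrC; have := y0 r r0 => yr.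
  by rewrite ler_wpM2l//; lra.
- move=> r /andP[r1 _]; have r0 : 0 < r by lra.
  by rewrite -yE// ler_peMr// y0.
- have := rintegrableZ (expR 2) (rintegrable_macdonald (- al - 1 / 2) ltr01 ltr01).
  apply: eq_rintegrable => r r0; rewrite /v /y -!expRD; congr expR; ring.
(* The second bound is [rho >= N] written in terms of [X]. *)
exists (Num.max 1 (N ^+ 2 / b)); split; first by rewrite le_max lexx.
move=> X; rewrite ge_max => /andP[X1 XN].
have X0 : 0 < X by lra.
pose sb := Num.sqrt b; pose sX := Num.sqrt X.
have sb0 : 0 < sb by rewrite sqrtr_gt0.
have sX0 : 0 < sX by rewrite sqrtr_gt0.
have bE : b = sb ^+ 2 by rewrite sqr_sqrtr// ltW.
have XE : X = sX ^+ 2 by rewrite sqr_sqrtr// ltW.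
pose rho := sb * sX.
have rho0 : 0 < rho by rewrite mulr_gt0.
have rN : N <= rho.
  rewrite -(@ler_pXn2r _ 2%N) ?nnegrE//; [|lra|exact: ltW].
  by move: XN; rewrite ler_pdivrMr// /rho exprMn -bE -XE mulrC.
have [iA A0 A4] := hN rho rN.
set A := rint _ in A0 A4.
pose kap := sb / sX.
have kap0 : 0 < kap by rewrite divr_gt0.
have [iV eV] := cint_scale kap0 (lap_vker_integrable b0 a0 (lexx 0) X0).
pose c := cpow kap (- a) * (pw kap (- (1 / 2)) * kap * expR (- (2 * rho)))%:C.
pose U r := cpow r (- a) * (pw r (- (1 / 2)) * expR (- (rho * y r)))%:C.
have E r : 0 < r -> vker a b 0 (kap * r) * (expR (- (X * (kap * r))))%:C * kap%:C = c * U r.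
  move=> r0; rewrite /vker !addr0 cpowM// lnM ?posrE// mulrDr expRD.
  have e1 : b / (kap * r) = rho / r.
    by rewrite /kap /rho bE; field; rewrite !gt_eqF.
  have e2 : X * (kap * r) = rho * r.
    by rewrite /kap /rho {1}XE; field; rewrite !gt_eqF.
  have e3 : expR (- (rho / r)) * expR (- (rho * r)) = expR (- (2 * rho)) * expR (- (rho * y r)).
    by rewrite -!expRD; congr expR; rewrite /y; ring.
  rewrite e1 e2 /U /c.
  transitivity (cpow kap (- a) * cpow r (- a) * (pw kap (- (1 / 2)) * pw r (- (1 / 2)) * kap * (expR (- (rho / r)) * expR (- (rho * r))))%:C).
    by rewrite !rmorphM; ring.
  by rewrite e3 !rmorphM; ring.
have c0 : c != 0.
  apply: mulf_neq0; first exact: cpow_neq0.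
  apply: real_complex_neq0; apply: lt0r_neq0.
  by apply: mulr_gt0; [apply: mulr_gt0 => //; exact: expR_gt0|exact: expR_gt0].
have icU : cintegrable (fun r => c * U r) by exact: eq_cintegrable E iV.
have iU : cintegrable U.
  by apply: eq_cintegrable (cintegrableZ c^-1 icU) => p _; rewrite mulKf.
have WU : W X = c * cint U by rewrite -cintZ// -(eq_cint E) -eV.
have nU r : normc (U r) = v r * expR (- (rho * y r)).
  rewrite /U normcM_real ?mulr_ge0 ?expR_ge0// normc_cpow ReN /v -!expRD; congr expR; ring.
have WabsE : Wabs X = normc c * A.
  rewrite (rint_scale kap0 (rintegrable_Wabs X0)).2 -rintZ//; apply: eq_rint => r r0.
  have h := congr1 (@normc R) (E r r0).
  rewrite normcM_real ?(ltW kap0)// normcM_real ?expR_ge0// (normcM c) nU in h.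
  exact: h.
have AU : A <= 4 * normc (cint U).
  apply: (le_trans A4); rewrite ler_pM2l//.
  apply: (le_trans (ler_norm _)); apply: le_trans (normc_re _).
  rewrite /cint /= (_ : rint _ = rint (fun r => re (U r)))//.
  apply: eq_rint => r r0; rewrite /U ReMC re_cpow ReN ImN (mulNr (im a)) cosN /v.
  rewrite (_ : expR ((- al - 1 / 2) * ln r) = pw r (- al) * pw r (- (1 / 2))); last first.
    by rewrite -expRD; congr expR; ring.
  by ring.
by rewrite WabsE WU (normcM c) mulrCA; apply: ler_wpM2l AU; exact: normc_ge0.
Qed.

End macdonald_lower_bounds.

(** * Interchange of integrals and uniform bounds near zero *)

Section laplace_fubini.
Context {R : realType}.
Implicit Types (A B : R -> R[i]) (x q X : R).

Lemma rmeas2_sqrmul : rmeas2 (fun x q : R => x ^+ 2 * q).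
Proof.
apply: rmeas2M.
  by apply: (rmeas2_fst (G := fun x => x ^+ 2)); rmeas_tac.
by apply: (rmeas2_snd (G := fun x => x)); rmeas_tac.
Qed.

(** The kernel [e^(- x^2 q)] is shared by both iterated integrals, so the transform can be moved
    from one factor to the other. All interchanges of [q] with [x] or with [u] on complex integrands
    have this form. *)
Lemma laplace_fubini A B (Gd : R -> R) : cmeas A -> cmeas B ->
  (forall q, 0 < q -> cintegrable (fun x => A x * (expR (- (x ^+ 2 * q)))%:C)) ->
  (forall x, 0 < x -> cintegrable (fun q => B q * (expR (- (x ^+ 2 * q)))%:C)) ->
  rintegrable Gd ->
  (forall x, 0 < x -> normc (A x) * rint (fun q => normc (B q) * expR (- (x ^+ 2 * q))) <= Gd x) ->
  [/\ cintegrable (fun x => A x * lap B (x ^+ 2)),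
      cintegrable (fun q => B q * cint (fun x => A x * (expR (- (x ^+ 2 * q)))%:C)) &
      cint (fun x => A x * lap B (x ^+ 2)) =
      cint (fun q => B q * cint (fun x => A x * (expR (- (x ^+ 2 * q)))%:C))].
Proof.
move=> mA mB iA iB iG hG.
pose g x q := A x * (B q * (expR (- (x ^+ 2 * q)))%:C).
have mg : cmeas2 g.
  apply: cmeas2M; first exact: cmeas2_fst.
  apply: cmeas2M; first exact: cmeas2_snd.
  by apply: cmeas2_real; apply: rmeas2_exp; apply: rmeas2N; exact: rmeas2_sqrmul.
have i1 x : 0 < x -> cintegrable (g x) by move=> x0; apply: cintegrableZ; exact: iB.
have gE x q : g x q = B q * (A x * (expR (- (x ^+ 2 * q)))%:C) by rewrite /g mulrCA.
have i2 q : 0 < q -> cintegrable (g^~ q).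
  move=> q0; apply: (@eq_cintegrable _ (fun x => B q * (A x * (expR (- (x ^+ 2 * q)))%:C))).
    by move=> x _; rewrite gE.
  by apply: cintegrableZ; exact: iA.
have [|c1 c2 c3] := cfubini mg i1 i2 iG.
  move=> x x0; apply: le_trans (hG x x0).
  rewrite -rintZ; last first.
    apply: eq_rintegrable (rintegrable_normc (iB x x0)) => q _.
    by rewrite normcM_real ?expR_ge0.
  rewrite (eq_rint (h := fun q => normc (A x) * (normc (B q) * expR (- (x ^+ 2 * q)))))// => q _.
  by rewrite /g normcM normcM_real ?expR_ge0.
have e1 x : 0 < x -> cint (g x) = A x * lap B (x ^+ 2).
  by move=> x0; exact: (cintZ (A x) (iB x x0)).
have e2 q : 0 < q -> cint (g^~ q) = B q * cint (fun x => A x * (expR (- (x ^+ 2 * q)))%:C).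
  move=> q0; rewrite -(cintZ (B q) (iA q q0)).
  by apply: eq_cint => x _; exact: gE.
split.
- exact: eq_cintegrable e1 c1.
- exact: eq_cintegrable e2 c2.
- by rewrite -(eq_cint e1) -(eq_cint e2).
Qed.

End laplace_fubini.

Section kernel_sequences.
Context {R : realType}.
Variables (a : R[i]) (b : R).
Hypotheses (b0 : 0 < b) (a0 : 0 < re a).
Local Notation W X := (lap (vker a b 0) X).

(** Outside the critical case the common majorant transforms to [Mker], which is monotone and
    controlled by [Mker_le_W]. On the critical line with [Im a != 0] the transforms are simply
    bounded. The shift [E] serves the Gaussian cut-off and [d] the exponential one. *)
Lemma vker_near_bound : exists C : R, 0 <= C /\ forall E d X, 0 <= E -> 0 <= d -> 0 < X -> X <= 1 ->
  normc (lap (vker a b E) (X + d)) <= C * (normc (W X) + 1).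
Proof.
have [special|ns] := pselect (re a = 1 / 2 /\ im a != 0).
  case: special => a1 a2.
  have [C hC] := vker_osc_bound b0 a1 a2.
  exists `|C|; split => // E d X E0 d0 X0 _.
  apply: (@le_trans _ _ C); first by apply: hC => //; lra.
  apply: (le_trans (ler_norm C)); rewrite ler_peMr// lerDr; exact: normc_ge0.
have ns' : im a = 0 \/ re a != 1 / 2.
  case: (eqVneq (re a) (1 / 2)) => h; last by right.
  by left; apply: contrapT => h2; apply: ns; split => //; exact/eqP.
have [C [C0 hC]] := Mker_le_W b0 a0 ns'.
have K0 : 0 <= Kv a b by have := Kv_ge1 a b; lra.
exists (2 * Kv a b * C); split; first by rewrite !mulr_ge0.
move=> E d X E0 d0 X0 X1.
have Xd : 0 < X + d by lra.
have [_ h] := lap_integrable a0 (cmeas_vker a b E0) Xd (fun q => @normc_vker_le _ a b b0 a0 E q E0).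
apply: (le_trans h); rewrite -[leRHS]mulrA ler_wpM2l ?mulr_ge0//.
apply: le_trans (hC X X0 X1); apply: Mker_mono => //; lra.
Qed.

Lemma lap_cvg (gn : nat -> R -> R[i]) g C X : (forall n, cmeas (gn n)) ->
  (forall n q, 0 < q -> normc (gn n q) <= C * mker a q) ->
  (forall q, 0 < q -> ccvg (gn^~ q) (g q)) -> 0 < X ->
  ccvg (fun n => lap (gn n) X) (lap g X).
Proof.
move=> m hb hc X0.
have ih := rintegrableZ C (rintegrable_mker a0 X0).
have [|||//] := @cint_cvg R (fun n q => gn n q * (expR (- (X * q)))%:C)
  (fun q => g q * (expR (- (X * q)))%:C) _ _ ih.
- by move=> n; apply: cmeasM => //; apply: cmeas_real; rmeas_tac.
- by move=> n q q0; rewrite normcM_real ?expR_ge0// mulrA ler_wpM2r ?expR_ge0// hb.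
- by move=> q q0; apply: ccvgM; [exact: hc|exact: ccvg_cst].
Qed.

Lemma Wabs_mono X Y : 0 < X -> X <= Y ->
  rint (fun q => normc (vker a b 0 q) * expR (- (Y * q))) <=
  rint (fun q => normc (vker a b 0 q) * expR (- (X * q))).
Proof.
move=> X0 XY; apply: le_rint; [by apply: rintegrable_Wabs => //; lra|exact: rintegrable_Wabs|].
by move=> q q0; rewrite ler_wpM2l ?normc_ge0// ler_expR lerN2 ler_wpM2r// ltW.
Qed.

End kernel_sequences.

(** * The iterated Laplace integral against the K-transform *)

Section macdonald_laplace.
Context {R : realType}.
Variables (a : R[i]) (b : R) (h : R -> R[i]).
Hypotheses (b0 : 0 < b) (a0 : 0 < re a).
Local Notation W X := (lap (vker a b 0) X).
Local Notation Wabs X := (rint (fun q => normc (vker a b 0 q) * expR (- (X * q)))).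
Local Notation H q := (cint (fun x => h x * (expR (- (x ^+ 2 * q)))%:C)).

Lemma cmeas_laplace_transform : cmeas h ->
  (forall q, 0 < q -> cintegrable (fun x => h x * (expR (- (x ^+ 2 * q)))%:C)) ->
  cmeas (fun q => H q).
Proof.
move=> mh iH; apply: (@cmeas_cint _ (fun q x => h x * (expR (- (x ^+ 2 * q)))%:C)) => //.
apply: cmeas2M; first exact: cmeas2_snd.
apply: (@cmeas2_swap _ (fun x q => (expR (- (x ^+ 2 * q)))%:C)).
by apply: cmeas2_real; apply: rmeas2_exp; apply: rmeas2N; exact: rmeas2_sqrmul.
Qed.

(** Measurability of [h] is contained in the convergence hypothesis and is recovered by dividing out
    the Gaussian. *)
Lemma cmeas_of_laplace : cintegrable (fun x => h x * (expR (- (x ^+ 2 * 1)))%:C) -> cmeas h.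
Proof.
move=> /cintegrable_meas m.
apply: (@eq_cmeas _ (fun x => (h x * (expR (- (x ^+ 2 * 1)))%:C) * (expR (x ^+ 2 * 1))%:C)).
  by move=> x _; rewrite -mulrA -rmorphM -expRD addNr expR0 mulr1.
by apply: cmeasM => //; apply: cmeas_real; rmeas_tac.
Qed.

(* The integrals over x and q do not commute absolutely in the hypotheses; the
   factor exp(- q / n) makes them do so, and is removed on both sides by
   dominated convergence. *)
Lemma laplace_macdonald :
  (forall q, 0 < q -> cintegrable (fun x => h x * (expR (- (x ^+ 2 * q)))%:C)) ->
  cintegrable (fun q => vker a b 0 q * H q) ->
  cintegrable (fun x => h x * W (x ^+ 2)) ->
  cint (fun q => vker a b 0 q * H q) = cint (fun x => h x * W (x ^+ 2)).
Proof.
move=> iH iLL iK.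
have ar1 (u1 u2 u3 c : R) : 0 <= u1 -> u2 <= c * (u1 + 1) -> 0 <= u3 ->
  u2 <= (c + 8) * u1 + (c + 2 * u3) by lra.
have ar2 (u1 u2 u3 c : R) : u1 <= u2 -> u2 <= 4 * u3 -> 0 <= c * u3 ->
  2 * u1 <= (c + 8) * u3 by lra.
have mh := cmeas_of_laplace (iH 1 ltr01).
have mH := cmeas_laplace_transform mh iH.
have mv := cmeas_vker a b (lexx 0).
pose d (n : nat) : R := n.+1%:R^-1.
have d0 n : 0 < d n by rewrite invr_gt0.
pose B n q := vker a b 0 q * (expR (- (d n * q)))%:C.
have mB n : cmeas (B n) by apply: cmeasM => //; apply: cmeas_real; rmeas_tac.
have BE n X q : B n q * (expR (- (X * q)))%:C = vker a b 0 q * (expR (- ((X + d n) * q)))%:C.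
  by rewrite /B -mulrA -rmorphM -expRD; congr (_ * (expR _)%:C); ring.
have lapB n X : lap (B n) X = W (X + d n) by apply: eq_cint => q _; exact: BE.
have x20 x : 0 < x -> 0 < x ^+ 2 :> R by exact: exprn_gt0.
have iBx n x : 0 < x -> cintegrable (fun q => B n q * (expR (- (x ^+ 2 * q)))%:C).
  move=> x0; apply: (@eq_cintegrable _ (fun q => vker a b 0 q * (expR (- ((x ^+ 2 + d n) * q)))%:C)).
    by move=> q _; rewrite BE.
  by apply: lap_vker_integrable => //; rewrite addr_gt0// x20.
have [X1 [X11 hfar]] := Wabs_le_W b0 a0.
have WW0 X : 0 <= Wabs X by apply: rint_ge0 => q _; rewrite mulr_ge0 ?normc_ge0 ?expR_ge0.
have WWn X : 0 < X -> normc (W X) <= 2 * Wabs X.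
  move=> X0; apply: normc_cint_le; [exact: lap_vker_integrable|exact: rintegrable_Wabs|].
  by move=> q _; rewrite normcM_real ?expR_ge0.
pose h1 x := normc (h x * (expR (- (x ^+ 2 * 1)))%:C).
have ih1 : rintegrable h1 by exact/rintegrable_normc/iH.
have h1E x : x ^+ 2 <= X1 -> normc (h x) <= expR X1 * h1 x.
  move=> xX; rewrite /h1 normcM_real ?expR_ge0// mulrCA ler_peMr ?normc_ge0//.
  by rewrite -expRD mulr1 -[leLHS]expR0 ler_expR subr_ge0.
pose hK x := normc (h x * W (x ^+ 2)).
have ihK : rintegrable hK by exact: rintegrable_normc.
have hK0 x : 0 <= hK x by exact: normc_ge0.
have h10 x : 0 <= h1 x by exact: normc_ge0.
have eX := expR_ge0 X1.
(* For fixed [n] the interchange is absolute: beyond [X1], [Wabs] is at most 4 times [|W|]. Below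
   [X1] it is at most [Wabs (d n)], finite thanks to the cut-off, and [h] is integrable there. *)
have F n : cint (fun x => h x * lap (B n) (x ^+ 2)) = cint (fun q => B n q * H q).
  have iG := rintegrableD (rintegrableZ 4 ihK) (rintegrableZ (Wabs (d n) * expR X1) ih1).
  have [|//] := laplace_fubini mh (mB n) iH (iBx n) iG.
  move=> x x0.
  rewrite (eq_rint (h := fun q => normc (vker a b 0 q) * expR (- ((x ^+ 2 + d n) * q)))); last first.
    move=> q _; rewrite -[LHS]normcM_real ?expR_ge0// BE normcM_real ?expR_ge0//.
  have [xX|xX] := leP X1 (x ^+ 2).
    rewrite ler_wpDr ?mulr_ge0//.
    rewrite /hK normcM mulrCA ler_wpM2l ?normc_ge0//.
    apply: le_trans (hfar _ xX); apply: Wabs_mono => //; first exact: x20.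
    by rewrite lerDl ltW.
  rewrite ler_wpDl ?mulr_ge0// mulrC -mulrA ler_pM ?normc_ge0//.
    by apply: Wabs_mono => //; rewrite lerDr sqr_ge0.
  by apply: h1E; exact: ltW.
have [C [C0 hnear]] := vker_near_bound b0 a0.
(* [C] covers [x^2 <= 1]. Beyond [X1] the 8 is the factor 2 of [WWn] times the 4 of Laplace's
   method. In between, where [W] might be small, the constant [2 Wabs 1] is used. *)
pose C1 := C + 8; pose C2 := C + 2 * Wabs 1.
have C20 : 0 <= C2 by rewrite addr_ge0 ?mulr_ge0.
have C10 : 0 <= C1 by rewrite addr_ge0.
have bound n x : 0 < x -> normc (h x * lap (B n) (x ^+ 2)) <= C1 * hK x + C2 * (expR X1 * h1 x).
  move=> x0; rewrite normcM lapB.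
  have xd : 0 < x ^+ 2 + d n by rewrite addr_gt0// x20.
  have dn := ltW (d0 n).
  have [xX|xX] := leP X1 (x ^+ 2).
    rewrite ler_wpDr ?mulr_ge0// /hK normcM mulrCA ler_wpM2l ?normc_ge0//.
    apply: (le_trans (WWn _ xd)).
    have s1 : Wabs (x ^+ 2 + d n) <= Wabs (x ^+ 2).
      by apply: Wabs_mono => //; [exact: x20|rewrite lerDl].
    have s2 := hfar _ xX.
    have s3 : 0 <= C * normc (W (x ^+ 2)) by rewrite mulr_ge0 ?normc_ge0.
    exact: (ar2 _ _ _ _ s1 s2 s3).
  have hx := h1E x (ltW xX).
  have key : normc (W (x ^+ 2 + d n)) <= C1 * normc (W (x ^+ 2)) + C2.
    have nW := normc_ge0 (W (x ^+ 2)).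
    have [x1|x1] := leP (x ^+ 2) 1.
      exact: (ar1 _ _ _ _ nW (hnear 0 (d n) (x ^+ 2) (lexx 0) dn (x20 _ x0) x1) (WW0 1)).
    have s1 : Wabs (x ^+ 2 + d n) <= Wabs 1.
      by apply: Wabs_mono => //; apply: (le_trans (ltW x1)); rewrite lerDl.
    apply: (le_trans (WWn _ xd)); rewrite ler_wpDl ?mulr_ge0// /C2 ler_wpDl//.
    by rewrite ler_pM2l.
  apply: (@le_trans _ _ (normc (h x) * (C1 * normc (W (x ^+ 2)) + C2))).
    by rewrite ler_wpM2l ?normc_ge0.
  rewrite mulrDr; apply: lerD; first by rewrite /hK normcM mulrCA.
  by rewrite mulrC ler_wpM2l.
have mW n : cmeas (fun x => lap (B n) (x ^+ 2)).
  apply: (@cmeas_cint _ (fun x q => B n q * (expR (- (x ^+ 2 * q)))%:C)) => //; last exact: iBx.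
  apply: cmeas2M; first exact: cmeas2_snd.
  by apply: cmeas2_real; apply: rmeas2_exp; apply: rmeas2N; exact: rmeas2_sqrmul.
have Bv n q : 0 < q -> normc (B n q) <= normc (vker a b 0 q).
  move=> q0; rewrite /B normcM_real ?expR_ge0// ler_piMr ?normc_ge0//.
  by rewrite -expR0 ler_expR oppr_le0 mulr_ge0// ltW.
have Bc q : 0 < q -> ccvg (B^~ q) (vker a b 0 q).
  move=> q0; rewrite -[X in ccvg _ X]mulr1; apply: ccvgM; first exact: ccvg_cst.
  rewrite oneC; apply: ccvg_real; rewrite -[X in _ --> X]expR0.
  apply: (continuous_cvg _ (@continuous_expR R _)).
  rewrite -[X in _ --> X]oppr0; apply: cvgN.
  by rewrite -[X in _ --> X](mul0r q); apply: cvgM; [exact: cvg_natS1V|exact: cvg_cst].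
have [||||_ lim1] := @cint_cvg R (fun n x => h x * lap (B n) (x ^+ 2)) (fun x => h x * W (x ^+ 2))
   (fun x => C1 * hK x + C2 * (expR X1 * h1 x)).
- by move=> n; exact: (cmeasM mh (mW n)).
- by apply: rintegrableD; [exact: rintegrableZ|apply: rintegrableZ; exact: rintegrableZ].
- by move=> n x; exact: bound.
- move=> x x0; apply: ccvgM; first exact: ccvg_cst.
  apply: (@lap_cvg R a a0 B (vker a b 0) (Kv a b) (x ^+ 2) mB _ Bc (x20 x x0)).
  by move=> n q q0; apply: (le_trans (Bv n q q0)); exact: normc_vker_le.
have [||||_ lim2] := @cint_cvg R (fun n q => B n q * H q) (fun q => vker a b 0 q * H q)
   (fun q => normc (vker a b 0 q * H q)).
- by move=> n; exact: (cmeasM (mB n) mH).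
- exact: (rintegrable_normc iLL).
- by move=> n q q0; rewrite [leLHS]normcM [leRHS]normcM; apply: ler_wpM2r; [exact: normc_ge0|exact: Bv].
- by move=> q q0; apply: ccvgM; [exact: Bc|exact: ccvg_cst].
apply: ccvg_unique lim2 _; apply: eq_ccvg lim1 => n; exact: F.
Qed.

End macdonald_laplace.

(** * The Hankel transform of the Glasser transform, with a cut-off *)

Section regularized_hankel.
Context {R : realType}.
Variables (nu : R[i]) (z : R) (h : R -> R[i]).
Hypotheses (hz : 0 < z) (hnu : -1 < re nu).
Implicit Types (x u q X : R) (n : nat).

Local Notation a := (nu + 1).
Local Notation b := (z ^+ 2 / 4).
Local Notation j := (hankel_kernel nu z).
Local Notation W X := (lap (vker a b 0) X).
Local Notation G u := (cint (fun x => h x * ((Num.sqrt (x ^+ 2 + u ^+ 2))^-1)%:C)).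

Let b0 : 0 < b. Proof. by rewrite divr_gt0 ?exprn_gt0. Qed.
Let a0 : 0 < re a. Proof. by rewrite ReD /=; move: hnu; lra. Qed.

(** It lies between 0 and 1 and tends to 1. The first Gaussian controls infinity; the difference is
    [O(u^2)] at 0, which compensates [u^(2 Re nu + 1)] from the kernel and [1 / u] from
    [sqrtV_le]. *)
Definition gauss_cutoff n u : R := expR (- (n.+1%:R^-1 * u ^+ 2)) - expR (- (n.+1%:R * u ^+ 2)).
(** The kernel that the cut-off produces on the [q] side, each Gaussian becoming one shift. *)
Definition kap n q : R[i] := vker a b (n.+1%:R^-1) q - vker a b n.+1%:R q.
Local Notation chi := gauss_cutoff.

Let N0 n : 0 < n.+1%:R :> R. Proof. by []. Qed.
Let NV n : 0 < n.+1%:R^-1 :> R. Proof. by rewrite invr_gt0. Qed.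
Let NV1 n : n.+1%:R^-1 <= n.+1%:R :> R.
Proof. by rewrite (@le_trans _ _ 1)// ?invf_le1// ler1n. Qed.

Lemma chi_ge0 n u : 0 <= chi n u.
Proof. by rewrite subr_ge0 ler_expR lerN2 ler_wpM2r ?sqr_ge0. Qed.
Lemma chi_le1 n u : chi n u <= 1.
Proof.
apply: (@le_trans _ _ (expR (- (n.+1%:R^-1 * u ^+ 2)))); first by rewrite lerBlDr lerDl expR_ge0.
by rewrite -[leRHS]expR0 ler_expR oppr_le0 mulr_ge0 ?sqr_ge0 ?ltW.
Qed.
Lemma chi_le n u : chi n u <= n.+1%:R * u ^+ 2 * expR (- (n.+1%:R^-1 * u ^+ 2)).
Proof.
pose w := u ^+ 2; have w0 : 0 <= w by exact: sqr_ge0.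
rewrite /chi -/w; pose e := expR (- (n.+1%:R^-1 * w)).
have -> : expR (- (n.+1%:R * w)) = e * expR (- (n.+1%:R * w - n.+1%:R^-1 * w)).
  by rewrite -expRD; congr expR; ring.
have h1 := expR_ge1Dx (- (n.+1%:R * w - n.+1%:R^-1 * w)).
have h2 : 0 <= n.+1%:R^-1 * w by rewrite mulr_ge0// ltW.
rewrite -/e; set Y := expR (- (_ - _)); rewrite -/Y in h1.
have h3 : 1 - Y <= n.+1%:R * w.
  have ar (y p q : R) : 1 + - (p - q) <= y -> 0 <= q -> 1 - y <= p by lra.
  exact: ar h1 h2.
rewrite (_ : e - e * Y = (1 - Y) * e); last by ring.
by rewrite ler_wpM2r ?expR_ge0.
Qed.
Lemma cvg_chi u : 0 < u -> (fun n : nat => chi n u) @ \oo --> (1 : R).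
Proof.
move=> u0; rewrite -[X in _ --> X](subr0 1); apply: cvgB.
  rewrite -[X in _ --> X]expR0; apply: (continuous_cvg _ (@continuous_expR R _)).
  rewrite -[X in _ --> X]oppr0; apply: cvgN.
  by rewrite -[X in _ --> X](mul0r (u ^+ 2)); apply: cvgM; [exact: cvg_natS1V|exact: cvg_cst].
apply: cvg_expN0; apply/cvgryPge => A; near=> n.
rewrite -ler_pdivrMr ?exprn_gt0// (@le_trans _ _ n%:R)//; last by rewrite ler_nat.
by near: n; exact: nbhs_infty_ger.
Unshelve. all: by end_near. Qed.
Lemma rmeas_chi n : rmeas (chi n).
Proof. by rewrite /chi; rmeas_tac. Qed.

Let jchi n u := j u * (chi n u)%:C.
Let mj : cmeas j. Proof. exact: cmeas_hankel_kernel. Qed.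
Let mjchi n : cmeas (jchi n).
Proof. by apply: (cmeasM mj); apply: cmeas_real; exact: rmeas_chi. Qed.

Let Jw n u := normc (jchi n u) * (1 + u^-1).
Let iJw n : rintegrable (Jw n).
Proof.
have [C [l [C0 l0 hj]]] := hankel_kernel_bound hz hnu.
have s1 : -1 < 2 * re nu + 3 by move: hnu; lra.
have s2 : -1 < 2 * re nu + 2 by move: hnu; lra.
have i1 := rintegrable_gauss s1 (ltW l0) (NV n).
have i2 := rintegrable_gauss s2 (ltW l0) (NV n).
apply: (rintegrable_le _ (rintegrableZ (C * n.+1%:R) (rintegrableD i1 i2))).
  apply: rmeasM; first exact: (rmeas_normc (mjchi n)).
  by rmeas_tac.
move=> u u0; have uV : 0 < u^-1 by rewrite invr_gt0.
rewrite ger0_norm; last by rewrite /Jw mulr_ge0 ?normc_ge0// addr_ge0// ltW.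
rewrite /Jw /jchi (normcM_real _ (chi_ge0 n u)).
set E := expR (l * u - n.+1%:R^-1 * u ^+ 2).
have pwS r : pw u (r + 1) = pw u r * u by rewrite mulrDl mul1r expRD lnK.
have e2 : pw u (2 * re nu + 2) = pw u (2 * re nu + 1) * u.
  by rewrite -pwS; congr expR; ring.
have e3 : pw u (2 * re nu + 3) = pw u (2 * re nu + 1) * u * u.
  by rewrite -!pwS; congr expR; ring.
have eE : E = expR (l * u) * expR (- (n.+1%:R^-1 * u ^+ 2)) by rewrite -expRD.
apply: (@le_trans _ _ (C * (pw u (2 * re nu + 1) * expR (l * u)) * (n.+1%:R * u ^+ 2 * expR (- (n.+1%:R^-1 * u ^+ 2))) * (1 + u^-1))).
  rewrite ler_wpM2r ?addr_ge0 ?(ltW uV)//.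
  by apply: ler_pM; rewrite ?normc_ge0 ?chi_ge0 ?hj ?chi_le.
rewrite e2 e3 eE le_eqVlt; apply/orP; left; apply/eqP.
by field; rewrite gt_eqF.
Qed.

(** Separates the variables, with the Glasser kernel at [u = 1] as the [x] factor, against which [h]
    is integrable. After squaring, [(1 + 1 / u)^2 (x^2 + u^2)] contains the terms [x^2] and
    [u^(- 2) u^2 = 1]. *)
Lemma sqrtV_le x u : 0 < x -> 0 < u ->
  (Num.sqrt (x ^+ 2 + u ^+ 2))^-1 <= (Num.sqrt (x ^+ 2 + 1))^-1 * (1 + u^-1).
Proof.
move=> x0 u0; have uV : 0 < u^-1 by rewrite invr_gt0.
have p1 : 0 < x ^+ 2 + u ^+ 2 by rewrite addr_gt0 ?exprn_gt0.
have p2 : 0 < x ^+ 2 + 1 by rewrite addr_gt0 ?exprn_gt0.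
rewrite mulrC ler_pdivlMr ?sqrtr_gt0// mulrC ler_pdivrMr ?sqrtr_gt0//.
rewrite -(@ler_pXn2r _ 2%N) ?nnegrE ?mulr_ge0 ?sqrtr_ge0 ?addr_ge0 ?(ltW uV)//.
rewrite exprMn !sqr_sqrtr ?(ltW p1) ?(ltW p2)//.
have e : u^-1 * u = 1 by rewrite mulVf// gt_eqF.
have e2 : (u^-1) ^+ 2 * u ^+ 2 = 1 by rewrite -exprMn e expr1n.
have -> : (1 + u^-1) ^+ 2 * (x ^+ 2 + u ^+ 2) =
  x ^+ 2 + u ^+ 2 + 2 * u^-1 * x ^+ 2 + 2 * (u^-1 * u) * u + (u^-1) ^+ 2 * x ^+ 2 + (u^-1) ^+ 2 * u ^+ 2 by ring.
rewrite e e2.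
have : 0 <= u ^+ 2 by exact: sqr_ge0.
have : 0 <= 2 * u^-1 * x ^+ 2 by rewrite !mulr_ge0 ?sqr_ge0// ltW.
have : 0 <= (u^-1) ^+ 2 * x ^+ 2 by rewrite mulr_ge0 ?sqr_ge0.
lra.
Qed.

Let qh q := pw q (- (1 / 2)).
Let sq x u := (Num.sqrt (x ^+ 2 + u ^+ 2))^-1.
Let sq_ge0 x u : 0 <= sq x u. Proof. by rewrite invr_ge0 sqrtr_ge0. Qed.
Let sq_gt0 x u : 0 < x -> 0 < x ^+ 2 + u ^+ 2.
Proof. by move=> x0; rewrite ltr_pwDl ?exprn_gt0 ?sqr_ge0. Qed.
Let half1 : -1 < - (1 / 2) :> R. Proof. lra. Qed.

Let iq x u : 0 < x -> rintegrable (fun q => qh q * expR (- ((x ^+ 2 + u ^+ 2) * q))) /\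
  rint (fun q => qh q * expR (- ((x ^+ 2 + u ^+ 2) * q))) = Num.sqrt pi * sq x u.
Proof.
move=> x0; split; first exact: (rintegrable_gamma half1 (sq_gt0 u x0)).
exact: (rint_sqrtV (sq_gt0 u x0)).
Qed.

Let iJ n : rintegrable (fun u => normc (jchi n u)).
Proof.
apply: (rintegrable_le (rmeas_normc (mjchi n)) (iJw n)) => u u0.
rewrite ger0_norm ?normc_ge0// /Jw ler_peMr ?normc_ge0// lerDl invr_ge0 ltW//.
Qed.

Let rmeas_sq x : 0 < x -> rmeas (fun u => sq x u).
Proof. by move=> x0; rewrite /sq; rmeas_tac => u u0; rewrite sqrtr_gt0 sq_gt0. Qed.

Let iJs n x : 0 < x -> rintegrable (fun u => normc (jchi n u) * sq x u) /\
  rint (fun u => normc (jchi n u) * sq x u) <= (Num.sqrt (x ^+ 2 + 1))^-1 * rint (Jw n).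
Proof.
move=> x0; have i := rintegrableZ (Num.sqrt (x ^+ 2 + 1))^-1 (iJw n).
have hb u : 0 < u -> normc (jchi n u) * sq x u <= (Num.sqrt (x ^+ 2 + 1))^-1 * Jw n u.
  move=> u0; rewrite /Jw mulrCA ler_wpM2l ?normc_ge0//; exact: sqrtV_le.
have i2 : rintegrable (fun u => normc (jchi n u) * sq x u).
  apply: (rintegrable_le _ i).
    by apply: rmeasM; [exact: (rmeas_normc (mjchi n))|exact: rmeas_sq].
  by move=> u u0; rewrite ger0_norm ?mulr_ge0 ?normc_ge0// hb.
by split; [exact: i2|rewrite -(rintZ _ (iJw n)); exact: (le_rint i2 i hb)].
Qed.

(** The constant of [laplace_hankel_kernel] divided by the [sqrt pi] of the integral for
    [1 / sqrt(x^2 + u^2)]. *)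
Definition hcst : R[i] := cpow (z / 2) nu / 2 / (Num.sqrt pi)%:C.

Let hcst_neq0 : hcst != 0.
Proof.
apply: mulf_neq0; first by apply: mulf_neq0; [exact: cpow_neq0|rewrite invr_eq0 pnatr_eq0].
by rewrite invr_eq0; apply: real_complex_neq0; rewrite gt_eqF// sqrtr_gt0 pi_gt0.
Qed.

Let spi : (Num.sqrt pi : R) != 0. Proof. by rewrite gt_eqF// sqrtr_gt0 pi_gt0. Qed.
Let spiC : (Num.sqrt pi)%:C != 0 :> R[i]. Proof. exact: real_complex_neq0. Qed.

Let jlap n q : 0 < q -> cint (fun u => jchi n u * (expR (- (u ^+ 2 * q)))%:C) * (qh q)%:C =
  hcst * (Num.sqrt pi)%:C * kap n q.
Proof.
move=> q0.
have q1 : 0 < q + n.+1%:R^-1 by rewrite addr_gt0.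
have q2 : 0 < q + n.+1%:R by rewrite addr_gt0.
have [i1 e1] := laplace_hankel_kernel hz hnu q1.
have [i2 e2] := laplace_hankel_kernel hz hnu q2.
have E u : 0 < u -> jchi n u * (expR (- (u ^+ 2 * q)))%:C =
  j u * (expR (- ((q + n.+1%:R^-1) * u ^+ 2)))%:C - j u * (expR (- ((q + n.+1%:R) * u ^+ 2)))%:C.
  move=> _; rewrite /jchi /chi -mulrA -rmorphM mulrBl -!expRD -mulrBr -rmorphB.
  by congr (_ * (expR _ - expR _)%:C); ring.
have hc : hcst * (Num.sqrt pi)%:C = cpow (z / 2) nu / 2 by rewrite /hcst divfK.
rewrite (eq_cint E) cintB// e1 e2 hc /kap /vker !rmorphM; ring.
Qed.

Let jlap_abs n q : 0 < q -> cintegrable (fun u => jchi n u * (expR (- (u ^+ 2 * q)))%:C).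
Proof.
move=> q0; apply: (cintegrable_le _ (iJ n)).
  by apply: cmeasM; [exact: mjchi|apply: cmeas_real; rmeas_tac].
move=> u u0; rewrite normcM_real ?expR_ge0// ler_piMr ?normc_ge0//.
by rewrite -expR0 ler_expR oppr_le0 mulr_ge0 ?sqr_ge0// ltW.
Qed.

(** Write [1 / sqrt(x^2 + u^2)] as an integral over [q], put [e^(- x^2 q)] into the weight [B],
    exchange [u] and [q], and evaluate the [u] integral by [jlap]. *)
Let inner n x : 0 < x ->
  cint (fun u => jchi n u * (sq x u)%:C) = hcst * lap (kap n) (x ^+ 2).
Proof.
move=> x0; pose B q : R[i] := (qh q * expR (- (x ^+ 2 * q)))%:C.
have x20 : 0 < x ^+ 2 by exact: exprn_gt0.
have mB : cmeas B by apply: cmeas_real; rewrite /qh; rmeas_tac.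
have BE u q : B q * (expR (- (u ^+ 2 * q)))%:C = (qh q * expR (- ((x ^+ 2 + u ^+ 2) * q)))%:C.
  by rewrite /B -rmorphM -mulrA -expRD; congr ((_ * expR _)%:C); ring.
have iB u : 0 < u -> cintegrable (fun q => B q * (expR (- (u ^+ 2 * q)))%:C).
  move=> u0; apply: (@eq_cintegrable _ (fun q => (qh q * expR (- ((x ^+ 2 + u ^+ 2) * q)))%:C)).
    by move=> q _; rewrite BE.
  by apply: cintegrable_real; case: (iq u x0).
have [i1 _] := iJs n x0.
have [|_ _ e] := laplace_fubini (mjchi n) mB (jlap_abs n) iB (rintegrableZ (Num.sqrt pi) i1).
  move=> u u0.
  rewrite (eq_rint (h := fun q => qh q * expR (- ((x ^+ 2 + u ^+ 2) * q)))); last first.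
    move=> q _; rewrite -[LHS]normcM_real ?expR_ge0// BE normc_real ger0_norm//.
    by rewrite mulr_ge0 ?expR_ge0.
  by case: (iq u x0) => _ ->; rewrite mulrCA.
have E1 u : 0 < u -> jchi n u * lap B (u ^+ 2) = (Num.sqrt pi)%:C * (jchi n u * (sq x u)%:C).
  move=> u0; rewrite /lap (eq_cint (g' := fun q => (qh q * expR (- ((x ^+ 2 + u ^+ 2) * q)))%:C)); last first.
    by move=> q _; rewrite BE.
  by rewrite cint_real; case: (iq u x0) => _ ->; rewrite rmorphM mulrCA.
have E2 q : 0 < q -> B q * cint (fun u => jchi n u * (expR (- (u ^+ 2 * q)))%:C) =
   hcst * (Num.sqrt pi)%:C * (kap n q * (expR (- (x ^+ 2 * q)))%:C).
  move=> q0; rewrite [RHS]mulrA -(jlap n q0) /B rmorphM; ring.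
have ijs : cintegrable (fun u => jchi n u * (sq x u)%:C).
  apply: (cintegrable_le _ i1).
    by apply: cmeasM; [exact: mjchi|apply: cmeas_real; exact: rmeas_sq].
  by move=> u u0; rewrite normcM_real.
have ik : cintegrable (fun q => kap n q * (expR (- (x ^+ 2 * q)))%:C).
  apply: (@eq_cintegrable _ (fun q => vker a b (n.+1%:R^-1) q * (expR (- (x ^+ 2 * q)))%:C - vker a b n.+1%:R q * (expR (- (x ^+ 2 * q)))%:C)).
    by move=> q _; rewrite -mulrBl.
  by apply: cintegrableB; apply: lap_vker_integrable => //; exact: ltW.
have e' : (Num.sqrt pi)%:C * cint (fun u => jchi n u * (sq x u)%:C) =
    hcst * (Num.sqrt pi)%:C * lap (kap n) (x ^+ 2).
  by rewrite /lap -(cintZ _ ijs) -(cintZ _ ik) -(eq_cint E1) -(eq_cint E2); exact: e.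
by apply: (mulfI spiC); rewrite e' mulrA [_ * hcst]mulrC.
Qed.

(** Bounding [kap] by [mker] would be too weak: [Mker] may blow up at 0, while [h] is only known to
    be integrable against [1 / sqrt(x^2 + 1)]. Bounding [kap] through its [u] integral and using
    Tonelli keeps the cancellation between the two shifted kernels. *)
Let kap_abs n : exists C : R, forall x, 0 < x ->
  rint (fun q => normc (kap n q) * expR (- (x ^+ 2 * q))) <= C * (Num.sqrt (x ^+ 2 + 1))^-1.
Proof.
pose Q q := rint (fun u => normc (jchi n u) * expR (- (u ^+ 2 * q))).
pose c1 := normc (hcst * (Num.sqrt pi)%:C).
have c10 : 0 < c1 by apply: normc_gt0; exact: mulf_neq0.
exists (c1^-1 * 2 * Num.sqrt pi * rint (Jw n)) => x x0.
have x20 : 0 < x ^+ 2 by exact: exprn_gt0.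
pose g u q := normc (jchi n u) * (qh q * expR (- ((x ^+ 2 + u ^+ 2) * q))).
have mg : rmeas2 g.
  apply: rmeas2M; first by apply: (rmeas2_fst (G := fun u => normc (jchi n u))); exact: rmeas_normc.
  apply: rmeas2M; first by apply: (rmeas2_snd (G := qh)); rewrite /qh; rmeas_tac.
  apply: rmeas2_exp; apply: rmeas2N; apply: rmeas2M.
    by apply: (rmeas2_fst (G := fun u => x ^+ 2 + u ^+ 2)); rmeas_tac.
  by apply: (rmeas2_snd (G := fun q => q)); rmeas_tac.
have g0 u q : 0 <= g u q by rewrite /g !mulr_ge0 ?normc_ge0 ?expR_ge0.
have ig1 u : 0 < u -> rintegrable (g u).
  by move=> u0; apply: rintegrableZ; case: (iq u x0).
have gE u q : g u q = qh q * expR (- (x ^+ 2 * q)) * (normc (jchi n u) * expR (- (u ^+ 2 * q))).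
  rewrite /g mulrDl opprD expRD; ring.
have iju q : 0 < q -> rintegrable (fun u => normc (jchi n u) * expR (- (u ^+ 2 * q))).
  move=> q0; apply: eq_rintegrable (rintegrable_normc (jlap_abs n q0)) => u _.
  by rewrite normcM_real ?expR_ge0.
have ig2 q : 0 < q -> rintegrable (g^~ q).
  move=> q0; apply: (eq_rintegrable (fun u _ => esym (gE u q))).
  by apply: rintegrableZ; exact: iju.
have [i1 i2] := iJs n x0.
have gu u : 0 < u -> rint (g u) = Num.sqrt pi * (normc (jchi n u) * sq x u).
  by move=> u0; case: (iq u x0) => iu eu; rewrite rintZ// eu mulrCA.
have [|f1 f2 f3] := rfubini mg ig1 ig2 (rintegrableZ (Num.sqrt pi) i1).
  move=> u u0; rewrite -gu//; rewrite le_eqVlt; apply/orP; left; apply/eqP.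
  by apply: eq_rint => q _; rewrite ger0_norm.
have gq q : 0 < q -> rint (g^~ q) = qh q * expR (- (x ^+ 2 * q)) * Q q.
  move=> q0; rewrite /Q -rintZ; last exact: iju.
  by apply: eq_rint => u _; exact: gE.
have kb q : 0 < q -> normc (kap n q) * expR (- (x ^+ 2 * q)) <= c1^-1 * 2 * rint (g^~ q).
  move=> q0; rewrite (gq q q0).
  have h1 : c1 * normc (kap n q) <= 2 * Q q * qh q.
    have jl := congr1 (@normc R) (jlap n q0).
    rewrite (normcM_real _ (expR_ge0 _ : 0 <= qh q)) (normcM (hcst * (Num.sqrt pi)%:C)) -/c1 in jl.
    rewrite -jl; apply: ler_wpM2r; first exact: expR_ge0.
    apply: normc_cint_le; [exact: jlap_abs|exact: iju|].
    by move=> u _; rewrite normcM_real ?expR_ge0.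
  rewrite (_ : c1^-1 * 2 * _ = c1^-1 * (2 * Q q * qh q) * expR (- (x ^+ 2 * q))); last by ring.
  apply: ler_wpM2r; first exact: expR_ge0.
  by rewrite (ler_pdivlMl _ _ c10).
have ik : rintegrable (fun q => normc (kap n q) * expR (- (x ^+ 2 * q))).
  apply: (rintegrable_le _ (rintegrableZ (c1^-1 * 2) f2)).
    apply: rmeasM; last by rmeas_tac.
    by apply: rmeas_normc; apply: cmeasD; [apply: cmeas_vker; exact: ltW|apply: cmeasN; exact: cmeas_vker].
  move=> q q0; rewrite ger0_norm; first exact: kb.
  exact: (mulr_ge0 (normc_ge0 _) (expR_ge0 _)).
apply: (@le_trans _ _ (rint (fun q => c1^-1 * 2 * rint (g^~ q)))).
  exact: (le_rint ik (rintegrableZ (c1^-1 * 2) f2) kb).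
rewrite (rintZ _ f2) -f3 (eq_rint gu) (rintZ _ i1).
rewrite [leRHS](_ : _ = c1^-1 * 2 * (Num.sqrt pi * ((Num.sqrt (x ^+ 2 + 1))^-1 * rint (Jw n)))); last by ring.
apply: ler_wpM2l; first by rewrite mulr_ge0 ?invr_ge0 ?(ltW c10).
by apply: ler_wpM2l; first exact: sqrtr_ge0.
Qed.

Let sq2 : rmeas2 (fun x u => sq x u).
Proof.
apply: (@eq_rmeas2 _ (fun x u => expR (- ln (Num.sqrt (x ^+ 2 + u ^+ 2))))).
  by move=> x u x0 u0; rewrite expRN lnK// posrE sqrtr_gt0 sq_gt0.
apply: rmeas2_exp; apply: rmeas2N; apply: (rmeas2_comp (phi := fun r => ln (Num.sqrt r))).
  apply: measurableT_comp; first exact: measurable_ln.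
  by apply: measurable_realfun.continuous_measurable_fun; exact: sqrt_continuous.
apply: rmeas2D.
  by apply: (rmeas2_fst (G := fun x => x ^+ 2)); rmeas_tac.
by apply: (rmeas2_snd (G := fun x => x ^+ 2)); rmeas_tac.
Qed.

Hypothesis iG1 : forall u, 0 < u -> cintegrable (fun x => h x * ((Num.sqrt (x ^+ 2 + u ^+ 2))^-1)%:C).

Let mh : cmeas h.
Proof.
have m := cintegrable_meas (iG1 ltr01).
apply: (@eq_cmeas _ (fun x => h x * ((Num.sqrt (x ^+ 2 + 1 ^+ 2))^-1)%:C * (Num.sqrt (x ^+ 2 + 1 ^+ 2))%:C)).
  move=> x x0; rewrite -mulrA -rmorphM mulVf ?mulr1// gt_eqF// sqrtr_gt0.
  exact: sq_gt0.
by apply: (cmeasM m); apply: cmeas_real; rmeas_tac.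
Qed.

Let hs x := normc (h x) * (Num.sqrt (x ^+ 2 + 1))^-1.
Let ihs : rintegrable hs.
Proof.
apply: eq_rintegrable (rintegrable_normc (iG1 ltr01)) => x x0.
by rewrite normcM_real ?invr_ge0 ?sqrtr_ge0// expr1n.
Qed.
Let hs0 x : 0 <= hs x. Proof. by rewrite /hs mulr_ge0 ?normc_ge0// invr_ge0 sqrtr_ge0. Qed.

Let mG : cmeas (fun u => G u).
Proof.
apply: (@cmeas_cint _ (fun u x => h x * (sq x u)%:C)) => //.
apply: cmeas2M; first exact: (cmeas2_snd mh).
by apply: (@cmeas2_swap _ (fun x u => (sq x u)%:C)); exact: (cmeas2_real sq2).
Qed.

(** With the cut-off the exchange of [u] and [x] is absolute, since [sqrtV_le] bounds the integrand
    by the product of [Jw n u] and [hs x]. *)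
Lemma regularized_hankel n : cintegrable (fun x => h x * lap (kap n) (x ^+ 2)) /\
  cint (fun u => jchi n u * G u) = hcst * cint (fun x => h x * lap (kap n) (x ^+ 2)).
Proof.
pose g u x := jchi n u * (h x * (sq x u)%:C).
have mg : cmeas2 g.
  apply: cmeas2M; first exact: (cmeas2_fst (mjchi n)).
  apply: cmeas2M; first exact: (cmeas2_snd mh).
  by apply: (@cmeas2_swap _ (fun x u => (sq x u)%:C)); exact: (cmeas2_real sq2).
have i1 u : 0 < u -> cintegrable (g u) by move=> u0; apply: cintegrableZ; exact: iG1.
have ijs x : 0 < x -> cintegrable (fun u => jchi n u * (sq x u)%:C).
  move=> x0; have [iJ1 _] := iJs n x0.
  apply: (cintegrable_le _ iJ1).
    by apply: (cmeasM (mjchi n)); apply: cmeas_real; exact: rmeas_sq.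
  by move=> u u0; rewrite (normcM_real _ (sq_ge0 x u)).
have gE x u : h x * (jchi n u * (sq x u)%:C) = g u x by rewrite /g mulrCA.
have i2 x : 0 < x -> cintegrable (g^~ x).
  move=> x0; apply: (eq_cintegrable (fun u _ => gE x u)).
  by apply: cintegrableZ; exact: ijs.
have [|c1 c2 c3] := cfubini mg i1 i2 (rintegrableZ (rint hs) (iJw n)).
  move=> u u0.
  have ib : rintegrable (fun x => Jw n u * hs x) by exact: rintegrableZ.
  rewrite mulrC -(rintZ _ ihs); apply: (le_rint (rintegrable_normc (i1 u u0)) ib) => x x0.
  rewrite [leLHS]normcM (normcM_real _ (sq_ge0 x u)) /Jw /hs.
  rewrite [leRHS](_ : _ = normc (jchi n u) * (normc (h x) * ((Num.sqrt (x ^+ 2 + 1))^-1 * (1 + u^-1)))); last by ring.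
  do 2 (apply: ler_wpM2l; first exact: normc_ge0).
  exact: sqrtV_le.
have e1 u : 0 < u -> cint (g u) = jchi n u * G u.
  by move=> u0; exact: (cintZ _ (iG1 u0)).
have e2 x : 0 < x -> cint (g^~ x) = hcst * (h x * lap (kap n) (x ^+ 2)).
  move=> x0; rewrite -(eq_cint (fun u _ => gE x u)) (cintZ _ (ijs x x0)) (inner n x0).
  by rewrite mulrCA.
have i3 : cintegrable (fun x => hcst * (h x * lap (kap n) (x ^+ 2))) by exact: eq_cintegrable e2 c2.
have i4 : cintegrable (fun x => h x * lap (kap n) (x ^+ 2)).
  apply: eq_cintegrable (cintegrableZ hcst^-1 i3) => x _; by rewrite mulKf.
split; first exact: i4.
by rewrite -(eq_cint e1) c3 (eq_cint e2) (cintZ _ i4).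
Qed.

Hypothesis iHG : cintegrable (fun u => j u * G u).

Let T_lim : ccvg (fun n => cint (fun u => jchi n u * G u)) (cint (fun u => j u * G u)).
Proof.
have [||||_ //] := @cint_cvg R (fun n u => jchi n u * G u) (fun u => j u * G u) (fun u => normc (j u * G u)).
- by move=> n; exact: (cmeasM (mjchi n) mG).
- exact: (rintegrable_normc iHG).
- move=> n u u0; rewrite [leLHS]normcM [leRHS]normcM; apply: ler_wpM2r; first exact: normc_ge0.
  by rewrite /jchi (normcM_real _ (chi_ge0 n u)) ler_piMr ?normc_ge0 ?chi_le1.
- move=> u u0; apply: ccvgM; last exact: ccvg_cst.
  rewrite -[X in ccvg _ X]mulr1; apply: ccvgM; first exact: ccvg_cst.
  by rewrite oneC; apply: ccvg_real; exact: cvg_chi.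
Qed.

Let mkap n : cmeas (kap n).
Proof. by apply: cmeasD; [apply: cmeas_vker; exact: ltW|apply: cmeasN; exact: cmeas_vker]. Qed.
Let kap_le n q : 0 < q -> normc (kap n q) <= (2 * Kv a b) * mker a q.
Proof.
move=> q0; have h1 := normc_vker_le b0 a0 (ltW (NV n)) q0.
have h2 := normc_vker_le b0 a0 (ltW (N0 n)) q0.
apply: (le_trans (normcB _ _)); apply: (le_trans (lerD h1 h2)).
by rewrite -mulrA mulr_natl mulr2n.
Qed.
Let kap_cvg q : 0 < q -> ccvg (kap^~ q) (vker a b 0 q).
Proof.
move=> q0; rewrite -[X in ccvg _ X]subr0; apply: ccvgD; first exact: cvg_vker0.
by apply: ccvgN; exact: (cvg_vker_y b0 a0 q0).
Qed.
Let x20 x : 0 < x -> 0 < x ^+ 2. Proof. exact: exprn_gt0. Qed.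
Let ikap n x : 0 < x -> cintegrable (fun q => kap n q * (expR (- (x ^+ 2 * q)))%:C).
Proof. by move=> x0; case: (lap_integrable a0 (mkap n) (x20 x0) (@kap_le n)). Qed.

(** The limit is taken on the [x] side. For [x <= 1] the transforms of [kap n] are bounded by
    [|W| + 1] through [vker_near_bound]; for larger [x] they are [O(1 / x)], which the Glasser
    hypothesis makes integrable against [h]. *)
Lemma macdonald_hankel : cintegrable (fun x => h x * W (x ^+ 2)) ->
  cint (fun u => j u * G u) = hcst * cint (fun x => h x * W (x ^+ 2)).
Proof.
move=> iK.
have [C [C0 hnear]] := vker_near_bound b0 a0.
have K0 : 0 <= Kv a b by apply: le_trans (Kv_ge1 a b).
(* For [x <= 1] two kernels give [2 C], and [1 <= 2 / sqrt(x^2 + 1)] doubles it. For [x > 1],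
   [lap_integrable] and [kap_le] give [4 Kv], [Mker] gives [sqrt pi / x], and
   [1 / x <= 2 / sqrt(x^2 + 1)]. *)
pose C3 := 4 * C + 8 * Kv a b * Num.sqrt pi.
have ihK := rintegrable_normc iK.
have ar1 (w u1 u2 c k : R) : u1 <= c * (w + 1) -> u2 <= c * (w + 1) -> 0 <= k ->
  u1 + u2 <= 2 * c * w + (4 * c + k) / 2 by lra.
have ar2 (w : R) : w <= 1 -> w + 1 <= 2 * 2 by lra.
have ar3 (w : R) : 1 < w -> w + 1 <= 2 ^+ 2 * w by rewrite expr2; lra.
have s0 x : 0 < x -> 0 < Num.sqrt (x ^+ 2 + 1) by move=> x0; rewrite sqrtr_gt0 addr_gt0 ?x20.
have k0 : 0 <= 8 * Kv a b * Num.sqrt pi by rewrite !mulr_ge0 ?sqrtr_ge0.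
have C30 : 0 <= C3 by rewrite /C3 addr_ge0// mulr_ge0.
have lapb n x : 0 < x -> normc (lap (kap n) (x ^+ 2)) <= 2 * C * normc (W (x ^+ 2)) + C3 * (Num.sqrt (x ^+ 2 + 1))^-1.
  move=> x0; have X0 := x20 x0.
  have [x1|x1] := leP (x ^+ 2) 1.
    have -> : lap (kap n) (x ^+ 2) = lap (vker a b (n.+1%:R^-1)) (x ^+ 2) - lap (vker a b n.+1%:R) (x ^+ 2).
      rewrite /lap -cintB; [|exact: (lap_vker_integrable b0 a0 (ltW (NV n)) X0)|exact: (lap_vker_integrable b0 a0 (ltW (N0 n)) X0)].
      by apply: eq_cint => q _; rewrite /kap mulrBl.
    have h1 := hnear _ 0 _ (ltW (NV n)) (lexx 0) X0 x1.
    have h2 := hnear _ 0 _ (ltW (N0 n)) (lexx 0) X0 x1.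
    rewrite addr0 in h1; rewrite addr0 in h2.
    apply: (le_trans (normcB _ _)); apply: (le_trans (ar1 _ _ _ _ _ h1 h2 k0)).
    rewrite lerD2l -/C3; apply: ler_wpM2l => //.
    rewrite lef_pV2 ?posrE ?s0//.
    rewrite -(@ler_pXn2r _ 2%N) ?nnegrE ?sqrtr_ge0// sqr_sqrtr; last by rewrite addr_ge0// ltW.
    by rewrite [leRHS]expr2; exact: ar2.
  have [_ hM] := lap_integrable a0 (mkap n) X0 (@kap_le n).
  apply: (le_trans hM).
  have hM2 := Mker_le a0 X0.
  have hx : pw (x ^+ 2) (- (1 / 2)) = x^-1.
    rewrite lnXn// mulr2n (_ : - (1 / 2) * (ln x + ln x) = - ln x); last by field.
    by rewrite expRN lnK.
  rewrite hx G12E in hM2.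
  apply: ler_wpDl; first by rewrite !mulr_ge0 ?normc_ge0.
  have xs : x^-1 <= 2 * (Num.sqrt (x ^+ 2 + 1))^-1.
    rewrite ler_pdivlMr ?s0// mulrC ler_pdivrMr//.
    rewrite -(@ler_pXn2r _ 2%N) ?nnegrE ?sqrtr_ge0 ?mulr_ge0 ?(ltW x0)// sqr_sqrtr; last by rewrite addr_ge0// (ltW X0).
    by rewrite exprMn; exact: ar3.
  have h4 : 0 <= 4 * Kv a b by rewrite mulr_ge0.
  rewrite (_ : 2 * (2 * Kv a b) = 4 * Kv a b); last by ring.
  apply: (le_trans (ler_wpM2l h4 hM2)).
  apply: (@le_trans _ _ (4 * Kv a b * (Num.sqrt pi * (2 * (Num.sqrt (x ^+ 2 + 1))^-1)))).
    by apply: ler_wpM2l => //; apply: ler_wpM2l => //; exact: sqrtr_ge0.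
  rewrite [leLHS](_ : _ = 8 * Kv a b * Num.sqrt pi * (Num.sqrt (x ^+ 2 + 1))^-1); last by ring.
  apply: ler_wpM2r; first by rewrite invr_ge0 sqrtr_ge0.
  by rewrite /C3 lerDr mulr_ge0.
have mlap n : cmeas (fun x => lap (kap n) (x ^+ 2)).
  apply: (@cmeas_cint _ (fun x q => kap n q * (expR (- (x ^+ 2 * q)))%:C)); last exact: ikap.
  apply: cmeas2M; first exact: (cmeas2_snd (mkap n)).
  by apply: cmeas2_real; apply: rmeas2_exp; apply: rmeas2N; exact: rmeas2_sqrmul.
have iD := rintegrableD (rintegrableZ (2 * C) ihK) (rintegrableZ C3 ihs).
have [|||_ lim] := @cint_cvg R (fun n x => h x * lap (kap n) (x ^+ 2)) (fun x => h x * W (x ^+ 2)) _ _ iD.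
- by move=> n; exact: (cmeasM mh (mlap n)).
- move=> n x x0; rewrite [leLHS]normcM.
  apply: (le_trans (ler_wpM2l (normc_ge0 _) (lapb n x x0))).
  rewrite mulrDr; apply: lerD; first by rewrite [X in _ <= _ * X]normcM mulrCA.
  by rewrite /hs mulrCA.
- move=> x x0; apply: ccvgM; first exact: ccvg_cst.
  exact: (@lap_cvg R a a0 kap (vker a b 0) (2 * Kv a b) (x ^+ 2) mkap (fun n q => @kap_le n q) kap_cvg (x20 x0)).
apply: ccvg_unique T_lim _.
apply: (eq_ccvg (fun n => esym (regularized_hankel n).2)).
by apply: ccvgM; [exact: ccvg_cst|exact: lim].
Qed.

Local Notation H q := (cint (fun x => h x * (expR (- (x ^+ 2 * q)))%:C)).

(** The limit is taken on the [q] side. For [q > 1], [mker] is at most [e^b] times the unshifted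
    kernel, so the integrability of [vker a b 0 q * H q] dominates. For [q <= 1] that kernel may be
    tiny, and the Glasser hypothesis takes over through [iHabs]. *)
Lemma laplace_hankel :
  (forall q, 0 < q -> cintegrable (fun x => h x * (expR (- (x ^+ 2 * q)))%:C)) ->
  cintegrable (fun q => vker a b 0 q * H q) ->
  cint (fun u => j u * G u) = hcst * cint (fun q => vker a b 0 q * H q).
Proof.
move=> iH iLL.
have mH := cmeas_laplace_transform mh iH.
have F n : cint (fun x => h x * lap (kap n) (x ^+ 2)) = cint (fun q => kap n q * H q).
  have [C hC] := kap_abs n.
  have [|_ _ //] := laplace_fubini mh (mkap n) iH (ikap n) (rintegrableZ C ihs).
  move=> x x0; rewrite /hs mulrCA; apply: ler_wpM2l; first exact: normc_ge0.
  exact: hC.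
pose Habs q := rint (fun x => normc (h x) * expR (- (x ^+ 2 * q))).
have inh q : 0 < q -> rintegrable (fun x => normc (h x) * expR (- (x ^+ 2 * q))).
  move=> q0; apply: eq_rintegrable (rintegrable_normc (iH q q0)) => x _.
  by rewrite normcM_real ?expR_ge0.
have HHabs q : 0 < q -> normc (H q) <= 2 * Habs q.
  move=> q0; apply: normc_cint_le; [exact: iH|exact: inh|].
  by move=> x _; rewrite normcM_real ?expR_ge0.
(* This is the absolute Glasser integral of [h] at [u = 1], with [1 / sqrt(x^2 + 1)] written as an
   integral over [q]. *)
have iHabs : rintegrable (fun q => qh q * expR (- q) * Habs q).
  pose g x q := normc (h x) * (qh q * expR (- ((x ^+ 2 + 1 ^+ 2) * q))).
  have mg : rmeas2 g.
    apply: rmeas2M; first by apply: (rmeas2_fst (G := fun x => normc (h x))); exact: rmeas_normc.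
    apply: rmeas2M; first by apply: (rmeas2_snd (G := qh)); rewrite /qh; rmeas_tac.
    apply: rmeas2_exp; apply: rmeas2N; apply: rmeas2M.
      by apply: (rmeas2_fst (G := fun x => x ^+ 2 + 1 ^+ 2)); rmeas_tac.
    by apply: (rmeas2_snd (G := fun q => q)); rmeas_tac.
  have gE x q : qh q * expR (- q) * (normc (h x) * expR (- (x ^+ 2 * q))) = g x q.
    rewrite /g mulrDl opprD expRD expr1n mul1r; ring.
  have g0 x q : 0 <= g x q by rewrite -gE !mulr_ge0 ?normc_ge0 ?expR_ge0.
  have ig1 x : 0 < x -> rintegrable (g x).
    by move=> x0; apply: rintegrableZ; case: (iq 1 x0).
  have ig2 q : 0 < q -> rintegrable (g^~ q).
    move=> q0; apply: (eq_rintegrable (fun x _ => gE x q)).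
    by apply: rintegrableZ; exact: inh.
  have [|_ f2 _] := rfubini mg ig1 ig2 (rintegrableZ (Num.sqrt pi) ihs).
    move=> x x0; rewrite (eq_rint (h := g x)); last by move=> q _; rewrite ger0_norm.
    have [i e] := iq 1 x0; rewrite /g (rintZ _ i) e /sq expr1n /hs.
    by rewrite mulrCA.
  apply: eq_rintegrable f2 => q q0.
  by rewrite /Habs -(rintZ _ (inh q q0)); apply: eq_rint => x _; rewrite gE.
have iLLn := rintegrable_normc iLL.
have K0 : 0 <= 2 * Kv a b by rewrite mulr_ge0//; apply: le_trans (Kv_ge1 a b).
have iD := rintegrableZ (2 * Kv a b) (rintegrableD (rintegrableZ (expR b) iLLn) (rintegrableZ (2 * expR 1) iHabs)).
have Habs0 q : 0 <= Habs q by apply: rint_ge0 => x _; rewrite mulr_ge0 ?normc_ge0 ?expR_ge0.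
have [|||_ lim] := @cint_cvg R (fun n q => kap n q * H q) (fun q => vker a b 0 q * H q) _ _ iD.
- by move=> n; exact: (cmeasM (mkap n) mH).
- move=> n q q0; rewrite [leLHS]normcM.
  apply: (@le_trans _ _ (2 * Kv a b * mker a q * normc (H q))).
    by apply: ler_wpM2r; [exact: normc_ge0|exact: kap_le].
  rewrite -mulrA; apply: ler_wpM2l => //.
  have [q1|q1] := leP q 1.
    apply: ler_wpDl; first by rewrite mulr_ge0 ?expR_ge0 ?normc_ge0.
    apply: (@le_trans _ _ (qh q * (2 * Habs q))).
      apply: ler_pM; [exact: mker_ge0|exact: normc_ge0|exact: mker_le|exact: HHabs].
    rewrite [leRHS](_ : _ = qh q * (2 * Habs q) * (expR 1 * expR (- q))); last by ring.
    rewrite ler_peMr ?mulr_ge0 ?expR_ge0//.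
    by rewrite -expRD -[leLHS]expR0 ler_expR subr_ge0.
  apply: ler_wpDr; first by rewrite !mulr_ge0 ?expR_ge0.
  rewrite [X in _ <= _ * X]normcM mulrA; apply: ler_wpM2r; first exact: normc_ge0.
  rewrite normc_vker addr0 /mker (leNgt q 1) q1/= -!expRD ler_expR.
  have : b / q <= b by rewrite ler_piMr ?(ltW b0)// invf_le1// ltW.
  lra.
- by move=> q q0; apply: ccvgM; [exact: kap_cvg|exact: ccvg_cst].
apply: ccvg_unique T_lim _.
apply: (eq_ccvg (fun n => esym (regularized_hankel n).2)).
apply: ccvgM; first exact: ccvg_cst.
by apply: (eq_ccvg (fun n => esym (F n))).
Qed.

End regularized_hankel.

(** * The four transforms in terms of the kernels above *)

Section transforms_as_laplace_integrals.
Context {R : realType}.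
Implicit Types (x y u q z : R) (nu mu : R[i]) (f : R -> R[i]).

Lemma sqrt_cpow x : 0 < x -> (Num.sqrt x)%:C = cpow x (1 / 2).
Proof.
move=> x0; rewrite halfC cpow_real; congr (_%:C).
have s0 : 0 < Num.sqrt x by rewrite sqrtr_gt0.
have -> : ln x = 2 * ln (Num.sqrt x) by rewrite -{1}(sqr_sqrtr (ltW x0)) lnXn// mulr_natl.
by rewrite mulrA (_ : 1 / 2 * 2 = 1 :> R) ?mul1r ?lnK//; field.
Qed.

Lemma invC_cpow x : 0 < x -> (x%:C)^-1 = cpow x (- 1).
Proof. by move=> x0; rewrite cpowN cpow1. Qed.

Lemma twoC : (2 : R[i]) = (2 : R)%:C. Proof. exact: natC. Qed.

(** The fold is centred at [q = z / (2 x)], where [z^2 / (4 q)] equals [x^2 q]. There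
    [q = e^(d + t)] and [q = e^(d - t)] share the weight [e^(- x z cosh t)], and their powers add up
    to [2 cosh(mu t)], which is Macdonald's integral. *)
Lemma lap_vker_bessel_K nu z x : 0 < z -> 0 < x -> 0 < re (nu + 1) ->
  lap (vker (nu + 1) (z ^+ 2 / 4) 0) (x ^+ 2) =
  2 * cpow (2 * x / z) (nu + 1 / 2) * bessel_K (nu + 1 / 2) (x * z).
Proof.
move=> z0 x0 a0; set mu := nu + 1 / 2.
have b0 : 0 < z ^+ 2 / 4 by rewrite divr_gt0 ?exprn_gt0.
have X0 : 0 < x ^+ 2 by rewrite exprn_gt0.
pose k := z / (2 * x); have k0 : 0 < k by rewrite divr_gt0 ?mulr_gt0.
pose d := ln k.
have [i e] := cint_exp_fold d (lap_vker_integrable b0 a0 (lexx 0) X0).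
pose c : R[i] := 2 * cpow (2 * x / z) mu.
have c0 : c != 0 by rewrite mulf_neq0 ?cpow_neq0// pnatr_eq0.
have ck : cpow (2 * x / z) mu = cexp (- mu * d%:C).
  have -> : 2 * x / z = k^-1 by rewrite invf_div.
  by rewrite (cpowV _ k0).
have term (s : R) : vker (nu + 1) (z ^+ 2 / 4) 0 (expR (d + s)) *
    (expR (- (x ^+ 2 * expR (d + s))))%:C * (expR (d + s))%:C =
    cexp (- mu * d%:C) * cexp (- mu * s%:C) * (expR (- (x * z) * ((expR s + expR (- s)) / 2)))%:C.
  rewrite /vker addr0 cpow_exp expRK.
  have e1 : expR (- (z ^+ 2 / 4 / expR (d + s))) * expR (- (x ^+ 2 * expR (d + s))) =
      expR (- (x * z) * ((expR s + expR (- s)) / 2)).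
    rewrite -expRD; congr expR; rewrite expRD lnK//.
    by rewrite /k expRN; field; rewrite !gt_eqF ?expR_gt0.
  transitivity (cexp (- (nu + 1) * (d + s)%:C) * ((expR (- (1 / 2) * (d + s)))%:C * (expR (d + s))%:C) *
     (expR (- (z ^+ 2 / 4 / expR (d + s))) * expR (- (x ^+ 2 * expR (d + s))))%:C).
    by rewrite !rmorphM; ring.
  rewrite e1; move: (expR (- (x * z) * _)) => w; rewrite -(cexp_real (d + s)) -(cexp_real (- (1 / 2) * _)).
  rewrite -!cexpD; congr (cexp _ * _).
  have hh (r : R) : (- (1 / 2) * r)%:C = - (1 / 2) * r%:C :> R[i] by rewrite halfC -rmorphN -rmorphM.
  by rewrite hh /mu (rmorphD _ d s); field.
have E t : 0 < t -> vker (nu + 1) (z ^+ 2 / 4) 0 (expR (d + t)) *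
    (expR (- (x ^+ 2 * expR (d + t))))%:C * (expR (d + t))%:C +
    vker (nu + 1) (z ^+ 2 / 4) 0 (expR (d - t)) *
    (expR (- (x ^+ 2 * expR (d - t))))%:C * (expR (d - t))%:C =
    c * ((expR (- (x * z) * ((expR t + expR (- t)) / 2)))%:C * ccosh (mu * t%:C)).
  move=> t0; rewrite !term opprK (addrC (expR (- t))) /c ck /ccosh.
  by rewrite rmorphN mulrN !mulNr opprK; field.
have iE := eq_cintegrable E i.
have iK : cintegrable (fun t => (expR (- (x * z) * ((expR t + expR (- t)) / 2)))%:C * ccosh (mu * t%:C)).
  by apply: eq_cintegrable (cintegrableZ c^-1 iE) => t _; rewrite mulKf.
by rewrite /lap e (eq_cint E) (cintZ _ iK).
Qed.

End transforms_as_laplace_integrals.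

Section transform_integrands.
Context {R : realType}.
Implicit Types (x y u q z : R) (nu : R[i]) (f : R -> R[i]).

Lemma cpow_half_arg x s : 0 < x -> cpow (x / 2) s = cpow x s * cpow 2 (- s).
Proof. by move=> x0; rewrite cpowM ?invr_gt0// cpowV. Qed.

Lemma sqrtM_cpow z x : 0 < x ->
  (Num.sqrt (x * z))%:C = cpow x (1 / 2) * (Num.sqrt z)%:C.
Proof. by move=> x0; rewrite (sqrtrM z (ltW x0)) rmorphM -sqrt_cpow. Qed.

Lemma L2_integrand_exp f y x :
  L2_integrand f y x = x%:C * f x * (expR (- (x ^+ 2 * y ^+ 2)))%:C.
Proof. by rewrite /L2_integrand rmorphM; ring. Qed.

Lemma L2_sqrt_integrable f q : 0 < q ->
  (forall y, 0 < y -> cintegrable (L2_integrand f (1 / (2 * y)))) ->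
  cintegrable (fun x => x%:C * f x * (expR (- (x ^+ 2 * q)))%:C).
Proof.
move=> q0 i; have s0 : 0 < Num.sqrt q by rewrite sqrtr_gt0.
have := i (2 * Num.sqrt q)^-1; rewrite invr_gt0 mulr_gt0// => /(_ isT).
apply: eq_cintegrable => x _; rewrite L2_integrand_exp.
have -> : 1 / (2 * (2 * Num.sqrt q)^-1) = Num.sqrt q by field; rewrite gt_eqF.
by rewrite (sqr_sqrtr (ltW q0)).
Qed.

Lemma iterated_L2_laplace f nu z :
  let phi := fun y => cpow y (2 * nu - 1) * L2 f (1 / (2 * y)) in
  let H q := cint (fun x => x%:C * f x * (expR (- (x ^+ 2 * q)))%:C) in
  let g q := vker (nu + 1) (z ^+ 2 / 4) 0 q * H q in
  cintegrable (L2_integrand phi z) ->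
  cintegrable g /\ L2 phi z = cpow 2 (- (2 * nu) - 2) * cint g.
Proof.
move=> phi H g i2.
have two0 : 0 < 2 :> R by [].
have r0 : - (1 / 2) != 0 :> R by rewrite oppr_eq0 gt_eqF// divr_gt0.
(* The map is [y = 1 / (2 sqrt q)], the inverse of [q = 1 / (4 y^2)]. *)
have [i e] := cint_power (- ln 2) r0 i2.
have c0 : cpow (2 : R) (- (2 * nu) - 2) != 0 by exact: cpow_neq0.
have E q : 0 < q -> L2_integrand phi z (expR (- (1 / 2) * ln q - ln 2)) *
    (`|- (1 / 2)| * expR (- (1 / 2) * ln q - ln 2) / q)%:C =
    cpow 2 (- (2 * nu) - 2) * g q.
  move=> q0; set y := expR _.
  have y0 : 0 < y by exact: expR_gt0.
  have y2 : y ^+ 2 = (4 * q)^-1.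
    rewrite /y -expRM_natl (_ : 2%:R * _ = - (ln q + 2 * ln 2)); last by field.
    by rewrite expRN expRD expRM_natl !lnK ?posrE//; congr (_^-1); ring.
  have yq : (1 / (2 * y)) ^+ 2 = q.
    by rewrite div1r exprVn exprMn y2; field; rewrite gt_eqF.
  have HE : L2 f (1 / (2 * y)) = H q.
    by apply: eq_cint => x _; rewrite L2_integrand_exp yq.
  have ez : y ^+ 2 * z ^+ 2 = z ^+ 2 / 4 / q by rewrite y2; field; rewrite gt_eqF.
  have half0 : `|- (1 / 2)| = 2^-1 :> R by rewrite normrN ger0_norm ?div1r.
  rewrite /L2_integrand /phi HE ez half0 /g /vker addr0.
  transitivity ((y%:C * y%:C * cpow y (2 * nu - 1) * (2 : R)%:C^-1 * q%:C^-1) *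
      ((expR (- (z ^+ 2 / 4 / q)))%:C * H q)).
    by rewrite !rmorphM !fmorphV; ring.
  transitivity (cpow 2 (- (2 * nu) - 2) * (cpow q (- (nu + 1)) * (pw q (- (1 / 2)))%:C) *
      ((expR (- (z ^+ 2 / 4 / q)))%:C * H q)); last by rewrite !rmorphM; ring.
  congr (_ * _); rewrite -[y%:C](cpow1 y0) (invC_cpow two0) (invC_cpow q0).
  have h2 : (- (1 / 2) : R)%:C = - (1 / 2) :> R[i] by rewrite halfC rmorphN.
  have ly : (ln y)%:C = - (1 / 2) * (ln q)%:C - (ln (2 : R))%:C :> R[i].
    by rewrite -h2 -rmorphM -rmorphB /y expRK.
  by rewrite -cpow_real h2 /cpow ly -!cexpD; congr cexp; field.
have ig : cintegrable g.
  have i3 := eq_cintegrable E i.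
  by apply: eq_cintegrable (cintegrableZ (cpow (2 : R) (- (2 * nu) - 2))^-1 i3) => q _; rewrite mulKf.
by split => //; rewrite /L2 e (eq_cint E) (cintZ _ ig).
Qed.

Lemma Ktrans_laplace f nu z : 0 < z -> -1 < re nu ->
  let g x := x%:C * f x * lap (vker (nu + 1) (z ^+ 2 / 4) 0) (x ^+ 2) in
  let c := (Num.sqrt z)%:C / 2 * cpow (z / 2) (nu + 1 / 2) in
  cintegrable (Ktrans_integrand (nu + 1 / 2) (fun x => cpow x (nu + 1) * f x) z) ->
  cintegrable g /\
  Ktrans (nu + 1 / 2) (fun x => cpow x (nu + 1) * f x) z = c * cint g.
Proof.
move=> z0 hnu g c iK.
have a0 : 0 < re (nu + 1) by rewrite ReD /=; lra.
have z20 : 0 < z / 2 by rewrite divr_gt0.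
have c0 : c != 0.
  by rewrite mulf_neq0 ?cpow_neq0// mulf_neq0 ?invr_eq0 ?pnatr_eq0// real_complex_neq0// gt_eqF// sqrtr_gt0.
have E x : 0 < x -> Ktrans_integrand (nu + 1 / 2) (fun x => cpow x (nu + 1) * f x) z x = c * g x.
  move=> x0; rewrite /g (lap_vker_bessel_K z0 x0 a0) /Ktrans_integrand (sqrtM_cpow z x0).
  have -> : cpow (2 * x / z) (nu + 1 / 2) = cpow x (nu + 1 / 2) * cpow (z / 2) (- (nu + 1 / 2)).
    rewrite (_ : 2 * x / z = x * (z / 2)^-1); last by rewrite invf_div; ring.
    by rewrite cpowM ?invr_gt0// cpowV.
  have e1 : cpow x (1 / 2) * cpow x (nu + 1) = x%:C * cpow x (nu + 1 / 2).
    by rewrite -[x%:C](cpow1 x0) -!cpowD; congr cpow; ring.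
  have e2 : cpow (z / 2) (nu + 1 / 2) * cpow (z / 2) (- (nu + 1 / 2)) = 1.
    by rewrite -cpowD subrr cpow0.
  transitivity ((Num.sqrt z)%:C * bessel_K (nu + 1 / 2) (x * z) * f x *
      (cpow x (1 / 2) * cpow x (nu + 1))); first by ring.
  by rewrite e1 -[LHS]mulr1 -[X in _ * X = _]e2 /c; field.
have ig : cintegrable g.
  by apply: eq_cintegrable (cintegrableZ c^-1 (eq_cintegrable E iK)) => q _; rewrite mulKf.
by split => //; rewrite /Ktrans (eq_cint E) (cintZ _ ig).
Qed.

Lemma Glasser_integrable g u : cintegrable (Glasser_integrand g u) ->
  cintegrable (fun x => g x * ((Num.sqrt (x ^+ 2 + u ^+ 2))^-1)%:C).
Proof. by apply: eq_cintegrable => x _; rewrite /Glasser_integrand fmorphV. Qed.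

Lemma Hankel_kernel_Glasser f nu z : 0 < z ->
  let G u := cint (fun x => x%:C * f x * ((Num.sqrt (x ^+ 2 + u ^+ 2))^-1)%:C) in
  let gf u := cpow u (nu + 1 / 2) * Glasser (fun x => x%:C * f x) u in
  cintegrable (Hankel_integrand nu gf z) ->
  cintegrable (fun u => hankel_kernel nu z u * G u) /\
  Hankel nu gf z = (Num.sqrt z)%:C * cint (fun u => hankel_kernel nu z u * G u).
Proof.
move=> z0 G gf iH.
have c0 : (Num.sqrt z)%:C != 0 :> R[i] by rewrite real_complex_neq0// gt_eqF// sqrtr_gt0.
have GE u : Glasser (fun x => x%:C * f x) u = G u.
  by apply: eq_cint => x _; rewrite /Glasser_integrand fmorphV.
have E u : 0 < u -> Hankel_integrand nu gf z u = (Num.sqrt z)%:C * (hankel_kernel nu z u * G u).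
  move=> u0; rewrite /Hankel_integrand /gf GE (sqrtM_cpow z u0).
  have e1 : cpow u (1 / 2) * cpow u (nu + 1 / 2) = cpow u (nu + 1).
    by rewrite -cpowD; congr cpow; field.
  by rewrite /hankel_kernel -e1; ring.
have ig : cintegrable (fun u => hankel_kernel nu z u * G u).
  by apply: eq_cintegrable (cintegrableZ (Num.sqrt z)%:C^-1 (eq_cintegrable E iH)) => q _; rewrite mulKf.
by split => //; rewrite /Hankel (eq_cint E) (cintZ _ ig).
Qed.

End transform_integrands.

(** * Comparison of the constants *)

Section constants.
Context {R : realType}.
Variables (nu : R[i]) (z : R).
Hypothesis z0 : 0 < z.

Let i2 : (2 : R[i])^-1 = cpow (2 : R) (- 1).
Proof. by rewrite -invC_cpow// twoC. Qed.

Let p0 : (Num.sqrt pi)%:C != 0 :> R[i].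
Proof. by rewrite real_complex_neq0// gt_eqF// sqrtr_gt0 pi_gt0. Qed.

(** Used with [x = 2] and [y = z]: three powers of 2 combine to the one on the left, while the
    powers of [z] cancel. *)
Let mul_powers x y s1 s2 s3 t1 t2 t3 s : s1 + s2 + s3 = s -> t1 + t2 + t3 = 0 ->
  cpow x s = cpow x s1 * cpow x s2 * cpow x s3 * (cpow y t1 * cpow y t2 * cpow y t3) :> R[i].
Proof. by move=> <- e; rewrite -(cpowD y t1) -(cpowD y (t1 + t2)) e cpow0 mulr1 !cpowD. Qed.

Lemma iterated_L2_Ktrans_const :
  cpow (2 : R) (- (2 * nu) - 2) = cpow 2 (- nu - 1 / 2) * cpow z (- nu - 1) *
    ((Num.sqrt z)%:C / 2 * cpow (z / 2) (nu + 1 / 2)).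
Proof.
rewrite (cpow_half_arg _ z0) (sqrt_cpow z0).
have e1 : - nu - 1 / 2 + - 1 + - (nu + 1 / 2) = - (2 * nu) - 2 by field.
have e2 : - nu - 1 + 1 / 2 + (nu + 1 / 2) = 0 by field.
transitivity (cpow (2 : R) (- nu - 1 / 2) * cpow 2 (- 1) * cpow 2 (- (nu + 1 / 2)) *
  (cpow z (- nu - 1) * cpow z (1 / 2) * cpow z (nu + 1 / 2))).
  exact: mul_powers.
by rewrite -i2; ring.
Qed.

Lemma iterated_L2_Hankel_const :
  cpow (2 : R) (- (2 * nu) - 2) = (Num.sqrt pi)%:C / cpow 2 (nu + 1) *
    cpow z (- nu - 1 / 2) * (Num.sqrt z)%:C * hcst nu z.
Proof.
rewrite /hcst (cpow_half_arg _ z0) (sqrt_cpow z0) -cpowN.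
have e1 : - (nu + 1) + - nu + - 1 = - (2 * nu) - 2 by ring.
have e2 : - nu - 1 / 2 + 1 / 2 + nu = 0 by ring.
transitivity (cpow (2 : R) (- (nu + 1)) * cpow 2 (- nu) * cpow 2 (- 1) *
  (cpow z (- nu - 1 / 2) * cpow z (1 / 2) * cpow z nu)).
  exact: mul_powers.
by rewrite -i2; field.
Qed.

Lemma Ktrans_Hankel_const :
  (Num.sqrt z)%:C / 2 * cpow (z / 2) (nu + 1 / 2) =
  (Num.sqrt (pi * z / 2))%:C * (Num.sqrt z)%:C * hcst nu z.
Proof.
have -> : (Num.sqrt (pi * z / 2))%:C = (Num.sqrt pi)%:C * cpow (z / 2) (1 / 2) :> R[i].
  by rewrite -sqrt_cpow ?divr_gt0// -rmorphM -(sqrtrM _ (pi_ge0 R)) mulrA.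
by rewrite (addrC nu) cpowD /hcst; field.
Qed.

End constants.

Unset Implicit Arguments.

Theorem corollary7 (R : realType) (f : R -> R[i]) (z : R) (nu : R[i])
    (hz : 0 < z) (hnu1 : -1 < complex.Re nu) (hnu2 : complex.Re nu < 1 / 2) :
  let xf := fun x : R => x%:C * f x in
  let phi := fun y : R => cpow y (2 * nu - 1) * L2 f (1 / (2 * y)) in
  let kf := fun x : R => cpow x (nu + 1) * f x in
  let gf := fun u : R => cpow u (nu + 1 / 2) * Glasser xf u in
  let LLcvg := (forall y : R, 0 < y ->
                  cintegrable (L2_integrand f (1 / (2 * y))))
               /\ cintegrable (L2_integrand phi z) in
  let Kcvg := cintegrable (Ktrans_integrand (nu + 1 / 2) kf z) in
  let HGcvg := (forall u : R, 0 < u -> cintegrable (Glasser_integrand xf u))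
               /\ cintegrable (Hankel_integrand nu gf z) in
  [/\ LLcvg -> Kcvg ->
        L2 phi z = cpow 2 (- nu - 1 / 2) * cpow z (- nu - 1)
                   * Ktrans (nu + 1 / 2) kf z,
      LLcvg -> HGcvg ->
        L2 phi z = (Num.sqrt pi)%:C / cpow 2 (nu + 1)
                   * cpow z (- nu - 1 / 2) * Hankel nu gf z
    & Kcvg -> HGcvg ->
        Ktrans (nu + 1 / 2) kf z
        = (Num.sqrt (pi * z / 2))%:C * Hankel nu gf z].
Proof.
move=> xf phi kf gf LLcvg Kcvg HGcvg.
have b0 : 0 < z ^+ 2 / 4 by rewrite divr_gt0 ?exprn_gt0.
have a0 : 0 < complex.Re (nu + 1) by rewrite ReD /=; lra.
(* The same lemmas that rewrite the transforms carry their convergence hypotheses over, so each case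
   ends with one interchange theorem and one identity of constants. *)
split=> [[iH /iterated_L2_laplace[iLL ->]] /(Ktrans_laplace hz hnu1)[iK ->]
  |[iH /iterated_L2_laplace[iLL ->]] [iG /(Hankel_kernel_Glasser hz)[iHG ->]]
  |/(Ktrans_laplace hz hnu1)[iK ->] [iG /(Hankel_kernel_Glasser hz)[iHG ->]]].
- rewrite (laplace_macdonald b0 a0 (fun q q0 => L2_sqrt_integrable q0 iH) iLL iK).
  by rewrite [RHS]mulrA -(iterated_L2_Ktrans_const nu hz).
- rewrite (laplace_hankel hz hnu1 (fun u u0 => Glasser_integrable (iG u u0)) iHG
    (fun q q0 => L2_sqrt_integrable q0 iH) iLL).
  by rewrite 2![RHS]mulrA -(iterated_L2_Hankel_const nu hz).
- rewrite (macdonald_hankel hz hnu1 (fun u u0 => Glasser_integrable (iG u u0)) iHG iK).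
  by rewrite 2![RHS]mulrA -(Ktrans_Hankel_const nu hz).
Qed.
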